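(* Let $\nu\ge-1/2$, $N\in\{0,1,2,\ldots\}$, and $p\in(0,\infty]$. Then the limit relation $$\lim_{n\to\infty}n^{-2N-(2\nu+2)/p}\,\mathcal{C}_0\left(\mathcal{P}_{2\lfloor n/2\rfloor,1,e},\,L_{p,|t|^{2\nu+1}}([-1,1]),\,(Be_\nu)^N\right)=\mathcal{C}_0\left(E_{1,1,e}\cap L_{p,|t|^{2\nu+1}}(\mathbb{R}),\,L_{p,|t|^{2\nu+1}}(\mathbb{R}),\,(Be_\nu)^N\right)$$ is valid. In addition, there exists a function $f_0\in\left(E_{1,1,e}\cap L_{p,|t|^{2\nu+1}}(\mathbb{R})\right)\setminus\{0\}$ such that $$\lim_{n\to\infty}n^{-2N-(2\nu+2)/p}\,\mathcal{C}_0\left(\mathcal{P}_{2\lfloor n/2\rfloor,1,e},\,L_{p,|t|^{2\nu+1}}([-1,1]),\,(Be_\nu)^N\right)=\frac{\left\|(Be_\nu)^N(f_0)\right\|_{L_\infty(\mathbb{R})}}{\|f_0\|_{L_{p,|t|^{2\nu+1}}(\mathbb{R})}}.$$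
   Context: Sharp constant: for a space $\mathcal{B}\ne\{0\}$ of functions on $\Omega$ lying in a (quasi)normed function space $F(\Omega)$, a linear operator $D$ on $\mathcal{B}$, and $a\in\Omega$, $\mathcal{C}_a(\mathcal{B},F(\Omega),D):=\sup_{f\in\mathcal{B}\setminus\{0\}}|D(f)(a)|/\|f\|_{F(\Omega)}$. $\mathcal{P}_{n,1}$ is the set of univariate polynomials with complex coefficients of degree at most $n$, and $\mathcal{P}_{n,1,e}$ is the set of even polynomials in it (restricted to $[-1,1]$). $E_{\sigma,1}$ ($\sigma>0$) is the set of entire functions $f:\mathbb{C}\to\mathbb{C}$ such that for any $\varepsilon>0$ there is a constant $C_0(\varepsilon,f)$ with $|f(z)|\le C_0(\varepsilon,f)\exp(\sigma(1+\varepsilon)|z|)$, $z\in\mathbb{C}$, identified with their restrictions to $\mathbb{R}$; $E_{\sigma,1,e}$ is the set of even functions in $E_{\sigma,1}$. For a weight $\mu\ge0$ on $\Omega_1\subseteq\mathbb{R}$, $\|f\|_{L_{p,\mu(t)}(\Omega_1)}=\left(\int_{\Omega_1}|f(t)|^p\mu(t)\,dt\right)^{1/p}$ for $0<p<\infty$, and $\|f\|_{L_{\infty,\mu(t)}(\Omega_1)}=\operatorname{ess\,sup}_{\Omega_1}|f|$; $1/p:=0$ for $p=\infty$. The Bessel operator is $Be_\nu(\varphi)(r)=\varphi''(r)+\frac{2\nu+1}{r}\varphi'(r)$, with $Be_\nu(\varphi)(0):=\lim_{r\to0}Be_\nu(\varphi)(r)$; $(Be_\nu)^0$ is the identity (imbedding)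 operator. *)

(* Defs.v *)
From HB Require Import structures.
From mathcomp Require Import all_boot all_order all_algebra.
From mathcomp Require Import complex.
From mathcomp Require Import all_classical all_reals all_analysis.
From mathcomp Require Import ess_sup_inf.

Set Implicit Arguments.
Unset Strict Implicit.
Unset Printing Implicit Defensive.

Import Order.TTheory GRing.Theory Num.Theory.
Import numFieldNormedType.Exports.

Local Open Scope classical_set_scope.
Local Open Scope ring_scope.
Local Open Scope complex_scope.

(* The norm `|z| of z : R[i] is itself an element of R[i]; this is the
   corresponding real number. *)
Definition cmod (R : realType) (z : R[i]) : R := complex.Re `|z|.

(* [weighted_norm Om w p f] is meant for 0 < p <= +oo; the value at p = -oo is
   junk.  For p = +oo the weight plays no role; extending |f| by 0 outside Om
   does not change the essential supremum, as |f| is nonnegative and Om is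
   never a null set below. *)
Definition weighted_norm (R : realType) (Om : set R) (w : R -> R) (p : \bar R)
    (f : R -> R[i]) : \bar R :=
  match p with
  | r%:E => ((\int[lebesgue_measure]_(t in Om)
               (cmod (f t) `^ r * w t)%:E) `^ r^-1)%E
  | +oo%E => ess_sup lebesgue_measure ((fun t : R => (cmod (f t))%:E) \_ Om)
  | -oo%E => 0%E
  end.

Definition weighted_Lp (R : realType) (Om : set R) (w : R -> R) (p : \bar R) :
    set (R -> R[i]) :=
  [set f | [/\ measurable_fun Om (fun t => complex.Re (f t)),
               measurable_fun Om (fun t => complex.Im (f t)) &
               (weighted_norm Om w p f < +oo)%E]].

Definition nonzero_on (R : realType) (Om : set R) : set (R -> R[i]) :=
  [set f | exists2 t, Om t & f t != 0].

(* A function on Om is represented by a function on R whose values outside Om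
   are irrelevant to [nrm] and to [nonzero_on Om]. *)
Definition sharp_constant (R : realType) (Om : set R) (B : set (R -> R[i]))
    (nrm : (R -> R[i]) -> \bar R) (D : (R -> R[i]) -> R -> R[i]) (a : R) :
    \bar R :=
  ereal_sup [set ((cmod (D f a))%:E / nrm f)%E | f in B `&` nonzero_on Om].

Definition poly_deg_le (R : realType) (n : nat) : set {poly R[i]} :=
  [set q | (size q <= n.+1)%N].

Definition even_poly_deg_le (R : realType) (n : nat) : set (R -> R[i]) :=
  [set (fun t : R => q.[t%:C]) |
    q in @poly_deg_le R n `&` [set q | forall z, q.[- z] = q.[z]]].

(* [derivable F z 1] is differentiability over the field R[i]. *)
Definition entire (R : realType) (F : R[i] -> R[i]) : Prop :=
  forall z : R[i], derivable (F : R[i]^o -> R[i]^o) z 1.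

Definition exp_type (R : realType) (sigma : R) : set (R[i] -> R[i]) :=
  [set F | entire F /\
    forall eps : R, 0 < eps -> exists C0 : R, forall z : R[i],
      cmod (F z) <= C0 * expR (sigma * (1 + eps) * cmod z)].

Definition even_exp_type (R : realType) (sigma : R) : set (R -> R[i]) :=
  [set (fun t : R => F t%:C) |
    F in exp_type sigma `&` [set F | forall z, F (- z) = F z]].

(* Componentwise, since R[i] carries no normed module structure over R. *)
Definition cderive (R : realType) (phi : R -> R[i]) (r : R) : R[i] :=
  derive1 (fun t => complex.Re (phi t)) r
  +i* derive1 (fun t => complex.Im (phi t)) r.

Definition bessel (R : realType) (nu : R) (phi : R -> R[i]) (r : R) : R[i] :=
  let B s := cderive (cderive phi) s
             + ((2 * nu + 1) / s)%:C * cderive phi s in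
  if r == 0 then lim ((B s : R[i]^o) @[s --> 0^']) else B r.

Definition bessel_weight (R : realType) (nu : R) (t : R) : R :=
  `|t| `^ (2 * nu + 1).

(* Main.v *)
Require Import Defs.
From HB Require Import structures.
From mathcomp Require Import all_boot all_order all_algebra.
From mathcomp Require Import complex.
From mathcomp Require Import all_classical all_reals all_analysis.
From mathcomp Require Import measurable_realfun ess_sup_inf ring lra zify.

Set Implicit Arguments.
Unset Strict Implicit.
Unset Printing Implicit Defensive.

Import Order.TTheory GRing.Theory Num.Theory.
Import numFieldNormedType.Exports.

Local Open Scope classical_set_scope.
Local Open Scope ring_scope.
Local Open Scope complex_scope.

(* For a power series the operator acts on coefficients, and the value at 0 of its N-th iterate is a positive
   constant times the coefficient of z^(2N).  Rescaled from [-1,1] to [-n,n], the polynomial problem becomes: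
   maximize that coefficient of an even polynomial of degree at most n under the weighted norm on [-n,n].

   Upper bound: near-optimal polynomials are bounded inside [-n,n] by a Nikolskii inequality, so the
   Bernstein-Walsh inequality bounds their coefficients like those of functions of exponential type 1.
   A coefficientwise limit is an even entire function of type 1, with norm at most 1 by Fatou's lemma, and it is
   extremal.

   Lower bound: a competitor f is bounded on the real line, and its dilation f(l z) with l < 1 grows at most
   like exp(sg |Im z|) with sg < 1 by the Phragmen-Lindelof principle.  Its Chebyshev expansion on [-n,n]
   truncated at degree n therefore has an exponentially small error, which does not affect the norm in the limit.

   A suitable dilation of the extremal function gives f_0. *)

(** * The complex modulus *)

(** For p < 1 the norm is only a quasinorm, so norms are compared pointwise or by Fatou's lemma and
    never through a triangle inequality. The weight may vanish at [0]; lower bounds for norms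
    therefore use intervals no longer than their distance from [0].

    Near the endpoints of [-n, n] polynomials of bounded norm need not be uniformly bounded. The
    Nikolskii bound holds on (1 - d) [-n, n] for fixed d only, which yields type 1 / (1 - d); that d
    is arbitrary gives type 1 in the limit.

    Type 1 itself leaves no room for the Chebyshev truncation. On an ellipse of height about h n the
    coefficients gain (1 + h)^n and the function costs exp(sg h n), which is favourable for small h
    only if sg < 1. This is why competitors are dilated first.

    The supremum of the modulus of (Be_nu)^N f over the real line may exceed its value at [0], so an
    extremal function for the value at [0] need not have the ratio required of f_0. Dilation lowers
    that ratio continuously. *)

Section Cmod.
Context {R : realType}.
Implicit Types (x y : R) (z w : R[i]).

Lemma cmodE z : `|z| = (cmod z)%:C.
Proof. by rewrite /cmod normc_def. Qed.

Lemma cmod_sqrt z : cmod z = Num.sqrt (complex.Re z ^+ 2 + complex.Im z ^+ 2).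
Proof. by rewrite /cmod normc_def. Qed.

Lemma cmod_ge0 z : 0 <= cmod z.
Proof. by rewrite cmod_sqrt sqrtr_ge0. Qed.

Lemma cmod_sqr z : cmod z ^+ 2 = complex.Re z ^+ 2 + complex.Im z ^+ 2.
Proof. by rewrite cmod_sqrt sqr_sqrtr // addr_ge0 ?sqr_ge0. Qed.

Lemma cmodM z w : cmod (z * w) = cmod z * cmod w.
Proof. by have := normrM z w; rewrite !cmodE -rmorphM => /complexI. Qed.

Lemma cmodD z w : cmod (z + w) <= cmod z + cmod w.
Proof. by have := ler_normD z w; rewrite !cmodE -rmorphD lecR. Qed.

Lemma cmodN z : cmod (- z) = cmod z.
Proof. by rewrite /cmod normrN. Qed.

Lemma cmodB z w : cmod (z - w) <= cmod z + cmod w.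
Proof. by rewrite -(cmodN w) cmodD. Qed.

Lemma cmod_distC z w : cmod (z - w) = cmod (w - z).
Proof. by rewrite -cmodN opprB. Qed.

Lemma cmod0 : cmod (0 : R[i]) = 0.
Proof. by rewrite /cmod normr0. Qed.

Lemma cmod1 : cmod (1 : R[i]) = 1.
Proof. by rewrite /cmod normr1. Qed.

Lemma cmod_eq0 z : (cmod z == 0) = (z == 0).
Proof.
have := normr_eq0 z; rewrite cmodE => <-.
by rewrite -[0 in RHS]/((0 : R)%:C) (inj_eq (@complexI R)).
Qed.

Lemma cmod_gt0 z : (0 < cmod z) = (z != 0).
Proof. by rewrite lt_def cmod_ge0 andbT cmod_eq0. Qed.

Lemma cmodX z n : cmod (z ^+ n) = cmod z ^+ n.
Proof. by elim: n => [|n IH]; rewrite ?cmod1 // !exprS cmodM IH. Qed.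

Lemma cmodV z : cmod z^-1 = (cmod z)^-1.
Proof. by have := normfV z; rewrite !cmodE -fmorphV => /complexI. Qed.

Lemma cmod_real x : cmod x%:C = `|x|.
Proof. by rewrite cmod_sqrt /= expr0n addr0 sqrtr_sqr. Qed.

Lemma cmod_i : cmod ('i : R[i]) = 1.
Proof. by rewrite cmod_sqrt /= expr0n add0r expr1n sqrtr1. Qed.

Lemma cmod_nat n : cmod (n%:R : R[i]) = n%:R.
Proof. by rewrite -(rmorph_nat (real_complex R)) cmod_real normr_nat. Qed.

Lemma cmod_Re z : `|complex.Re z| <= cmod z.
Proof.
rewrite -sqrtr_sqr cmod_sqrt ler_wsqrtr // lerDl sqr_ge0 //.
Qed.

Lemma cmod_Im z : `|complex.Im z| <= cmod z.
Proof.
rewrite -sqrtr_sqr cmod_sqrt ler_wsqrtr // lerDr sqr_ge0 //.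
Qed.

Lemma complexEr z : z = (complex.Re z)%:C + 'i * (complex.Im z)%:C.
Proof. exact: complexE. Qed.

Lemma cmod_le_ReIm z : cmod z <= `|complex.Re z| + `|complex.Im z|.
Proof.
rewrite {1}[z]complexEr (le_trans (cmodD _ _)) // cmodM cmod_i mul1r !cmod_real //.
Qed.

Lemma cmod_sum I (r : seq I) (P : pred I) (F : I -> R[i]) :
  cmod (\sum_(i <- r | P i) F i) <= \sum_(i <- r | P i) cmod (F i).
Proof.
elim/big_ind2 : _ => //; first by rewrite cmod0.
by move=> a b c d ab cd; rewrite (le_trans (cmodD _ _)) // lerD.
Qed.

Lemma cmod_lerB z w : cmod z - cmod w <= cmod (z - w).
Proof. by rewrite lerBlDr (le_trans _ (cmodD _ _)) // subrK. Qed.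

Lemma cmod_leB z w : `|cmod z - cmod w| <= cmod (z - w).
Proof.
by rewrite ler_norml cmod_lerB lerNl opprB cmod_distC cmod_lerB.
Qed.

Lemma cmod_dist_triangle v z w : cmod (z - w) <= cmod (z - v) + cmod (v - w).
Proof. by rewrite -[z - w](subrKA v) cmodD. Qed.

Lemma cmod_conj z : cmod z^*%C = cmod z.
Proof. by rewrite /cmod normcJ. Qed.

Lemma cReD z w : complex.Re (z + w) = complex.Re z + complex.Re w.
Proof. by case: z; case: w. Qed.
Lemma cImD z w : complex.Im (z + w) = complex.Im z + complex.Im w.
Proof. by case: z; case: w. Qed.
Lemma cReN z : complex.Re (- z) = - complex.Re z. Proof. by case: z. Qed.
Lemma cImN z : complex.Im (- z) = - complex.Im z. Proof. by case: z. Qed.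
Lemma cReB z w : complex.Re (z - w) = complex.Re z - complex.Re w.
Proof. by rewrite cReD cReN. Qed.
Lemma cImB z w : complex.Im (z - w) = complex.Im z - complex.Im w.
Proof. by rewrite cImD cImN. Qed.
Lemma cReM z w :
  complex.Re (z * w) = complex.Re z * complex.Re w - complex.Im z * complex.Im w.
Proof. by case: z; case: w. Qed.
Lemma cImM z w :
  complex.Im (z * w) = complex.Re z * complex.Im w + complex.Im z * complex.Re w.
Proof. by case: z => a b; case: w => c d. Qed.
Lemma cRe_sum I (r : seq I) (P : pred I) (F : I -> R[i]) :
  complex.Re (\sum_(i <- r | P i) F i) = \sum_(i <- r | P i) complex.Re (F i).
Proof. by elim/big_ind2 : _ => // a b c d <- <-; rewrite cReD. Qed.
Lemma cIm_sum I (r : seq I) (P : pred I) (F : I -> R[i]) :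
  complex.Im (\sum_(i <- r | P i) F i) = \sum_(i <- r | P i) complex.Im (F i).
Proof. by elim/big_ind2 : _ => // a b c d <- <-; rewrite cImD. Qed.

Lemma complex_ext z w : complex.Re z = complex.Re w -> complex.Im z = complex.Im w -> z = w.
Proof. by case: z; case: w => /= ? ? ? ? -> ->. Qed.

End Cmod.

Section Cdiff.
Context {R : realType}.
Implicit Types (F G : R[i] -> R[i]) (z w h : R[i]).

(** Remainder form with real radii: the norm of [R[i]] takes values in [R[i]], whose order is
    partial. *)
Definition cderivative F z (D : R[i]) := forall e : R, 0 < e -> exists2 d : R, 0 < d &
  forall h, cmod h < d -> cmod (F (z + h) - F z - D * h) <= e * cmod h.

Lemma derivable_cderivative F z :
  derivable (F : R[i]^o -> R[i]^o) z 1 -> exists D, cderivative F z D.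
Proof.
move=> /cvg_ex [/= D dF]; exists D => e e0.
move/cvgrPdist_le : dF => /(_ e%:C); rewrite ltcR => /(_ e0).
case=> [[d dI]] /= /[1!ltcE] /= /andP[/eqP dI0 d0] H; exists d => // h hd.
have [->|h0] := eqVneq h 0; first by rewrite addr0 subrr mulr0 subr0 cmod0 mulr0.
have /H /(_ h0) : ball_ Num.Def.normr (0 : R[i]) (d +i* dI) h.
  by rewrite /ball_ /= sub0r normrN cmodE ltcE /= dI0 eqxx.
rewrite [h *: 1]mulr1 cmodE lecR => {}H.
have -> : F (z + h) - F z - D * h = - h * (D - h^-1 * (F (h + z) - F z)).
  by rewrite [h + z]addrC; field.
by rewrite cmodM cmodN mulrC ler_wpM2r ?cmod_ge0.
Qed.

Lemma cderivative_derivable F z D :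
  cderivative F z D -> derivable (F : R[i]^o -> R[i]^o) z 1.
Proof.
move=> dF; apply/cvg_ex; exists (D : R[i]^o); apply/cvgrPdist_le => -[e eI].
rewrite ltcE /= => /andP[/eqP eI0 e0]; case: (dF _ e0) => d d0 H.
exists (d%:C); first by rewrite /= ltcR.
move=> h; rewrite /ball_ /= sub0r normrN cmodE ltcR => hd h0.
rewrite [h *: 1]mulr1 cmodE lecE /= eI0 eqxx /=.
have -> : D - h^-1 *: (F (h + z) - F z) = - h^-1 * (F (z + h) - F z - D * h).
  by rewrite -[_ *: _]/(h^-1 * (F (h + z) - F z)) [h + z]addrC; field.
rewrite cmodM cmodN cmodV ler_pdivrMl ?cmod_gt0 // [leRHS]mulrC.
exact: H.
Qed.

End Cdiff.

(** * Integrals of complex-valued functions of a real variable *)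

Section Cint.
Context {R : realType}.
Implicit Types (x y a b c t : R) (g : R -> R[i]).
Local Notation mu := (@lebesgue_measure R).

Definition rcont g := continuous (fun t => complex.Re (g t)) /\
                      continuous (fun t => complex.Im (g t)).

Definition cint a b g : R[i] :=
  (\int[mu]_(t in `[a, b]) complex.Re (g t)) +i*
  (\int[mu]_(t in `[a, b]) complex.Im (g t)).

Lemma rcontP g : (forall t e, 0 < e -> exists2 d, 0 < d &
  forall s, `|s| < d -> cmod (g (t + s) - g t) <= e) <-> rcont g.
Proof.
split=> [H|[H1 H2] t e e0].
  split=> t; apply/cvgrPdist_le => e e0; have [d d0 Hd] := H t e e0;
    exists d => // s /=; rewrite distrC => sd; rewrite distrC;
    have E : t + (s - t) = s by ring.
    by rewrite -cReB (le_trans (cmod_Re _)) // -E; exact: Hd.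
  by rewrite -cImB (le_trans (cmod_Im _)) // -E; exact: Hd.
have e2 : 0 < e / 2 by lra.
move/(_ t)/cvgrPdist_le/(_ _ e2) : H1 => [d1 /= d10 Hd1].
move/(_ t)/cvgrPdist_le/(_ _ e2) : H2 => [d2 /= d20 Hd2].
exists (Num.min d1 d2); first by rewrite lt_min d10.
move=> s; rewrite lt_min => /andP[s1 s2].
rewrite (le_trans (cmod_le_ReIm _)) // cReB cImB (splitr e) distrC [X in _ + X]distrC lerD //.
  by apply: Hd1; rewrite /ball_ /= opprD addrA subrr sub0r normrN.
by apply: Hd2; rewrite /ball_ /= opprD addrA subrr sub0r normrN.
Qed.

Lemma continuous_itv_integrable a b (f : R -> R) : continuous f ->
  mu.-integrable `[a, b] (EFin \o f).
Proof.
move=> cf; apply: continuous_compact_integrable; first exact: segment_compact.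
exact: continuous_subspaceT.
Qed.
Hint Resolve continuous_itv_integrable : core.

Lemma rcontD g1 g2 : rcont g1 -> rcont g2 -> rcont (fun t => g1 t + g2 t).
Proof.
move=> [c1 c2] [d1 d2]; split; [under eq_fun do rewrite cReD|under eq_fun do rewrite cImD];
  by move=> t; apply: cvgD; first [exact: c1|exact: c2|exact: d1|exact: d2].
Qed.

Lemma rcont_cst k : rcont (fun=> k).
Proof. by split=> t; exact: cvg_cst. Qed.

Lemma rcontM g1 g2 : rcont g1 -> rcont g2 -> rcont (fun t => g1 t * g2 t).
Proof.
move=> [c1 c2] [d1 d2]; split; [under eq_fun do rewrite cReM|under eq_fun do rewrite cImM].
  by move=> t; apply: cvgB; apply: cvgM; first [exact: c1|exact: c2|exact: d1|exact: d2].
by move=> t; apply: cvgD; apply: cvgM; first [exact: c1|exact: c2|exact: d1|exact: d2].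
Qed.

Lemma rcontN g : rcont g -> rcont (fun t => - g t).
Proof.
move=> [c1 c2]; split; [under eq_fun do rewrite cReN|under eq_fun do rewrite cImN];
  by move=> t; apply: cvgN; first [exact: c1|exact: c2].
Qed.

Lemma rcontB g1 g2 : rcont g1 -> rcont g2 -> rcont (fun t => g1 t - g2 t).
Proof. by move=> c1 c2; apply: rcontD => //; exact: rcontN. Qed.

Lemma eq_cint a b g1 g2 : (forall t, a <= t <= b -> g1 t = g2 t) ->
  cint a b g1 = cint a b g2.
Proof.
move=> H; congr Complex; apply: eq_Rintegral => t; rewrite inE /= in_itv /= => /H -> //.
Qed.

Lemma cintD a b g1 g2 : rcont g1 -> rcont g2 ->
  cint a b (fun t => g1 t + g2 t) = cint a b g1 + cint a b g2.
Proof.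
move=> [c1 c2] [d1 d2]; rewrite /cint.
rewrite (_ : (fun t => _) = (fun t => complex.Re (g1 t) + complex.Re (g2 t))); last first.
  by apply/funext => t; rewrite cReD.
rewrite (_ : (fun t => complex.Im _) = (fun t => complex.Im (g1 t) + complex.Im (g2 t))); last first.
  by apply/funext => t; rewrite cImD.
by rewrite !RintegralD //; auto.
Qed.

Lemma cintZ a b k g : rcont g -> cint a b (fun t => k * g t) = k * cint a b g.
Proof.
move=> [c1 c2]; case: k => u v; rewrite /cint.
have cZ (w : R) (f : R -> R) : continuous f -> continuous (fun t => w * f t).
  by move=> cf t; apply: cvgM; [exact: cvg_cst|exact: cf].
rewrite (_ : (fun t => _) = (fun t => u * complex.Re (g t) - v * complex.Im (g t))); last first.
  by apply/funext => t; rewrite cReM.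
rewrite (_ : (fun t => complex.Im _) = (fun t => u * complex.Im (g t) + v * complex.Re (g t))); last first.
  by apply/funext => t; rewrite cImM.
rewrite RintegralB //; auto. rewrite RintegralD //; auto.
by rewrite !RintegralZl //; auto.
Qed.

Lemma cintN a b g : rcont g -> cint a b (fun t => - g t) = - cint a b g.
Proof.
move=> cg; rewrite -mulN1r -cintZ //; apply: eq_cint => t _; by rewrite mulN1r.
Qed.

Lemma cintB a b g1 g2 : rcont g1 -> rcont g2 ->
  cint a b (fun t => g1 t - g2 t) = cint a b g1 - cint a b g2.
Proof. by move=> c1 c2; rewrite cintD ?cintN //; exact: rcontN. Qed.

Lemma cint_cst a b k : a <= b -> cint a b (fun=> k) = (b - a)%:C * k.
Proof.
move=> ab; rewrite /cint !Rintegral_cst //= lebesgue_measure_itv /= lte_fin.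
move: ab; rewrite le_eqVlt => /orP[/eqP ->|ab].
  by rewrite ltxx /= !mulr0 subrr mul0r.
by rewrite ab -EFinD /=; case: k => u v; apply: complex_ext; rewrite ?cReM ?cImM /=; ring.
Qed.

Lemma cint_cat a b c g : rcont g -> a <= b -> b <= c ->
  cint a c g = cint a b g + cint b c g.
Proof.
move=> [c1 c2] ab bc.
have H (f : R -> R) : continuous f -> (\int[mu]_(t in `[a, c]) f t =
  \int[mu]_(t in `[a, b]) f t + \int[mu]_(t in `[b, c]) f t).
  move=> cf; have := @Rintegral_itvB _ f (BLeft a) (BRight c) b (continuous_itv_integrable a c cf).
  rewrite !bnd_simp ab bc => /(_ isT isT) E.
  rewrite -[X in _ + X]Rintegral_itv_obnd_cbnd; last first.
    by apply: integrableS (continuous_itv_integrable b c cf) => //; exact: subset_itv_oc_cc.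
  by rewrite -E addrC subrK.
by rewrite /cint !H.
Qed.

(** The factor [2] comes from estimating real and imaginary parts separately. It passes into the
    Cauchy estimates, where it is harmless: taking powers removes it in [bernstein_walsh1], and
    elsewhere only rates of growth count. *)
Lemma cint_le a b g M : rcont g -> a <= b -> (forall t, a <= t <= b -> cmod (g t) <= M) ->
  cmod (cint a b g) <= 2 * (b - a) * M.
Proof.
move=> [c1 c2] ab gM.
have H (f : R -> R) : continuous f -> (forall t, a <= t <= b -> `|f t| <= M) ->
    `|\int[mu]_(t in `[a, b]) f t| <= (b - a) * M.
  move=> cf fM; rewrite (le_trans (le_normr_Rintegral _ _)) //; auto.
  apply: (@le_trans _ _ (\int[mu]_(t in `[a, b]) M)).
    apply: le_Rintegral => //; auto.
    - apply: (@continuous_itv_integrable _ _ (fun x => `|f x|)) => t.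
      by apply: cvg_norm; exact: cf.
    - by apply: (@continuous_itv_integrable _ _ (cst M)) => t; exact: cvg_cst.
  have /(congr1 (@complex.Re R)) := cint_cst M%:C ab.
  by rewrite /cint /= mul0r subr0 => ->.
rewrite (le_trans (cmod_le_ReIm _)) // /cint /= -mulrA mulr2n mulrDl mul1r lerD // H // => t tab;
  by rewrite (le_trans _ (gM _ tab)) // ?cmod_Re ?cmod_Im.
Qed.

End Cint.

(** * Goursat's lemma *)

Section Goursat.
Context {R : realType}.
Implicit Types (x y a b c t : R) (g : R[i] -> R[i]).

Definition ccont g (z : R[i]) := forall e : R, 0 < e -> exists2 d, 0 < d &
  forall h, cmod h < d -> cmod (g (z + h) - g z) <= e.

Lemma ccont_rcont_h g y : (forall z, ccont g z) -> rcont (fun t => g (t +i* y)).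
Proof.
move=> cg; apply/rcontP => t e /(cg (t +i* y))[d d0 H]; exists d => // s sd.
have -> : (t + s) +i* y = (t +i* y) + s%:C by apply: complex_ext => /=; ring.
by apply: H; rewrite cmod_real.
Qed.

Lemma ccont_rcont_v g x : (forall z, ccont g z) -> rcont (fun t => g (x +i* t)).
Proof.
move=> cg; apply/rcontP => t e /(cg (x +i* t))[d d0 H]; exists d => // s sd.
have -> : x +i* (t + s) = (x +i* t) + 'i * s%:C.
  by apply: complex_ext; rewrite ?cReD ?cImD ?cReM ?cImM /=; ring.
by apply: H; rewrite cmodM cmod_i mul1r cmod_real.
Qed.

Variable g : R[i] -> R[i].
Hypothesis cg : forall z, ccont g z.

Let H x y A := cint x (x + A) (fun t => g (t +i* y)).
Let V x y B := cint y (y + B) (fun t => g (x +i* t)).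

(** The counterclockwise boundary integral of [g] over the rectangle with lower left corner
    [x +i* y] and sides [A], [B]. *)
Definition rect_int x y A B : R[i] :=
  H x y A - H x (y + B) A + 'i * (V (x + A) y B - V x y B).

Lemma rect_int_split x y A B : 0 <= A -> 0 <= B ->
  rect_int x y A B =
  (rect_int x y (A / 2) (B / 2) + rect_int (x + A / 2) y (A / 2) (B / 2)) +
  (rect_int x (y + B / 2) (A / 2) (B / 2) +
   rect_int (x + A / 2) (y + B / 2) (A / 2) (B / 2)).
Proof.
move=> A0 B0.
have e2 (u v : R) : u + v / 2 + v / 2 = u + v by field.
have Hs u v : H u v A = H u v (A / 2) + H (u + A / 2) v (A / 2).
  rewrite /H e2; apply: cint_cat; first exact: ccont_rcont_h.
    by rewrite lerDl divr_ge0.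
  by rewrite lerD2l ler_pdivrMr // mulr2n mulrDr mulr1 lerDl.
have Vs u v : V u v B = V u v (B / 2) + V u (v + B / 2) (B / 2).
  rewrite /V e2; apply: cint_cat; first exact: ccont_rcont_v.
    by rewrite lerDl divr_ge0.
  by rewrite lerD2l ler_pdivrMr // mulr2n mulrDr mulr1 lerDl.
rewrite /rect_int !Hs !Vs !e2; ring.
Qed.

Lemma rect_int_local x y A B (z D : R[i]) e : 0 <= A -> 0 <= B -> 0 <= e ->
  (forall u v, x <= u <= x + A -> y <= v <= y + B ->
     cmod (g (u +i* v) - g z - D * ((u +i* v) - z)) <= e) ->
  cmod (rect_int x y A B) <= 4 * e * (A + B).
Proof.
move=> A0 B0 e0 He.
have xA : x <= x + A by rewrite lerDl.
have yB : y <= y + B by rewrite lerDl.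
(* Opposite edges are paired. On such a pair the affine part [g z + D * (w - z)] differs by a
   constant, and the two constants contribute opposite multiples of [A * B], so they can be
   subtracted from the integrands. *)
pose h := fun t => g (t +i* y) - g (t +i* (y + B)) + D * 'i * B%:C.
pose v := fun t => g ((x + A) +i* t) - g (x +i* t) - D * A%:C.
have ch k : rcont (fun t => g (t +i* k)) by exact: ccont_rcont_h.
have cv k : rcont (fun t => g (k +i* t)) by exact: ccont_rcont_v.
have rh : rcont h by apply: rcontD; [exact: rcontB|exact: rcont_cst].
have rv : rcont v by apply: rcontB; [exact: rcontB|exact: rcont_cst].
have -> : rect_int x y A B = cint x (x + A) h + 'i * cint y (y + B) v.
  rewrite /rect_int /H /V /h /v cintD ?cintB //; do ?[exact: rcontB|exact: rcont_cst].
  rewrite !cint_cst // [x + A - x]addrC addKr [y + B - y]addrC addKr.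
  ring.
have p2 (p q : R[i]) : cmod p <= e -> cmod q <= e -> cmod (p - q) <= 2 * e.
  by move=> pe qe; rewrite (le_trans (cmodB _ _)) // mulr2n mulrDl !mul1r lerD.
have hb t : x <= t <= x + A -> cmod (h t) <= 2 * e.
  move=> tx.
  have -> : h t = (g (t +i* y) - g z - D * ((t +i* y) - z)) -
       (g (t +i* (y + B)) - g z - D * ((t +i* (y + B)) - z)).
    rewrite /h; have -> : t +i* (y + B) = (t +i* y) + 'i * B%:C.
      by apply: complex_ext; rewrite ?cReD ?cImD ?cReM ?cImM /=; ring.
    ring.
  by apply: p2; apply: He => //; lra.
have vb t : y <= t <= y + B -> cmod (v t) <= 2 * e.
  move=> ty.
  have -> : v t = (g ((x + A) +i* t) - g z - D * (((x + A) +i* t) - z)) -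
       (g (x +i* t) - g z - D * ((x +i* t) - z)).
    rewrite /v; have -> : (x + A) +i* t = (x +i* t) + A%:C.
      by apply: complex_ext; rewrite ?cReD ?cImD ?cReM ?cImM /=; ring.
    ring.
  by apply: p2; apply: He => //; lra.
rewrite (le_trans (cmodD _ _)) // cmodM cmod_i mul1r.
have := cint_le rh xA hb; have := cint_le rv yB vb.
rewrite [x + A - x]addrC addKr [y + B - y]addrC addKr => h1 h2.
by rewrite (le_trans (lerD h2 h1)) // [leRHS](_ : _ = 2 * A * (2 * e) + 2 * B * (2 * e)) //; ring.
Qed.

(** Selects a quarter that carries at least a fourth of the integral. The last quarter needs no
    test, since all four cannot fail at once. *)
Definition bisect (p : R * R * R * R) : R * R * R * R :=
  let: (x, y, A, B) := p in
  let I := cmod (rect_int x y A B) in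
  let ok u v := I <= 4 * cmod (rect_int u v (A / 2) (B / 2)) in
  if ok x y then (x, y, A / 2, B / 2)
  else if ok (x + A / 2) y then (x + A / 2, y, A / 2, B / 2)
  else if ok x (y + B / 2) then (x, y + B / 2, A / 2, B / 2)
  else (x + A / 2, y + B / 2, A / 2, B / 2).

Lemma bisectP x y A B : 0 <= A -> 0 <= B -> exists u v,
  [/\ bisect (x, y, A, B) = (u, v, A / 2, B / 2),
      x <= u <= x + A / 2, y <= v <= y + B / 2 &
      cmod (rect_int x y A B) <= 4 * cmod (rect_int u v (A / 2) (B / 2))].
Proof.
move=> A0 B0; rewrite /bisect.
have A2 : 0 <= A / 2 by rewrite divr_ge0.
have B2 : 0 <= B / 2 by rewrite divr_ge0.
have [h1|h1] := leP; first by exists x, y; split; rewrite ?lexx ?lerDl ?A2 ?B2.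
have [h2|h2] := leP; first by exists (x + A / 2), y; split; rewrite ?lexx ?lerDl ?A2 ?B2.
have [h3|h3] := leP; first by exists x, (y + B / 2); split; rewrite ?lexx ?lerDl ?A2 ?B2.
exists (x + A / 2), (y + B / 2); split; rewrite ?lexx ?lerDl ?A2 ?B2 //.
rewrite leNgt; apply/negP => h4.
have := rect_int_split x y A0 B0; move: h1 h2 h3 h4.
set r1 := rect_int x y (A / 2) (B / 2).
set r2 := rect_int (x + A / 2) y (A / 2) (B / 2).
set r3 := rect_int x (y + B / 2) (A / 2) (B / 2).
set r4 := rect_int (x + A / 2) (y + B / 2) (A / 2) (B / 2).
move=> h1 h2 h3 h4 E; rewrite {}E in h1 h2 h3 h4.
have := le_trans (cmodD (r1 + r2) (r3 + r4)) (lerD (cmodD r1 r2) (cmodD r3 r4)).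
move: (cmod (r1 + r2 + (r3 + r4))) (cmod r1) (cmod r2) (cmod r3) (cmod r4) h1 h2 h3 h4 => {}A0 a b c d.
clear; lra.
Qed.

Theorem goursat_rectangle x y A B : 0 <= A -> 0 <= B ->
  (forall u v, x <= u <= x + A -> y <= v <= y + B ->
     exists D, cderivative g (u +i* v) D) ->
  rect_int x y A B = 0.
Proof.
move=> A0 B0 dg; pose s n := iter n bisect (x, y, A, B).
pose u n := (s n).1.1.1; pose v n := (s n).1.1.2.
have P n : [/\ s n = (u n, v n, A / 2 ^+ n, B / 2 ^+ n) &
   cmod (rect_int x y A B) <= 4 ^+ n * cmod (rect_int (u n) (v n) (A / 2 ^+ n) (B / 2 ^+ n))]
  /\ [/\ u n <= u n.+1, u n.+1 + A / 2 ^+ n.+1 <= u n + A / 2 ^+ n, v n <= v n.+1 &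
      v n.+1 + B / 2 ^+ n.+1 <= v n + B / 2 ^+ n].
  have e2 (a : R) k : a / 2 ^+ k.+1 = a / 2 ^+ k / 2.
    by rewrite exprS invfM; ring.
  have half (a : R) k : a / 2 ^+ k = a / 2 ^+ k.+1 + a / 2 ^+ k.+1.
    by rewrite e2; field; rewrite gt_eqF // exprn_gt0.
  have step k : s k = (u k, v k, A / 2 ^+ k, B / 2 ^+ k) -> exists u' v',
     [/\ s k.+1 = (u', v', A / 2 ^+ k.+1, B / 2 ^+ k.+1),
      u k <= u' <= u k + A / 2 ^+ k.+1, v k <= v' <= v k + B / 2 ^+ k.+1 &
      cmod (rect_int (u k) (v k) (A / 2 ^+ k) (B / 2 ^+ k)) <=
      4 * cmod (rect_int u' v' (A / 2 ^+ k.+1) (B / 2 ^+ k.+1))].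
    move=> E; have k0 : 0 <= (2 : R) ^+ k by rewrite exprn_ge0.
    have [a [b]] := bisectP (u k) (v k) (divr_ge0 A0 k0) (divr_ge0 B0 k0).
    rewrite -E -[bisect _]/(s k.+1) -!e2 => H'; exists a, b; exact: H'.
  elim: n => [|n [[E I] _]].
    have E0 : s 0%N = (u 0%N, v 0%N, A / 2 ^+ 0, B / 2 ^+ 0).
      by rewrite expr0 !divr1.
    split.
      by rewrite expr0 !divr1 mul1r; split => //; rewrite /u /v /s /=.
    have [u' [v' [E1 /andP[a1 a2] /andP[a3 a4] a5]]] := step 0%N E0.
    have -> : u 1%N = u' by rewrite /u E1.
    have -> : v 1%N = v' by rewrite /v E1.
    by split; rewrite // (half _ 0%N) addrA lerD2r.
  have [u' [v' [E1 /andP[a1 a2] /andP[a3 a4] a5]]] := step n E.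
  have Eu : u n.+1 = u' by rewrite /u E1.
  have Ev : v n.+1 = v' by rewrite /v E1.
  have E1' : s n.+1 = (u n.+1, v n.+1, A / 2 ^+ n.+1, B / 2 ^+ n.+1) by rewrite Eu Ev.
  split.
    rewrite -Eu -Ev in a1 a2 a3 a4 a5.
    split => //.
    rewrite (le_trans I) // exprSr -mulrA ler_wpM2l // exprn_ge0 //.
  have [u2 [v2 [F1 /andP[b1 b2] /andP[b3 b4] b5]]] := step n.+1 E1'.
  have -> : u n.+2 = u2 by rewrite /u F1.
  have -> : v n.+2 = v2 by rewrite /v F1.
  by split; rewrite // (half _ n.+1) addrA lerD2r.
(* Left ends increase and right ends decrease, so the supremum of the left ends lies in every
   interval. *)
have lim_ex (w : nat -> R) (K : R) : 0 <= K -> (forall n, w n <= w n.+1) ->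
   (forall n, w n.+1 + K / 2 ^+ n.+1 <= w n + K / 2 ^+ n) ->
   exists l, forall n, w n <= l <= w n + K / 2 ^+ n.
  move=> K0 wi wd.
  have wm : {homo w : m n / (m <= n)%N >-> m <= n} by apply: homo_leq => // b c d; exact: le_trans.
  have wd' : {homo (fun n => w n + K / 2 ^+ n) : m n / (m <= n)%N >-> n <= m}.
    by apply: homo_leq => // b c d h1 h2; exact: le_trans h2 h1.
  have wb m n : w m <= w n + K / 2 ^+ n.
    have [mn|/ltnW nm] := leqP m n.
      by rewrite (le_trans (wm _ _ mn)) // lerDl divr_ge0 // exprn_ge0.
    by rewrite (le_trans _ (wd' _ _ nm)) // lerDl divr_ge0 // exprn_ge0.
  exists (sup (range w)) => n; apply/andP; split.
    apply: ub_le_sup; last by exists n.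
    by exists (w 0%N + K / 2 ^+ 0) => _ [m _ <-]; exact: wb.
  by apply: ge_sup; [exists (w 0%N), 0%N|move=> _ [m _ <-]; exact: wb].
have [p Hp] := lim_ex u A A0 (fun n => let: conj _ (And4 a _ _ _) := P n in a)
  (fun n => let: conj _ (And4 _ a _ _) := P n in a).
have [q Hq] := lim_ex v B B0 (fun n => let: conj _ (And4 _ _ a _) := P n in a)
  (fun n => let: conj _ (And4 _ _ _ a) := P n in a).
have [D HD] : exists D, cderivative g (p +i* q) D.
  have := Hp 0%N; have := Hq 0%N; rewrite /u /v /s /= expr0 !divr1.
  by move=> ? ?; exact: dg.
apply/eqP; rewrite -cmod_eq0 eq_le cmod_ge0 andbT; apply/ler_addgt0Pr => e e0.
rewrite add0r.
(* The [1] keeps [K] positive for degenerate rectangles. *)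
pose K := A + B + 1; have K0 : 0 < K by rewrite /K; lra.
have e1 : 0 < e / (4 * K ^+ 2) by rewrite divr_gt0 // mulr_gt0 // exprn_gt0.
have [d d0 Hd] := HD _ e1.
have [n Hn] : exists n, K / 2 ^+ n < d.
  have [n hn] : exists n : nat, K / d < n%:R by exists (Num.bound (K / d)); apply: archi_boundP; rewrite divr_ge0 // ltW.
  exists n; rewrite ltr_pdivrMr ?exprn_gt0 // mulrC -ltr_pdivrMr // (lt_le_trans hn) //.
  by rewrite -natrX ler_nat ltnW // ltn_expl.
have [[_ I] _] := P n; rewrite (le_trans I) //.
have p2 : 0 < (2 : R) ^+ n by rewrite exprn_gt0.
have dist a b : u n <= a <= u n + A / 2 ^+ n -> v n <= b <= v n + B / 2 ^+ n ->
   cmod ((a +i* b) - (p +i* q)) <= (A + B) / 2 ^+ n.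
  move=> ha hb; rewrite (le_trans (cmod_le_ReIm _)) //= mulrDl.
  have := Hp n; have := Hq n => hq hp.
  by rewrite lerD // ler_norml; lra.
have loc : cmod (rect_int (u n) (v n) (A / 2 ^+ n) (B / 2 ^+ n)) <=
    4 * (e / (4 * K ^+ 2) * (K / 2 ^+ n)) * (A / 2 ^+ n + B / 2 ^+ n).
  apply: (@rect_int_local _ _ _ _ (p +i* q) D).
  - by rewrite divr_ge0 // ltW.
  - by rewrite divr_ge0 // ltW.
  - by rewrite mulr_ge0 ?divr_ge0 // ltW // mulr_gt0 // exprn_gt0.
  move=> a b ha hb.
  have hd := dist a b ha hb.
  have hd' : cmod ((a +i* b) - (p +i* q)) <= K / 2 ^+ n.
    by rewrite (le_trans hd) // ler_pM2r ?invr_gt0 // /K lerDl.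
  have := Hd ((a +i* b) - (p +i* q)) (le_lt_trans hd' Hn).
  rewrite [(p +i* q) + _]addrC subrK => /le_trans; apply.
  by rewrite ler_wpM2l // ltW.
have -> : 4 ^+ n = (2 ^+ n) ^+ 2 :> R by rewrite -exprM mulnC exprM; congr (_ ^+ n); ring.
rewrite (le_trans (ler_wpM2l _ loc)) ?sqr_ge0 //.
have -> : (2 ^+ n) ^+ 2 * (4 * (e / (4 * K ^+ 2) * (K / 2 ^+ n)) * (A / 2 ^+ n + B / 2 ^+ n))
   = e * ((A + B) / K) by field; rewrite !gt_eqF.
rewrite -[leRHS]mulr1 ler_wpM2l ?(ltW e0) // ler_pdivrMr // mul1r /K lerDl //.
Qed.

End Goursat.

(** * Complex differentiability and the exponential *)

Section ComplexDifferentiability.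
Context {R : realType}.
Implicit Types (f g F G : R[i] -> R[i]) (z w h : R[i]).

Definition cdiff f z := exists D, cderivative f z D.

Lemma cdiffP f z : cdiff f z <-> derivable (f : R[i]^o -> R[i]^o) z 1.
Proof.
split; last exact: derivable_cderivative.
by move=> [D]; exact: cderivative_derivable.
Qed.

Lemma cdiff_ccont f z : cdiff f z -> ccont f z.
Proof.
move=> [D HD] e e0; have [d d0 Hd] := HD 1 ltr01.
have K0 : 0 < 1 + cmod D by rewrite ltr_pwDl // cmod_ge0.
exists (Num.min d (e / (1 + cmod D))); first by rewrite lt_min d0 divr_gt0.
move=> h; rewrite lt_min => /andP[/Hd H1 H2].
have -> : f (z + h) - f z = (f (z + h) - f z - D * h) + D * h by ring.
rewrite (le_trans (cmodD _ _)) // cmodM (le_trans (lerD H1 (lexx _))) //.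
by rewrite -mulrDl mulrC -ler_pdivlMr // ltW.
Qed.

Lemma cdiff_cst c z : cdiff (fun=> c) z.
Proof. by apply/cdiffP; exact: (@derivable_cst _ (R[i]^o) (R[i]^o)). Qed.

Lemma cdiff_id z : cdiff id z.
Proof. by apply/cdiffP; exact: (@derivable_id _ (R[i]^o)). Qed.

Lemma cdiffD f g z : cdiff f z -> cdiff g z -> cdiff (fun w => f w + g w) z.
Proof. by move=> /cdiffP df /cdiffP dg; apply/cdiffP; exact: (@derivableD _ (R[i]^o) (R[i]^o) _ _ _ _ df dg). Qed.

Lemma cdiffB f g z : cdiff f z -> cdiff g z -> cdiff (fun w => f w - g w) z.
Proof. by move=> /cdiffP df /cdiffP dg; apply/cdiffP; exact: (@derivableB _ (R[i]^o) (R[i]^o) _ _ _ _ df dg). Qed.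

Lemma cdiffM f g z : cdiff f z -> cdiff g z -> cdiff (fun w => f w * g w) z.
Proof. by move=> /cdiffP df /cdiffP dg; apply/cdiffP; exact: (@derivableM _ (R[i]^o) _ _ _ _ df dg). Qed.

Lemma cdiffX f n z : cdiff f z -> cdiff (fun w => f w ^+ n) z.
Proof.
move=> df; elim: n => [|n IH]; first exact: cdiff_cst.
under eq_fun do rewrite exprS; exact: cdiffM.
Qed.

Lemma cdiffV f z : f z != 0 -> cdiff f z -> cdiff (fun w => (f w)^-1) z.
Proof. by move=> f0 /cdiffP df; apply/cdiffP; exact: (@derivableV _ (R[i]^o) _ _ _ f0 df). Qed.

Lemma cdiff_comp f g z : cdiff f z -> cdiff g (f z) -> cdiff (fun w => g (f w)) z.
Proof.
move=> /cdiffP/derivable1_diffP df /cdiffP/derivable1_diffP dg; apply/cdiffP/derivable1_diffP.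
exact: (@differentiable_comp _ (R[i]^o) (R[i]^o) (R[i]^o) _ _ _ df dg).
Qed.

Lemma cdiff_near f g z : (exists2 d, 0 < d & forall h, cmod h < d -> f (z + h) = g (z + h)) ->
  cdiff f z -> cdiff g z.
Proof.
move=> [d d0 E] [D HD]; exists D => e /HD[d' d'0 H].
exists (Num.min d d'); first by rewrite lt_min d0.
move=> h; rewrite lt_min => /andP[h1 h2]; rewrite -E //.
have := E 0; rewrite cmod0 addr0 => <- //; exact: H.
Qed.

Lemma ccontP f z : ccont f z <-> {for z, continuous (f : R[i]^o -> R[i]^o)}.
Proof.
split=> [H|/cvgrPdist_le H e e0].
  apply/(@cvgrPdist_le _ (R[i]^o) _ (nbhs (z : R[i]^o))) => -[e eI]; rewrite ltcE /= => /andP[/eqP eI0 e0].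
  have [d d0 Hd] := H e e0; exists (d%:C); first by rewrite /= ltcR.
  move=> w; rewrite /ball_ /= cmodE ltcR => wd.
  rewrite cmodE lecE /= eI0 eqxx /= cmod_distC.
  have -> : w = z + (w - z) by ring.
  by apply: Hd; rewrite cmod_distC.
have := H e%:C; rewrite ltcR => /(_ e0)[[d dI]] /=; rewrite ltcE /= => /andP[/eqP dI0 d0] Hd.
exists d => // h hd; have := Hd (z + h); rewrite /ball_ /= opprD addNKr normrN.
rewrite !cmodE lecR ltcE /= dI0 eqxx /= cmod_distC; exact.
Qed.

Lemma ccontM f g z : ccont f z -> ccont g z -> ccont (fun w => f w * g w) z.
Proof. by move=> /ccontP cf /ccontP cg; apply/ccontP; exact: (@continuousM R[i] (R[i]^o) _ _ _ cf cg). Qed.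

Lemma ccont_comp f g z : ccont f z -> ccont g (f z) -> ccont (fun w => g (f w)) z.
Proof.
move=> cf cg e /cg[d d0 Hd]; have [d' d'0 Hd'] := cf (d / 2) (divr_gt0 d0 (ltr0Sn _ 1)).
exists d' => // h /Hd' hd; have := Hd (f (z + h) - f z).
by rewrite subrKC; apply; rewrite (le_lt_trans hd) // ltr_pdivrMr // mulr2n mulrDr mulr1 ltrDl.
Qed.

Lemma entire_cdiff F : entire F <-> forall z, cdiff F z.
Proof. by split=> eF z; apply/cdiffP; exact: eF. Qed.

End ComplexDifferentiability.

Section ComplexExponential.
Context {R : realType}.
Implicit Types (z w h : R[i]) (x y : R).

Definition cexp z : R[i] :=
  (expR (complex.Re z))%:C * (cos (complex.Im z) +i* sin (complex.Im z)).

Lemma cexpD z w : cexp (z + w) = cexp z * cexp w.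
Proof.
rewrite /cexp cReD cImD expRD rmorphM cosD sinD.
apply: complex_ext; rewrite !(cReM, cImM) /=; ring.
Qed.

Lemma cexp0 : cexp 0 = 1.
Proof. by rewrite /cexp /= expR0 cos0 sin0 mul1r. Qed.

Lemma cmod_cexp z : cmod (cexp z) = expR (complex.Re z).
Proof.
rewrite /cexp cmodM cmod_real ger0_norm ?expR_ge0 // cmod_sqrt /= cos2Dsin2 sqrtr1 mulr1 //.
Qed.

Lemma cexp_neq0 z : cexp z != 0.
Proof. by rewrite -cmod_gt0 cmod_cexp expR_gt0. Qed.

Lemma cexp_periodic x : cexp (x +i* (2 * pi)) = cexp (x +i* 0).
Proof.
by rewrite /cexp /= -[2 * pi]add0r mulr_natl cosD2pi sinD2pi.
Qed.

Lemma cexp_polar x y : cexp (x +i* y) = (expR x)%:C * cexp (0 +i* y).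
Proof. by rewrite /cexp /= expR0 mul1r. Qed.

Lemma is_derive_littleo (f : R -> R) (D e : R) : is_derive (0 : R) (1 : R) f D -> 0 < e ->
  exists2 d : R, 0 < d & forall h : R, `|h| < d -> `|f h - f 0 - D * h| <= e * `|h|.
Proof.
move=> [df dD] e0; move: df => /cvg_ex [/= D' dF].
have ED : D' = D by rewrite -dD /derive; apply/esym/cvg_lim.
move/cvgrPdist_le : dF => /(_ e e0)[d /= d0 H]; exists d => // h hd.
have [->|h0] := eqVneq h 0; first by rewrite subrr mulr0 subr0 normr0 mulr0.
have /H /(_ h0) : ball_ Num.Def.normr (0 : R) d h by rewrite /ball_ /= sub0r normrN.
rewrite [h *: 1]mulr1 addr0 ED => {}H.
have -> : f h - f 0 - D * h = - h * (D - h^-1 * (f h - f 0)) by field.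
by rewrite normrM normrN mulrC ler_wpM2r.
Qed.

Lemma cderivative_cexp0 : cderivative cexp 0 1.
Proof.
(* Each of the two components of the remainder is at most [3 * e' * cmod h]. *)
move=> e e0; pose e' := Num.min 1 (e / 6).
have e'0 : 0 < e' by rewrite lt_min ltr01 divr_gt0.
have e'1 : e' <= 1 by rewrite ge_min lexx.
have e'e : 6 * e' <= e by rewrite mulrC -ler_pdivlMr // ge_min lexx orbT.
have [d1 d10 H1] := is_derive_littleo (is_derive_expR 0) e'0.
have [d2 d20 H2] := is_derive_littleo (is_derive_cos 0) e'0.
have [d3 d30 H3] := is_derive_littleo (is_derive_sin 0) e'0.
exists (Num.min (Num.min d1 d2) (Num.min d3 (e' / 2))).
  by rewrite !lt_min d10 d20 d30 divr_gt0.
move=> h; rewrite !lt_min => /andP[/andP[h1 h2] /andP[h3 h4]].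
rewrite add0r cexp0 mul1r.
case: h h1 h2 h3 h4 => x y h1 h2 h3 h4.
set m := cmod (x +i* y) in h1 h2 h3 h4 *.
have xm : `|x| <= m by exact: (cmod_Re (x +i* y)).
have ym : `|y| <= m by exact: (cmod_Im (x +i* y)).
have m0 : 0 <= m by exact: cmod_ge0.
have := H1 _ (le_lt_trans xm h1); rewrite expR0 mul1r => {}H1.
have := H2 _ (le_lt_trans ym h2); rewrite cos0 sin0 oppr0 mul0r subr0 => {}H2.
have := H3 _ (le_lt_trans ym h3); rewrite cos0 sin0 mul1r subr0 => {}H3.
have H1' : `|expR x - 1 - x| <= e' * m by rewrite (le_trans H1) // ler_pM2l.
have H2' : `|cos y - 1| <= e' * m by rewrite (le_trans H2) // ler_pM2l.
have H3' : `|sin y - y| <= e' * m by rewrite (le_trans H3) // ler_pM2l.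
have cy : `|cos y| <= 1 by rewrite ler_norml cos_geN1 cos_le1.
have ex1 : `|expR x - 1| <= 2 * m.
  rewrite (_ : expR x - 1 = (expR x - 1 - x) + x); last by ring.
  rewrite (le_trans (ler_normD _ _)) // mulrDl mul1r lerD // (le_trans H1') //.
  by rewrite -[leRHS]mul1r ler_wpM2r.
have sy : `|sin y| <= 1 by rewrite ler_norml sin_geN1 sin_le1.
have sy' : `|sin y| <= 2 * m.
  rewrite (_ : sin y = (sin y - y) + y); last by ring.
  rewrite (le_trans (ler_normD _ _)) // mulrDl mul1r lerD // (le_trans H3') //.
  by rewrite -[leRHS]mul1r ler_wpM2r.
rewrite (le_trans (cmod_le_ReIm _)) // cReB cImB cReB cImB /cexp cReM cImM /=.
rewrite !mul0r subr0 addr0 subr0.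
have hm : m <= e' / 2 by exact: ltW.
have A1 : `|expR x * cos y - 1 - x| <= 3 * e' * m.
  rewrite (_ : _ - x = (expR x - 1 - x) * cos y + (1 + x) * (cos y - 1)); last by ring.
  rewrite (le_trans (ler_normD _ _)) // !normrM.
  have -> : 3 * e' * m = e' * m * 1 + 2 * (e' * m) by ring.
  rewrite lerD // ler_pM // (le_trans (ler_normD _ _)) // normr1 lerD // (le_trans xm) //.
  by rewrite (le_trans hm) // ler_pdivrMr // mul1r (le_trans e'1) // ler1n.
have A2 : `|expR x * sin y - y| <= 3 * e' * m.
  rewrite (_ : _ - y = (expR x - 1) * sin y + (sin y - y)); last by ring.
  rewrite (le_trans (ler_normD _ _)) // !normrM.
  have -> : 3 * e' * m = (e' / 2 * 2) * (2 * m) + e' * m by field.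
  rewrite lerD // ler_pM // (le_trans ex1) // mulrC ler_pM2r //.
rewrite (le_trans (lerD A1 A2)) // -mulrDl ler_wpM2r // (le_trans _ e'e) //.
by rewrite -mulrDl ler_pM2r // -natrD.
Qed.

Lemma cdiff_cexp z : cdiff cexp z.
Proof.
exists (cexp z) => e e0.
have [d d0 H] := cderivative_cexp0 (divr_gt0 e0 (expR_gt0 (complex.Re z))).
exists d => // h /H; rewrite add0r cexp0 mul1r => {}H.
have -> : cexp (z + h) - cexp z - cexp z * h = cexp z * (cexp h - 1 - h).
  by rewrite cexpD; ring.
by rewrite cmodM cmod_cexp mulrC -ler_pdivlMr ?expR_gt0 // mulrAC.
Qed.

End ComplexExponential.

(** * Taylor coefficients of entire functions *)

Section CircleMeans.
Context {R : realType}.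
Implicit Types (h : R[i] -> R[i]) (s t r : R) (z : R[i]).

(** The mean over the circle of radius [expR s]. In logarithmic coordinates circles become vertical
    segments and annuli become rectangles, to which Goursat's lemma applies. *)
Definition circ s h : R[i] :=
  ((2 * pi)^-1)%:C * cint 0 (2 * pi) (fun t => h (cexp (s +i* t))).

Let pi20 : 0 <= 2 * pi :> R.
Proof. by rewrite mulr_ge0 // pi_ge0. Qed.

Let pi2_gt0 : 0 < 2 * pi :> R.
Proof. by rewrite mulr_gt0 // pi_gt0. Qed.

Definition circ_cont s h := rcont (fun t => h (cexp (s +i* t))).

Lemma ccont_circ_cont s h : (forall t, ccont h (cexp (s +i* t))) -> circ_cont s h.
Proof.
move=> ch; apply/rcontP => t e /(ccont_comp (cdiff_ccont (cdiff_cexp _)) (ch t))[d d0 H].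
exists d => // u ud.
have -> : s +i* (t + u) = (s +i* t) + 'i * u%:C.
  by apply: complex_ext; rewrite ?cReD ?cImD ?cReM ?cImM /=; ring.
by apply: H; rewrite cmodM cmod_i mul1r cmod_real.
Qed.

Lemma circB s h1 h2 : circ_cont s h1 -> circ_cont s h2 ->
  circ s (fun z => h1 z - h2 z) = circ s h1 - circ s h2.
Proof. by move=> c1 c2; rewrite /circ cintB // mulrBr. Qed.

Lemma circD s h1 h2 : circ_cont s h1 -> circ_cont s h2 ->
  circ s (fun z => h1 z + h2 z) = circ s h1 + circ s h2.
Proof. by move=> c1 c2; rewrite /circ cintD // mulrDr. Qed.

Lemma circZ s k h : circ_cont s h -> circ s (fun z => k * h z) = k * circ s h.
Proof. by move=> c1; rewrite /circ cintZ // mulrCA. Qed.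

Lemma circ_cst s k : circ s (fun=> k) = k.
Proof.
rewrite /circ cint_cst // subr0 mulrA -rmorphM mulVf ?gt_eqF // rmorph1 mul1r //.
Qed.

Lemma eq_circ s h1 h2 : (forall z, cmod z = expR s -> h1 z = h2 z) ->
  circ s h1 = circ s h2.
Proof.
move=> E; congr (_ * _); apply: eq_cint => t _; apply: E; by rewrite cmod_cexp.
Qed.

Lemma eq_circ_polar s1 s2 h1 h2 :
  (forall t, h1 (cexp (s1 +i* t)) = h2 (cexp (s2 +i* t))) -> circ s1 h1 = circ s2 h2.
Proof.
by move=> E; rewrite /circ; congr (_ * _); apply: eq_cint => t _; exact: E.
Qed.

Lemma circ_le s h M : circ_cont s h -> (forall z, cmod z = expR s -> cmod (h z) <= M) ->
  cmod (circ s h) <= 2 * M.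
Proof.
move=> ch hM; rewrite cmodM cmod_real ger0_norm ?invr_ge0 //.
have H t : 0 <= t <= 2 * pi -> cmod (h (cexp (s +i* t))) <= M.
  by move=> _; rewrite hM // cmod_cexp.
rewrite mulrC ler_pdivrMr // (le_trans (cint_le ch pi20 H)) // subr0.
by rewrite mulrAC.
Qed.

(** Goursat's lemma for [h] composed with [cexp] on a rectangle of height [2 * pi], whose horizontal
    edges cancel by periodicity. *)
Lemma circ_const s1 s2 h : s1 <= s2 -> (forall w, ccont (fun w => h (cexp w)) w) ->
  (forall w, s1 <= complex.Re w <= s2 -> cdiff (fun w => h (cexp w)) w) ->
  circ s1 h = circ s2 h.
Proof.
move=> s12 ch dh; pose g w := h (cexp w).
have A0 : 0 <= s2 - s1 by rewrite subr_ge0.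
have := @goursat_rectangle _ g ch s1 0 _ _ A0 pi20.
rewrite /rect_int add0r subrKC.
have -> : cint s1 s2 (fun t => g (t +i* (2 * pi))) = cint s1 s2 (fun t => g (t +i* 0)).
  by apply: eq_cint => t _; rewrite /g cexp_periodic.
rewrite subrr add0r => H.
have /H/eqP : forall u v, s1 <= u <= s2 -> 0 <= v <= 2 * pi -> exists D, cderivative g (u +i* v) D.
  by move=> u v uu _; exact: dh.
rewrite mulf_eq0 -cmod_eq0 cmod_i oner_eq0 /= subr_eq0 => /eqP E.
by rewrite /circ -/g E.
Qed.

End CircleMeans.

(** * Cauchy estimates and the Taylor remainder *)

Section Taylor.
Context {R : realType}.
Implicit Types (s t r : R) (z w : R[i]).
Variable F : R[i] -> R[i].
Hypothesis eF : forall z, cdiff F z.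

(** Cauchy's integral over the unit circle; [circ_taylor_coeff] permits any other radius. *)
Definition taylor_coeff k : R[i] := circ 0 (fun z => F z * z ^- k).

Lemma cdiff_powV k z : z != 0 -> cdiff (fun w => w ^- k) z.
Proof. by move=> z0; apply: cdiffV; [rewrite expf_neq0|apply: cdiffX; exact: cdiff_id]. Qed.

Lemma circ_taylor_coeff k s : circ s (fun z => F z * z ^- k) = taylor_coeff k.
Proof.
have D w : cdiff (fun w => F (cexp w) * cexp w ^- k) w.
  apply: cdiffM; first by apply: cdiff_comp; [exact: cdiff_cexp|exact: eF].
  apply: (@cdiff_comp _ cexp (fun z => z ^- k)); first exact: cdiff_cexp.
  by apply: cdiff_powV; exact: cexp_neq0.
have C w := cdiff_ccont (D w).
by have [s0|/ltW s0] := leP s 0; [|apply: esym];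
   apply: (@circ_const _ _ _ (fun z => F z * z ^- k)).
Qed.

(** The mean does not depend on the radius, yet enlarging the radius by the factor [expR 1]
    multiplies it by [expR 1 ^- k], which differs from [1]. *)
Lemma circ_power k s : (0 < k)%N -> circ s (fun z => z ^- k) = 0 :> R[i].
Proof.
move=> k0.
have D w : cdiff (fun w : R[i] => cexp w ^- k) w.
  apply: (@cdiff_comp _ cexp (fun z => z ^- k)); first exact: cdiff_cexp.
  by apply: cdiff_powV; exact: cexp_neq0.
have C w := cdiff_ccont (D w).
have E1 : circ s (fun z => z ^- k) = circ (s + 1) (fun z => z ^- k) :> R[i].
  by apply: circ_const => //; rewrite lerDl.
have E2 : circ (s + 1) (fun z => z ^- k) = ((expR 1)%:C ^- k) * circ s (fun z => z ^- k) :> R[i].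
  have cs : circ_cont s (fun z : R[i] => z ^- k).
    by apply: ccont_circ_cont => t; apply/cdiff_ccont/cdiff_powV/cexp_neq0.
  rewrite -(circZ ((expR 1)%:C ^- k) cs).
  apply: eq_circ_polar => t.
  by rewrite cexp_polar [cexp (s +i* t)]cexp_polar addrC expRD rmorphM -mulrA exprMn invfM.
set c := circ s _ in E1 E2 *; rewrite E2 in E1.
have /eqP : (1 - (expR 1)%:C ^- k) * c = 0 by rewrite mulrBl mul1r -E1 subrr.
rewrite mulf_eq0 => /orP[|/eqP //].
rewrite subr_eq0 eq_sym invr_eq1 -rmorphXn /= -(rmorph1 (real_complex R)) (inj_eq (@complexI R)).
by rewrite gt_eqF // exprn_egt1 ?gtn_eqF // expR_gt1.
Qed.

Lemma taylor_coeff_le k r M : 0 < r -> (forall z, cmod z = r -> cmod (F z) <= M) ->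
  cmod (taylor_coeff k) * r ^+ k <= 2 * M.
Proof.
move=> r0 FM; rewrite -(circ_taylor_coeff _ (ln r)).
rewrite -ler_pdivlMr ?exprn_gt0 // -mulrA; apply: circ_le.
  apply: ccont_circ_cont => t; apply: cdiff_ccont; apply: cdiffM => //.
  by apply: cdiff_powV; exact: cexp_neq0.
move=> z; rewrite lnK // => zr.
by rewrite cmodM cmodV cmodX zr ler_pM2r ?invr_gt0 ?exprn_gt0 // FM.
Qed.

Section Point.
Variable z0 : R[i].

(* The difference quotient of [F] at [z0] times [z]; its circle means do not depend on the radius, even across the
   circle through [z0], by continuity, and vanish in the limit of radius [0]. *)
Let G z : R[i] := (if z == z0 then xget 0 [set D | cderivative F z0 D]
                   else (F z - F z0) / (z - z0)) * z.

Let G_diff z : z != z0 -> cdiff G z.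
Proof.
move=> zz0; apply: (@cdiff_near _ (fun z => (F z - F z0) / (z - z0) * z)); last first.
  apply: cdiffM; last exact: cdiff_id.
  apply: cdiffM; first by apply: cdiffB; [exact: eF|exact: cdiff_cst].
  by apply: cdiffV; rewrite ?subr_eq0 //; apply: cdiffB; [exact: cdiff_id|exact: cdiff_cst].
exists (cmod (z0 - z)); first by rewrite cmod_gt0 subr_eq0 eq_sym.
move=> h hd; rewrite /G ifF //; apply/negP => /eqP E; move: hd.
by rewrite -E addrC addKr ltxx.
Qed.

Let G_cont z : ccont G z.
Proof.
have [->|/G_diff/cdiff_ccont //] := eqVneq z z0.
apply: ccontM; last exact: cdiff_ccont (cdiff_id _).
have HD : cderivative F z0 (xget 0 [set D | cderivative F z0 D]).
  by apply: xgetPex; exact: eF.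
move=> e e0; have [d d0 Hd] := HD e e0; exists d => // h hd; rewrite eqxx.
have [->|h0] := eqVneq h 0; first by rewrite addr0 eqxx subrr cmod0 ltW.
have -> : (z0 + h == z0) = false by rewrite -subr_eq0 addrC addKr (negbTE h0).
set D := xget _ _ in Hd *.
rewrite [z0 + h - z0]addrC addKr.
have -> : (F (z0 + h) - F z0) / h - D = (F (z0 + h) - F z0 - D * h) / h by field.
rewrite cmodM cmodV ler_pdivrMr ?cmod_gt0 //; exact: Hd.
Qed.

Let J_const s1 s2 : s1 <= s2 -> (forall s, s1 <= s <= s2 -> expR s != cmod z0) ->
  circ s1 G = circ s2 G.
Proof.
move=> s12 H; apply: circ_const => // w.
  by apply: ccont_comp; [exact/cdiff_ccont/cdiff_cexp|exact: G_cont].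
move=> /H ws; apply: cdiff_comp; first exact: cdiff_cexp.
by apply: G_diff; apply: contra_neq ws => <-; rewrite cmod_cexp.
Qed.

Let G_circ_cont s : circ_cont s G.
Proof. by apply: ccont_circ_cont. Qed.

Let J_cont s0 e : 0 < e -> exists2 d, 0 < d & forall s, `|s| < d ->
  cmod (circ (s0 + s) G - circ s0 G) <= e.
Proof.
move=> e0.
have K := @segment_compact R 0 (2 * pi).
move/compact_near_coveringP : K => K.
pose P (s t : R) := cmod (G (cexp ((s0 + s) +i* t)) - G (cexp (s0 +i* t))) <= e / 2.
have [d /= d0 Hd] : \forall s \near (0 : R), `[0, 2 * pi] `<=` P s.
  apply: (K _ (nbhs (0 : R)) P) => t _.
  have cgt : ccont (fun w => G (cexp w)) (s0 +i* t).
    by apply: ccont_comp; [exact/cdiff_ccont/cdiff_cexp|exact: G_cont].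
  have e4 : 0 < e / 4 by lra.
  have [d d0 Hd] := cgt _ e4.
  exists (ball t (d / 2), ball 0 (d / 2)) => /=.
    by split; apply: nbhsx_ballx; rewrite divr_gt0.
  move=> [u s] [] /=; rewrite /ball /= sub0r normrN => ut sd; rewrite /P.
  have H (s' : R) : `|s'| < d / 2 -> cmod (G (cexp ((s0 + s') +i* u)) - G (cexp (s0 +i* t))) <= e / 4.
    move=> s'd.
    have -> : (s0 + s') +i* u = (s0 +i* t) + (s' +i* (u - t)).
      by apply: complex_ext => /=; ring.
    by apply: Hd; rewrite (le_lt_trans (cmod_le_ReIm _)) //= (splitr d) ltrD // distrC.
  have H0 := H 0; rewrite addr0 normr0 in H0.
  rewrite (_ : e / 2 = e / 4 + e / 4); last by field.
  apply: (le_trans (cmod_dist_triangle (G (cexp (s0 +i* t))) _ _)).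
  by apply: lerD; [exact: H|rewrite cmod_distC; apply: H0; rewrite divr_gt0].
exists d => // s sd; rewrite /circ -mulrBr -cintB; [|exact: G_circ_cont..].
rewrite cmodM cmod_real ger0_norm ?invr_ge0 ?mulr_ge0 ?pi_ge0 //.
have pi2 : 0 < 2 * pi :> R by rewrite mulr_gt0 ?pi_gt0.
rewrite mulrC ler_pdivrMr //.
have H t : 0 <= t <= 2 * pi ->
    cmod (G (cexp ((s0 + s) +i* t)) - G (cexp (s0 +i* t))) <= e / 2.
  move=> ht; have := Hd s; rewrite /ball_ /= sub0r normrN => /(_ sd); apply.
  by rewrite /= in_itv.
have rc : rcont (fun t => G (cexp ((s0 + s) +i* t)) - G (cexp (s0 +i* t))).
  by apply: rcontB; exact: G_circ_cont.
apply: (le_trans (cint_le rc (ltW pi2) H)).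
by rewrite subr0 le_eqVlt; apply/orP; left; apply/eqP; field.
Qed.

Let J_lim e : 0 < e -> exists s1, forall s, s <= s1 -> cmod (circ s G) <= e.
Proof.
move=> e0; have [d d0 Hd] := G_cont 0 (divr_gt0 e0 (ltr0Sn _ 1)).
exists (ln (d / 2)) => s ss.
rewrite (_ : e = 2 * (e / 2)); last by field.
apply: circ_le; first exact: G_circ_cont.
move=> z zs; have := Hd z; rewrite add0r [G 0]mulr0 subr0; apply.
rewrite zs (@le_lt_trans _ _ (d / 2)) //; last by rewrite ltr_pdivrMr // mulr2n mulrDr mulr1 ltrDl.
by rewrite -[leRHS]lnK ?posrE ?divr_gt0 // ler_expR.
Qed.

Let J0 s : cmod z0 < expR s -> circ s G = 0.
Proof.
have small s' : (forall u, u <= s' -> expR u != cmod z0) -> circ s' G = 0.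
  move=> H; apply/eqP; rewrite -cmod_eq0 eq_le cmod_ge0 andbT.
  apply/ler_addgt0Pr => e /J_lim[s1 Hs1]; rewrite add0r.
  have [/Hs1 //|/ltW s1s] := leP s' s1.
  rewrite -(@J_const s1 s' s1s); first exact: Hs1.
  by move=> u /andP[_]; exact: H.
move=> zs; have [z00|z00] := eqVneq z0 0.
  by apply: small => u _; rewrite z00 cmod0 gt_eqF // expR_gt0.
rewrite -cmod_gt0 in z00; pose s0 := ln (cmod z0).
have Es0 : expR s0 = cmod z0 by rewrite lnK.
have s0s : s0 < s by rewrite -ltr_expR Es0.
have below u : u < s0 -> circ u G = 0.
  move=> us; apply: small => v vu; rewrite lt_eqF // -Es0 ltr_expR //.
  exact: le_lt_trans us.
have above u : s0 < u -> circ u G = circ s G.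
  move=> us; have [h|/ltW h] := leP u s; [|symmetry]; apply: J_const => // v /andP[v1 v2];
   by rewrite gt_eqF // -Es0 ltr_expR; exact: lt_le_trans v1.
apply/eqP; rewrite -cmod_eq0 eq_le cmod_ge0 andbT.
apply/ler_addgt0Pr => e e0; rewrite add0r.
have [d d0 Hd] := J_cont s0 (divr_gt0 e0 (ltr0Sn _ 1)).
have d2 : 0 < d / 2 by rewrite divr_gt0.
have dd : d / 2 < d by rewrite ltr_pdivrMr // mulr2n mulrDr mulr1 ltrDl.
have := Hd (d / 2); rewrite above ?ltrDl // ger0_norm ?(ltW d2) // => /(_ dd) h1.
have := Hd (- (d / 2)); rewrite below ?ltrDl ?oppr_gt0 ?gtrDl ?oppr_lt0 // normrN ger0_norm ?(ltW d2) // => /(_ dd).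
rewrite sub0r cmodN => h2.
rewrite -[circ s G](subrK (circ s0 G)) (le_trans (cmodD _ _)) // [leRHS]splitr lerD //.
Qed.

(** Cauchy's formula says that the mean of [(F z - F z0) * z / (z - z0)] vanishes. Expanding
    [z / (z - z0)] in powers of [z0 / z] splits off one coefficient at a time, and the constant
    [F z0] affects only the first one by [circ_power]. The [8] is a product of three factors [2]:
    from [circ_le], from [cmod (F z - F z0) <= 2 * M] and from [r / cmod (z - z0) <= 2]. *)
Lemma taylor_remainder K r M : 0 < r -> (forall z, cmod z <= r -> cmod (F z) <= M) ->
  cmod z0 <= r / 2 ->
  cmod (F z0 - \sum_(k < K) taylor_coeff k * z0 ^+ k) <= 8 * M * (cmod z0 / r) ^+ K.
Proof.
move=> r0 FM z0r.
have M0 : 0 <= M by rewrite (le_trans (cmod_ge0 (F 0))) // FM // cmod0 ltW.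
have z0r' : cmod z0 < r by rewrite (le_lt_trans z0r) // ltr_pdivrMr // mulr2n mulrDr mulr1 ltrDl.
have Fz0M : cmod (F z0) <= M by rewrite FM // ltW.
case: K => [|K].
  by rewrite big_ord0 subr0 expr0 mulr1 (le_trans Fz0M) // ler_peMl // ler1n.
pose s := ln r; have Es : expR s = r by rewrite lnK.
pose rem k z := (F z - F z0) * (z0 ^+ k * z ^- k) * (z / (z - z0)).
have nz z : cmod z = expR s -> z != 0 by rewrite Es => zr; rewrite -cmod_gt0 zr.
have nzz z : cmod z = expR s -> z - z0 != 0.
  by rewrite Es subr_eq0 => zr; apply: contraTneq z0r' => <-; rewrite zr ltxx.
have ccexp t : cmod (cexp (s +i* t)) = expR s by rewrite cmod_cexp.
have cF t : ccont (fun z => (F z - F z0)) (cexp (s +i* t)).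
  by apply: cdiff_ccont; apply: cdiffB; [exact: eF|exact: cdiff_cst].
have cV k t : ccont (fun z => z ^- k) (cexp (s +i* t)).
  by apply: cdiff_ccont; apply: cdiff_powV; exact: cexp_neq0.
have cQ t : ccont (fun z => z / (z - z0)) (cexp (s +i* t)).
  apply: cdiff_ccont; apply: cdiffM; first exact: cdiff_id.
  by apply: cdiffV; [exact: nzz|apply: cdiffB; [exact: cdiff_id|exact: cdiff_cst]].
have cc c t : ccont (fun=> c : R[i]) (cexp (s +i* t)) by exact: cdiff_ccont (cdiff_cst _ _).
have crem k : circ_cont s (rem k).
  by apply: ccont_circ_cont => t; apply: ccontM => //; apply: ccontM => //; exact: ccontM.
have rem0 : circ s (rem 0) = 0.
  rewrite -(@J0 s) ?Es //; apply: eq_circ => z zr.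
  rewrite /rem /G expr0 invr1 !mulr1 ifF; first by rewrite mulrA [RHS]mulrAC.
  by apply/negbTE; rewrite -subr_eq0; exact: nzz.
have remS k : circ s (rem k) = z0 ^+ k * (taylor_coeff k - (k == 0%N)%:R * F z0) + circ s (rem k.+1).
  rewrite -(circ_taylor_coeff k s).
  have -> : (k == 0%N)%:R * F z0 = circ s (fun z => F z0 * z ^- k).
    rewrite circZ; last exact: ccont_circ_cont.
    case: k => [|k].
      rewrite /= mul1r -[LHS]mulr1; congr (_ * _); rewrite -[LHS](circ_cst s); apply: eq_circ => z _.
      by rewrite expr0 invr1.
    by rewrite mul0r circ_power // mulr0.
  have c1 : circ_cont s (fun z => F z * z ^- k).
    by apply: ccont_circ_cont => t; apply: ccontM => //; exact/cdiff_ccont/eF.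
  have c2 : circ_cont s (fun z => F z0 * z ^- k).
    by apply: ccont_circ_cont => t; apply: ccontM.
  have c3 : circ_cont s (fun z => F z * z ^- k - F z0 * z ^- k) by exact: rcontB.
  have c4 : circ_cont s (fun z => z0 ^+ k * (F z * z ^- k - F z0 * z ^- k)).
    by apply: (rcontM _ c3); exact: rcont_cst.
  rewrite -(circB c1 c2) -(circZ _ c3) -(circD c4 (crem _)).
  apply: eq_circ => z zr; rewrite /rem !exprS invfM.
  have := nz z zr; have := nzz z zr => h1 h2; field.
  by rewrite h2 h1 expf_neq0.
have E k : F z0 - \sum_(j < k.+1) taylor_coeff j * z0 ^+ j = circ s (rem k.+1).
  elim: k => [|k IH].
    have := remS 0%N; rewrite rem0 big_ord1 expr0 !mul1r mulr1 => /eqP.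
    by rewrite eq_sym addrC addr_eq0 opprB => /eqP.
  rewrite big_ord_recr /= opprD addrA IH remS mul0r subr0 [z0 ^+ _ * _]mulrC.
  by rewrite addrAC subrr add0r.
rewrite E.
have -> : 8 * M * (cmod z0 / r) ^+ K.+1 = 2 * (4 * M * (cmod z0 / r) ^+ K.+1) by ring.
apply: circ_le => // z zr; have zr' : cmod z = r by rewrite zr.
rewrite /rem !cmodM !cmodV !cmodX zr' -exprVn -exprMn.
have H1 : cmod (F z - F z0) <= 2 * M.
  by rewrite (le_trans (cmodB _ _)) // mulr2n mulrDl !mul1r lerD // FM // zr'.
have H2 : r / cmod (z - z0) <= 2.
  rewrite ler_pdivrMr; last by rewrite cmod_gt0; exact: nzz.
  have := cmod_lerB z z0; rewrite zr'; move: z0r; rewrite ler_pdivlMr //; lra.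
have p0 : 0 <= (cmod z0 / r) ^+ K.+1 by rewrite exprn_ge0 // divr_ge0 ?cmod_ge0 ?ltW.
have -> : 4 * M * (cmod z0 / r) ^+ K.+1 = 2 * M * (cmod z0 / r) ^+ K.+1 * 2 by ring.
apply: ler_pM => //; first by rewrite mulr_ge0 // cmod_ge0.
  by rewrite divr_ge0 ?cmod_ge0 // ltW.
exact: ler_wpM2r.
Qed.

End Point.

End Taylor.

(** * Coefficient estimates and Chebyshev polynomials *)

Section PolynomialCoefficients.
Context {R : realType}.
Implicit Types (p q : {poly R[i]}) (z w u : R[i]) (r M : R).

Lemma cdiff_horner p z : cdiff (fun w => p.[w]) z.
Proof.
elim/poly_ind: p => [|p c IH].
  by under eq_fun do rewrite horner0; exact: cdiff_cst.
under eq_fun do rewrite hornerMXaddC.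
by apply: cdiffD; [apply: cdiffM => //; exact: cdiff_id|exact: cdiff_cst].
Qed.

(** The one-term remainder estimate at the point [0] has right-hand side [0]. *)
Lemma taylor_coeff0 (F : R[i] -> R[i]) : (forall z, cdiff F z) -> taylor_coeff F 0 = F 0.
Proof.
move=> eF; have := cdiff_ccont (eF 0) ltr01 => -[d d0 Hd].
have d2 : 0 < d / 2 by rewrite divr_gt0.
have := @taylor_remainder _ F eF 0 1 (d / 2) (1 + cmod (F 0)) d2.
rewrite cmod0 big_ord1 expr0 mulr1 mul0r expr1 mulr0 => H; apply/esym/eqP.
rewrite -subr_eq0 -cmod_eq0 eq_le cmod_ge0 andbT H //; last by rewrite divr_ge0 // ltW.
move=> z zd; rewrite -[F z](subrK (F 0)) (le_trans (cmodD _ _)) // lerD2r.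
rewrite -[z]add0r Hd // (le_lt_trans zd) // ltr_pdivrMr // mulr2n mulrDr mulr1 ltrDl //.
Qed.

Lemma taylor_coeff_horner p k : taylor_coeff (fun w => p.[w]) k = p`_k.
Proof.
elim/poly_ind: p k => [|p c IH] k.
  rewrite coef0 /taylor_coeff -[RHS](circ_cst 0); apply: eq_circ => z _.
  by rewrite horner0 mul0r.
rewrite coefD coefMX coefC; case: k => [|k] /=.
  by rewrite add0r (taylor_coeff0 (cdiff_horner _)) hornerMXaddC mulr0 add0r.
rewrite addr0 -IH /taylor_coeff -[RHS]addr0 -[X in _ = _ + X](mulr0 c) -(@circ_power R k.+1 0) //.
have cc (h : R[i] -> R[i]) : (forall z, z != 0 -> cdiff h z) -> circ_cont 0 h.
  by move=> dh; apply: ccont_circ_cont => t; apply/cdiff_ccont/dh/cexp_neq0.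
have cV : circ_cont 0 (fun z : R[i] => z ^- k.+1) by apply: cc => z z0; exact: cdiff_powV.
rewrite -circZ // -circD; first last.
- by apply: cc => z z0; apply: cdiffM; [exact: cdiff_cst|exact: cdiff_powV].
- by apply: cc => z z0; apply: cdiffM; [exact: cdiff_horner|exact: cdiff_powV].
apply: eq_circ => z zr; rewrite hornerMXaddC mulrDl; congr (_ + _).
by rewrite exprS invfM mulrA mulfK // -cmod_gt0 zr expR_gt0.
Qed.

Lemma poly_coef_le p k r M : 0 < r -> (forall z, cmod z = r -> cmod p.[z] <= M) ->
  cmod p`_k * r ^+ k <= 2 * M.
Proof.
by move=> r0 H; rewrite -taylor_coeff_horner; apply: taylor_coeff_le => // z; exact: cdiff_horner.
Qed.

End PolynomialCoefficients.

(** * Chebyshev polynomials and expansions *)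

Section Chebyshev.
Context {R : realType}.
Implicit Types (p q : {poly R[i]}) (z w u : R[i]) (r x s M : R).

(** Two consecutive polynomials are carried along, which makes the three-term recurrence
    structural. *)
Fixpoint chebyshev2 n : {poly R[i]} * {poly R[i]} :=
  if n is m.+1 then let: (a, b) := chebyshev2 m in (b, 2%:P * 'X * b - a)
  else (1, 'X).
Definition chebyshev n := (chebyshev2 n).1.

Lemma chebyshev0 : chebyshev 0 = 1. Proof. by []. Qed.
Lemma chebyshev1 : chebyshev 1 = 'X. Proof. by []. Qed.
Lemma chebyshevSS n : chebyshev n.+2 = 2%:P * 'X * chebyshev n.+1 - chebyshev n.
Proof. by rewrite /chebyshev /=; case: (chebyshev2 n). Qed.

Lemma size_chebyshev n : (size (chebyshev n) <= n.+1)%N.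
Proof.
suff: (size (chebyshev n) <= n.+1)%N /\ (size (chebyshev n.+1) <= n.+2)%N by case.
elim: n => [|n [IH1 IH2]]; first by rewrite chebyshev0 chebyshev1 size_poly1 size_polyX.
split => //; rewrite chebyshevSS (leq_trans (size_polyD _ _)) // geq_max size_polyN.
apply/andP; split; last by rewrite (leq_trans IH1) // leqW.
rewrite -mulrA mul_polyC (leq_trans (size_scale_leq _ _)) // mulrC.
by have [->|h] := eqVneq (chebyshev n.+1) 0; [rewrite mul0r size_poly0|rewrite size_mulX].
Qed.

Lemma horner_chebyshev n u : u != 0 ->
  (chebyshev n).[(u + u^-1) / 2] = (u ^+ n + u ^- n) / 2.
Proof.
move=> u0.
suff: (chebyshev n).[(u + u^-1) / 2] = (u ^+ n + u ^- n) / 2 /\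
      (chebyshev n.+1).[(u + u^-1) / 2] = (u ^+ n.+1 + u ^- n.+1) / 2 by case.
elim: n => [|n [IH1 IH2]].
  by rewrite chebyshev0 chebyshev1 hornerC hornerX expr0 expr1 invr1; split => //; field.
split => //; rewrite chebyshevSS hornerD hornerN !hornerM hornerC hornerX IH1 IH2.
rewrite !exprS; field; by rewrite u0 expf_neq0.
Qed.

(** This is [s <= sinh s] multiplied by [2 * expR s]. *)
Lemma expR_sinh_ge s : 0 <= s -> 2 * s * expR s + 1 <= expR s ^+ 2.
Proof.
move=> s0; pose f t : R := expR t ^+ 2 - 2 * t * expR t.
pose df t : R := 2 * expR t * (expR t - 1 - t).
have Df (t : R) : is_derive t (1 : R) f (df t).
  rewrite /f; apply: is_derive_eq; rewrite /df /GRing.scale /=; ring.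
have : f 0 <= f s.
  apply: (@ger0_derive1_ndecry _ f 0) => //.
  - move=> x; rewrite in_itv /= andbT => x0; rewrite derive1E (@derive_val _ _ _ _ _ _ _ (Df x)).
    by rewrite /df mulr_ge0 ?mulr_ge0 ?expR_ge0 // -addrA -opprD subr_ge0 expR_ge1Dx.
  - by apply: derivable_within_continuous => x _; by case: (Df x).
by rewrite /f expR0 mulr0 mul0r subr0 expr1n; lra.
Qed.

(** Induction along the recurrence, closed by [expR_sinh_ge]. The exponent is exactly [n * cmod z];
    this is why degree [n] on [[-n, n]] corresponds to type 1. *)
Lemma chebyshev_le_expR n z : cmod (chebyshev n).[z] <= expR (cmod z) ^+ n.
Proof.
pose X := expR (cmod z); have X0 : 0 <= X by exact: expR_ge0.
suff: cmod (chebyshev n).[z] <= X ^+ n /\ cmod (chebyshev n.+1).[z] <= X ^+ n.+1 by case.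
elim: n => [|n [IH1 IH2]].
  rewrite chebyshev0 chebyshev1 hornerC hornerX cmod1 expr0 expr1; split => //.
  by rewrite (le_trans _ (expR_ge1Dx _)) // lerDr.
split => //; rewrite chebyshevSS hornerD hornerN !hornerM hornerC hornerX.
rewrite (le_trans (cmodB _ _)) // !cmodM (cmod_nat 2) (le_trans (lerD (ler_wpM2l _ IH2) IH1)) //.
  by rewrite mulr_ge0 // cmod_ge0.
have -> : X ^+ n.+2 = X ^+ n * X ^+ 2 by rewrite -exprD addn2.
have -> : 2 * cmod z * X ^+ n.+1 + X ^+ n = X ^+ n * (2 * cmod z * X + 1) by rewrite exprS; ring.
by rewrite ler_wpM2l ?exprn_ge0 // expR_sinh_ge // cmod_ge0.
Qed.

Definition cheb_span n p := exists b : nat -> R[i], p = \sum_(k < n) b k *: chebyshev k.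

Lemma cheb_spanD n p q : cheb_span n p -> cheb_span n q -> cheb_span n (p + q).
Proof.
move=> [b ->] [c ->]; exists (fun k => b k + c k); rewrite -big_split /=.
by apply: eq_bigr => k _; rewrite scalerDl.
Qed.

Lemma cheb_spanZ n c p : cheb_span n p -> cheb_span n (c *: p).
Proof.
move=> [b ->]; exists (fun k => c * b k); rewrite scaler_sumr.
by apply: eq_bigr => k _; rewrite scalerA.
Qed.

Lemma cheb_span_chebyshev n k : (k < n)%N -> cheb_span n (chebyshev k).
Proof.
move=> kn; exists (fun j => (j == k)%:R); rewrite (bigD1 (Ordinal kn)) //= eqxx scale1r.
rewrite big1 ?addr0 // => j; rewrite -val_eqE /= => /negbTE ->; exact: scale0r.
Qed.

Lemma cheb_spanMX n p : cheb_span n p -> cheb_span n.+1 (p * 'X).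
Proof.
move=> [b ->]; rewrite mulr_suml; elim/big_ind : _ => [| |k _].
- by exists (fun=> 0); rewrite big1 // => k _; rewrite scale0r.
- exact: cheb_spanD.
rewrite -scalerAl; apply: cheb_spanZ; case: k => -[|k] kn /=.
  by rewrite chebyshev0 mul1r -chebyshev1; exact: cheb_span_chebyshev.
have -> : chebyshev k.+1 * 'X = 2^-1 *: (chebyshev k.+2 + chebyshev k).
  rewrite chebyshevSS subrK -mulrA mul_polyC scalerA mulVf ?scale1r ?pnatr_eq0 // mulrC //.
by apply/cheb_spanZ/cheb_spanD; apply: cheb_span_chebyshev; lia.
Qed.

Lemma cheb_span_size n p : (size p <= n)%N -> cheb_span n p.
Proof.
elim: n p => [|n IH] p.
  by rewrite leqn0 size_poly_eq0 => /eqP ->; exists (fun=> 0); rewrite big_ord0.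
elim/poly_ind: p => [|p c _].
  by move=> _; exists (fun=> 0); rewrite big1 // => k _; rewrite scale0r.
move=> H; apply: cheb_spanD.
  apply: cheb_spanMX; apply: IH; move: H; rewrite size_MXaddC; case: ifP => [/andP[/eqP -> _]|] //.
  by rewrite size_poly0.
by rewrite -alg_polyC; apply: (@cheb_spanZ _ c (chebyshev 0)); exact: cheb_span_chebyshev.
Qed.

(** Multiplied by [u ^+ n], the expansion at [(u + u^-1) / 2] becomes a polynomial in [u]. Its
    coefficient at [n + k] is [b k / 2], or [b 0] for [k = 0] where two monomials coincide, and
    Cauchy's estimate applies. *)
Lemma cheb_coef_le n (b : nat -> R[i]) r M k : 0 < r ->
  (forall u, cmod u = r -> cmod (\sum_(j < n.+1) b j *: chebyshev j).[(u + u^-1) / 2] <= M) ->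
  (k <= n)%N -> cmod (b k) * r ^+ k <= 4 * M.
Proof.
move=> r0 HM kn.
pose L : {poly R[i]} := \sum_(j < n.+1) (b j / 2) *: ('X^(n + j) + 'X^(n - j)).
have HL u : u != 0 -> L.[u] = u ^+ n * (\sum_(j < n.+1) b j *: chebyshev j).[(u + u^-1) / 2].
  move=> u0; rewrite !horner_sum mulr_sumr; apply: eq_bigr => j _.
  rewrite !hornerZ horner_chebyshev // hornerD !hornerXn exprD expfB_cond; last first.
    by rewrite (negbTE u0) add0n -ltnS.
  by field; rewrite expf_neq0.
have LM : cmod L`_(n + k) * r ^+ (n + k) <= 2 * (r ^+ n * M).
  apply: poly_coef_le => // z zr; have z0 : z != 0 by rewrite -cmod_gt0 zr.
  by rewrite HL // cmodM cmodX zr ler_pM2l ?exprn_gt0 // HM.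
have Lk : cmod (b k) / 2 <= cmod L`_(n + k).
  rewrite /L coef_sum (bigD1 (Ordinal (kn : k < n.+1)%N)) //= big1 ?addr0; last first.
    move=> j; rewrite -val_eqE /= => jk; rewrite coefZ coefD !coefXn.
    rewrite eqn_add2l eq_sym (negbTE jk) add0r.
    have [E|] := eqVneq (n + k)%N (n - j)%N; last by rewrite mulr0.
    exfalso; move: jk; have := ltn_ord j; move: E; lia.
  rewrite coefZ coefD !coefXn eqxx cmodM cmodM cmodV (cmod_nat 2).
  rewrite -[leLHS]mulr1 ler_wpM2l ?divr_ge0 ?cmod_ge0 //.
  by rewrite -natrD cmod_nat ler1n.
have : cmod L`_(n + k) * r ^+ k <= 2 * M.
  rewrite -(ler_pM2l (exprn_gt0 n r0)).
  have -> : r ^+ n * (2 * M) = 2 * (r ^+ n * M) by ring.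
  by have -> : r ^+ n * (cmod L`_(n + k) * r ^+ k) = cmod L`_(n + k) * r ^+ (n + k)
    by rewrite exprD; ring.
have rk : 0 <= r ^+ k by rewrite exprn_ge0 // ltW.
have := ler_wpM2r rk Lk; rewrite mulrAC => h1 h2; have := le_trans h1 h2.
by rewrite ler_pdivrMr //; lra.
Qed.

End Chebyshev.

(** * The Bernstein-Walsh inequality *)

Section BernsteinWalsh.
Context {R : realType}.
Implicit Types (p q : {poly R[i]}) (z w u : R[i]) (r x s M y B c d : R).

Lemma joukowski_unit u : cmod u = 1 -> (u + u^-1) / 2 = (complex.Re u)%:C.
Proof.
move=> u1; have -> : u^-1 = u^*%C.
  have u0 : u != 0 by rewrite -cmod_gt0 u1.
  apply: (mulfI u0); rewrite divff //; case: u u1 u0 => a b /(congr1 (fun x => x ^+ 2)).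
  rewrite cmod_sqr /= expr1n => h _.
  by apply: complex_ext; rewrite ?cReM ?cImM /= ?mulrN ?opprK -?h; ring.
case: u u1 => a b _; rewrite -[2]/(2%:R) -(rmorph_nat (real_complex R)) -fmorphV /=.
by apply: complex_ext; rewrite ?cReM ?cImM /=; field.
Qed.

Lemma bernoulli_ineq d n : 0 <= d -> 1 + n%:R * d <= (1 + d) ^+ n.
Proof.
move=> d0; elim: n => [|n IH]; first by rewrite mul0r addr0 expr0.
rewrite exprS (le_trans _ (ler_wpM2l _ IH)) ?addr_ge0 // -natr1.
have : 0 <= n%:R * d * d by rewrite !mulr_ge0.
lra.
Qed.

(** If [y = B * (1 + d)] with [d > 0], then by Bernoulli's inequality at even exponents
    [(1 + d) ^+ j] grows at least quadratically, faster than the linear factor. *)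
Lemma le_of_power_le y B c : 0 <= y -> 0 <= B ->
  (forall j, y ^+ j <= (c * j%:R + c) * B ^+ j) -> y <= B.
Proof.
move=> y0 B0 H; rewrite leNgt; apply/negP => By.
have c0 : 0 <= c by have := H 0%N; rewrite !expr0 mulr0 add0r mulr1; lra.
have := B0; rewrite le_eqVlt => /orP[/eqP B00|B1].
  by have := H 1%N; rewrite -B00 !expr1 mulr0 => h; have := lt_le_trans By h; rewrite -B00 ltxx.
pose d := y / B - 1; have d0 : 0 < d by rewrite subr_gt0 ltr_pdivlMr // mul1r.
have Ey : y = B * (1 + d) by rewrite /d subrKC mulrCA divff ?mulr1 // gt_eqF.
have {}H j : (1 + d) ^+ j <= c * j%:R + c.
  have := H j; rewrite Ey exprMn mulrC ler_pM2r // exprn_gt0 //.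
have Hi i : (0 < i)%N -> i%:R * d ^+ 2 <= 3 * c.
  move=> i0; have iR : 1 <= i%:R :> R by rewrite ler1n.
  have := H (i * 2)%N; rewrite exprM => h1.
  have h2 : (i%:R * d) ^+ 2 <= ((1 + d) ^+ i) ^+ 2.
    apply: lerXn2r; rewrite ?nnegrE.
    - by rewrite mulr_ge0 // ltW.
    - by rewrite exprn_ge0 // addr_ge0 // ltW.
    - by rewrite (le_trans _ (bernoulli_ineq _ (ltW d0))) // lerDr.
  have := le_trans h2 h1; rewrite natrM -(ler_pM2l (lt_le_trans ltr01 iR)).
  have : c <= c * i%:R by rewrite ler_peMr.
  rewrite exprMn => h3 h4; rewrite -(ler_pM2l (lt_le_trans ltr01 iR)).
  have : (i%:R * i%:R * d ^+ 2) * i%:R <= (3 * c * i%:R) * i%:R.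
    move: h4; rewrite expr2 => h4; rewrite mulrC (le_trans h4) // mulrC ler_pM2r ?(lt_le_trans ltr01) //.
    lra.
  by rewrite ler_pM2r ?(lt_le_trans ltr01 iR) // => h5; rewrite mulrA (le_trans h5) // mulrC.
have d20 : 0 < d ^+ 2 by rewrite exprn_gt0.
have c20 : 0 <= 3 * c / d ^+ 2 by rewrite divr_ge0 ?(ltW d20) // mulr_ge0.
have := archi_boundP c20.
set i := Num.Def.archi_bound _ => h.
have := Hi i.+1 isT; rewrite -ler_pdivlMr // leNgt (lt_trans h) // ltr_nat //.
Qed.

Lemma size_exp_le p n j : (size p <= n.+1)%N -> (size (p ^+ j) <= (n * j).+1)%N.
Proof.
move=> sp; rewrite (leq_trans (size_poly_exp_leq _ _)) // ltnS leq_mul2r.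
by apply/orP; right; case: (size p) sp.
Qed.

(** The Chebyshev expansion gives the bound with an extra factor linear in the degree. Applied to
    all powers of [p], it loses that factor through [le_of_power_le]. *)
Lemma bernstein_walsh1 p n M z : (size p <= n.+1)%N ->
  (forall x, -1 <= x <= 1 -> cmod p.[x%:C] <= M) -> cmod p.[z] <= M * expR (n%:R * cmod z).
Proof.
move=> sp pM.
have M0 : 0 <= M by rewrite (le_trans (cmod_ge0 p.[0%:C])) // pM // lerN10 ler01.
have weak q m K : (size q <= m.+1)%N -> (forall x, -1 <= x <= 1 -> cmod q.[x%:C] <= K) ->
    cmod q.[z] <= (m%:R + 1) * (4 * K) * expR (m%:R * cmod z).
  move=> sq qK; have [b Eb] := cheb_span_size sq.
  have bK k : (k <= m)%N -> cmod (b k) <= 4 * K.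
    move=> km; have := @cheb_coef_le _ m b 1 K k ltr01.
    rewrite expr1n mulr1 -Eb; apply => // u u1; rewrite joukowski_unit // qK //.
    by rewrite -ler_norml -u1 cmod_Re.
  rewrite Eb horner_sum (le_trans (cmod_sum _ _ _)) //.
  apply: (@le_trans _ _ (\sum_(k < m.+1) (4 * K) * expR (m%:R * cmod z))).
    apply: ler_sum => k _; rewrite hornerZ cmodM ler_pM ?cmod_ge0 //.
      by rewrite bK // -ltnS.
    rewrite (le_trans (chebyshev_le_expR _ _)) // -expRM_natl ler_expR ler_wpM2r ?cmod_ge0 //.
    by rewrite ler_nat -ltnS.
  by rewrite sumr_const card_ord -[_ *+ _]mulr_natl -natr1 mulrA.
apply: (@le_of_power_le _ _ (4 * (n%:R + 1))); rewrite ?cmod_ge0 ?mulr_ge0 ?expR_ge0 //.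
move=> j; rewrite -cmodX -horner_exp.
have -> : (M * expR (n%:R * cmod z)) ^+ j = M ^+ j * expR ((n * j)%:R * cmod z).
  by rewrite exprMn -expRM_natl natrM; congr (_ * expR _); ring.
have := weak (p ^+ j) (n * j)%N (M ^+ j) (size_exp_le _ sp).
have H x : -1 <= x <= 1 -> cmod (p ^+ j).[x%:C] <= M ^+ j.
  by move=> /pM h; rewrite horner_exp cmodX lerXn2r ?nnegrE ?cmod_ge0.
move=> /(_ H) h; apply: (le_trans h); rewrite [leRHS]mulrA ler_wpM2r ?expR_ge0 //.
rewrite mulrA ler_wpM2r ?exprn_ge0 // natrM.
by have := ler0n R j; have := ler0n R n; lra.
Qed.

Lemma bernstein_walsh p n x0 r M z : (size p <= n.+1)%N -> 0 < r ->
  (forall s, `|s| <= r -> cmod p.[(x0 + s)%:C] <= M) ->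
  cmod p.[x0%:C + z] <= M * expR (n%:R * (cmod z / r)).
Proof.
move=> sp r0 pM; pose q := p \Po (r%:C *: 'X + x0%:C%:P).
have r0' : r%:C != 0 :> R[i] by rewrite -cmod_gt0 cmod_real normr_gt0 gt_eqF.
have sq : (size q <= n.+1)%N.
  rewrite size_comp_poly2 // size_polyDl size_scale ?size_polyX // size_polyC.
  by case: (_ != 0).
have Eq w : q.[w] = p.[x0%:C + r%:C * w].
  by rewrite horner_comp hornerD hornerZ hornerX hornerC addrC.
have -> : p.[x0%:C + z] = q.[z / r%:C] by rewrite Eq mulrC divfK.
have := @bernstein_walsh1 q n M (z / r%:C) sq.
rewrite cmodM cmodV cmod_real gtr0_norm //; apply => x x1.
rewrite Eq -rmorphM -rmorphD pM // normrM gtr0_norm // -[leRHS]mulr1 ler_pM2l //.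
by rewrite ler_norml.
Qed.

Lemma poly_coef_le_interval p n r M k t : (size p <= n.+1)%N -> 0 < r -> 0 < t ->
  (forall s, `|s| <= r -> cmod p.[s%:C] <= M) ->
  cmod p`_k * t ^+ k <= 2 * (M * expR (n%:R * (t / r))).
Proof.
move=> sp r0 t0 pM; apply: poly_coef_le => // z zt.
have := @bernstein_walsh p n 0 r M z sp r0; rewrite add0r zt; apply => s sr.
by rewrite add0r pM.
Qed.

(** On the disc of radius [r / n] the Bernstein-Walsh factor is at most [expR 1], so a one-term
    Taylor remainder serves as a Lipschitz bound in place of Bernstein's derivative inequality. *)
Lemma poly_osc_le p n x0 r M s : (size p <= n.+1)%N -> (0 < n)%N -> 0 < r ->
  (forall s, `|s| <= r -> cmod p.[(x0 + s)%:C] <= M) -> `|s| <= r / n%:R / 2 ->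
  cmod (p.[(x0 + s)%:C] - p.[x0%:C]) <= 8 * (M * expR 1) * (n%:R * `|s| / r).
Proof.
move=> sp n0 r0 pM sr.
have nR : 0 < n%:R :> R by rewrite ltr0n.
have rn : 0 < r / n%:R by rewrite divr_gt0.
have dF z : cdiff (fun w => p.[x0%:C + w]) z.
  apply: (@cdiff_comp _ (fun w => x0%:C + w) (fun w => p.[w])); last exact: cdiff_horner.
  by apply: cdiffD; [exact: cdiff_cst|exact: cdiff_id].
have := @taylor_remainder _ _ dF s%:C 1 (r / n%:R) (M * expR 1) rn.
rewrite big_ord1 expr0 mulr1 taylor_coeff0 // addr0 expr1 cmod_real rmorphD.
have -> : `|s| / (r / n%:R) = n%:R * `|s| / r by field; rewrite !gt_eqF.
apply => // z zr.
have M0 : 0 <= M by rewrite (le_trans (cmod_ge0 p.[(x0 + 0)%:C])) // pM // normr0 ltW.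
rewrite (le_trans (bernstein_walsh _ sp r0 pM)) // ler_wpM2l // ler_expR mulrA.
by rewrite ler_pdivrMr // mul1r mulrC -ler_pdivlMr.
Qed.

End BernsteinWalsh.

(** * Weighted norms *)

Section Dilation.
Context {R : realType}.
Local Notation mu := (@lebesgue_measure R).
Local Open Scope ereal_scope.

Definition dilation (c : R) : measurableTypeR R -> measurableTypeR R := fun x => (c * x)%R.

Lemma measurable_dilation (c : R) : measurable_fun setT (dilation c).
Proof. by apply: measurable_funM; [exact: measurable_cst|exact: measurable_id]. Qed.

(** Lebesgue measure is [c] times its image under the dilation, since both agree on half-open
    intervals. *)
Lemma ge0_integral_dilation (c : R) (D : set R) (f : R -> \bar R) : (0 < c)%R ->
  measurable D -> measurable_fun D f -> (forall y, D y -> 0 <= f y) ->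
  \int[mu]_(y in D) f y = c%:E * \int[mu]_(x in dilation c @^-1` D) f (c * x)%R.
Proof.
move=> c0 mD mf f0; pose k := NngNum (ltW c0).
have f0' : {in D, forall y, 0 <= f y} by move=> y /set_mem /f0.
have := @ge0_integral_pushforward _ _ _ _ R _ (measurable_dilation c) mu D f mD mf f0'.
rewrite -[X in c%:E * X]/(\int[mu]_(x in dilation c @^-1` D) (f \o dilation c) x) => <-.
pose m := measure_function_pushforward__canonical__measure_function_Measure mu (measurable_dilation c).
rewrite -[X in _ = c%:E * X]/(\int[m]_(y in D) f y).
have <- : \int[mscale k m]_(x in D) f x = c%:E * \int[m]_(x in D) f x.
  exact: (@ge0_integral_mscale _ _ R m D mD k f mf f0).
apply: eq_measure_integral => A mA _; apply: lebesgue_measure_unique => //= _ [[a b]] _ <-.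
rewrite /mscale /m /= /pushforward /=.
have -> : dilation c @^-1` `]a, b] = `](a / c)%R, (b / c)%R]%classic.
  apply/seteqP; split => x /=;
    by rewrite !in_itv /= /dilation [(c * x)%R]mulrC ltr_pdivrMr // ler_pdivlMr.
rewrite !lebesgue_measure_itv /= !lte_fin ltr_pM2r ?invr_gt0 //.
case: ifP => _; last by rewrite mule0.
by rewrite -!EFinB -EFinM -mulrBl mulrCA divff ?mulr1 // gt_eqF.
Qed.

End Dilation.

Section WeightedNorm.
Context {R : realType}.
Local Notation mu := (@lebesgue_measure R).
Variables (nu : R) (p : \bar R).
Hypothesis (hnu : - (1 / 2) <= nu) (hp : (0 < p)%E).
Local Notation w := (bessel_weight nu).
Implicit Types (Om : set R) (f g : R -> R[i]) (t x A c r : R).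

Let a0 : 0 <= 2 * nu + 1. Proof. by move: hnu; rewrite div1r; lra. Qed.

Lemma bessel_weight_ge0 t : 0 <= w t.
Proof. exact: powR_ge0. Qed.

Lemma bessel_weightM c t : w (c * t) = w c * w t.
Proof. by rewrite /bessel_weight normrM powRM. Qed.

Lemma bessel_weight_le t A : `|t| <= A -> w t <= A `^ (2 * nu + 1).
Proof.
by move=> tA; rewrite ge0_ler_powR // nnegrE // (le_trans _ tA).
Qed.

Lemma bessel_weight_ge t A : 0 <= A -> A <= `|t| -> A `^ (2 * nu + 1) <= w t.
Proof. by move=> A0 tA; rewrite ge0_ler_powR // nnegrE. Qed.

Lemma continuous_cmod f : rcont f -> continuous (fun t => cmod (f t)).
Proof.
move=> /rcontP cf t; apply/cvgrPdist_le => e /(cf t)[d d0 H].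
exists d => // s /=; rewrite distrC => sd; rewrite distrC.
by rewrite (le_trans (cmod_leB _ _)) // -{1}(subrKC t s) H.
Qed.

Lemma measurable_cmod f : rcont f -> measurable_fun setT (fun t => cmod (f t)).
Proof. by move=> /continuous_cmod; exact: continuous_measurable_fun. Qed.

Lemma measurable_bessel_weight : measurable_fun setT w.
Proof.
rewrite (_ : w = (@powR R ^~ (2 * nu + 1)) \o @Num.norm _ R); last by apply/funext.
by apply: measurableT_comp; [exact: measurable_powR|exact: normr_measurable].
Qed.

Lemma measurable_integrand Om r f : rcont f ->
  measurable_fun Om (fun t => (cmod (f t) `^ r * w t)%:E).
Proof.
move=> cf; apply/measurable_EFinP; apply: measurable_funTS; apply: measurable_funM.
  rewrite (_ : (fun x => _) = (@powR R ^~ r) \o (fun t => cmod (f t))); last by apply/funext.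
  by apply: measurableT_comp; [exact: measurable_powR|exact: measurable_cmod].
exact: measurable_bessel_weight.
Qed.

Lemma integrand_ge0 r f t : (0 <= (cmod (f t) `^ r * w t)%:E)%E.
Proof. by rewrite lee_fin mulr_ge0 // powR_ge0. Qed.

(** Upper bounds have a common form for all [p]: they unfold to an integral inequality for finite
    [p] and to a pointwise bound for [p = +oo]. *)
Definition norm_le Om f c := (weighted_norm Om w p f <= c%:E)%E.

Lemma norm_le_fin Om f c r : p = r%:E -> 0 <= c ->
  norm_le Om f c <-> (\int[mu]_(t in Om) (cmod (f t) `^ r * w t)%:E <= (c `^ r)%:E)%E.
Proof.
move=> pr c0; have r0 : 0 < r by move: hp; rewrite pr lte_fin.
rewrite /norm_le pr /=; set x := (\int[mu]_(t in Om) _)%E.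
have x0 : (0 <= x)%E by apply: integral_ge0 => t _; exact: integrand_ge0.
have memE (y : \bar R) : (0 <= y)%E -> y \in `[0%E, +oo%E].
  by move=> y0; rewrite in_itv /= y0 leey.
split=> h.
  have /(gt0_ler_poweR (ltW r0)) := h; rewrite -poweRrM mulVf ?gt_eqF // poweRe1 // poweR_EFin.
  by apply; rewrite memE ?poweR_ge0.
have /(gt0_ler_poweR (_ : 0 <= r^-1)) : (x <= (c `^ r)%:E)%E by [].
rewrite -poweR_EFin -poweRrM mulfV ?gt_eqF // poweRe1 ?lee_fin // invr_ge0 ltW // => /(_ isT).
by apply; rewrite memE ?poweR_ge0.
Qed.

(* On such a set the essential supremum of a continuous function is its supremum. *)
Definition fat Om := forall t d, Om t -> 0 < d -> exists u v, u < v /\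
  forall s, u <= s <= v -> Om s /\ `|s - t| < d.

Lemma fat_setT : fat setT.
Proof.
move=> t d _ d0; exists t, (t + d / 2); split; first by rewrite ltrDl divr_gt0.
move=> s /andP[ts st]; split => //; rewrite ger0_norm ?subr_ge0 //; lra.
Qed.

Lemma fat_itv A : 0 < A -> fat `[- A, A].
Proof.
move=> A0 t d; rewrite /= in_itv /= => /andP[tA1 tA2] d0.
have [t0|t0] := leP 0 t.
  exists (Num.max (-A) (t - d / 2)), t; split; first by rewrite gt_max; lra.
  move=> s; rewrite ge_max in_itv /= => /andP[/andP[s1 s2] s3]; split; first lra.
  by rewrite ltr_norml; lra.
exists t, (Num.min A (t + d / 2)); split; first by rewrite lt_min; lra.
move=> s; rewrite le_min in_itv /= => /andP[s1 /andP[s2 s3]]; split; first lra.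
by rewrite ltr_norml; lra.
Qed.

Lemma norm_le_infty Om f c : p = +oo%E -> 0 <= c -> fat Om -> rcont f ->
  norm_le Om f c <-> forall t, Om t -> cmod (f t) <= c.
Proof.
move=> py c0 Omf cf; rewrite /norm_le py /=; split => h.
  move=> t Omt; rewrite leNgt; apply/negP => ct.
  have cft : cmod (f s) @[s --> t] --> cmod (f t) by exact: continuous_cmod.
  move/cvgrPdist_lt : cft.
  move=> /(_ (cmod (f t) - c)); rewrite subr_gt0 => /(_ ct)[d /= d0 Hd].
  have [u [v [uv Huv]]] := Omf t d Omt d0.
  have /ess_supP[N [mN muN HN]] := h.
  have uvN : `[u, v] `<=` N.
    move=> s /=; rewrite in_itv /= => /Huv[Oms sd]; apply: HN => /=.
    rewrite patchE ifT ?inE // lee_fin; apply/negP; rewrite -ltNge.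
    have := Hd s; rewrite /= distrC => /(_ sd); rewrite ltr_norml => /andP[_]; lra.
  have : (mu `[u, v] <= mu N)%E by apply: le_measure; rewrite ?inE.
  by rewrite muN lebesgue_measure_itv /= lte_fin uv -EFinB lee_fin subr_le0 leNgt uv.
apply/ess_supP; apply: aeW => t; rewrite patchE; case: ifPn => [/set_mem /h|_];
  by rewrite lee_fin.
Qed.

End WeightedNorm.

Section LimInf.
Context {R : realType}.
Implicit Types (u : nat -> \bar R) (x : \bar R).
Local Open Scope ereal_scope.

Lemma limn_einf_ge u x J : (forall j, (J <= j)%N -> x <= u j) -> x <= limn_einf u.
Proof.
move=> H; rewrite limn_einf_lim; apply: lime_ge; first exact: is_cvg_einfs.
exists J => // n /= Jn; apply: le_ereal_inf_tmp => _ [m /= nm <-]; apply: H.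
exact: leq_trans nm.
Qed.

Lemma limn_einf_le u x : (forall j, u j <= x) -> limn_einf u <= x.
Proof.
move=> H; rewrite limn_einf_lim; apply: lime_le; first exact: is_cvg_einfs.
by exists 0%N => // n _; apply: (le_trans (ereal_inf_lbound _) (H n)); exists n => /=.
Qed.

End LimInf.

(** * Scaling, limits and lower bounds of the weighted norm *)

Section WeightedNormTheory.
Context {R : realType}.
Local Notation mu := (@lebesgue_measure R).
Variables (nu : R) (p : \bar R).
Hypothesis (hnu : - (1 / 2) <= nu) (hp : (0 < p)%E).
Local Notation w := (bessel_weight nu).
Local Notation norm_le := (norm_le nu p).
Implicit Types (Om : set R) (f g : R -> R[i]) (t x A c r : R).

(* [(2 nu + 2) / p], which is [0] for [p = +oo]. *)
Definition scale_exp : R := (2 * nu + 2) * fine (p^-1)%E.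
Local Notation s := scale_exp.

Let a0 : 0 <= 2 * nu + 1. Proof. by move: hnu; rewrite div1r; lra. Qed.

Lemma exponent_cases : (p = +oo%E /\ s = 0) \/
  exists r, [/\ p = r%:E, 0 < r & s = (2 * nu + 2) / r].
Proof.
rewrite /scale_exp; case: p hp => [r|_|//]; last by left; rewrite invey /= mulr0.
by rewrite lte_fin => r0; right; exists r; rewrite inver gt_eqF.
Qed.

Lemma scale_exp_ge0 : 0 <= s.
Proof.
case: exponent_cases => [[_ ->]//|[r [_ r0 ->]]]; rewrite divr_ge0 ?(ltW r0) //.
by move: a0; lra.
Qed.

Lemma norm_leW Om f c d : c <= d -> norm_le Om f c -> norm_le Om f d.
Proof. by move=> cd h; rewrite /norm_le (le_trans h) // lee_fin. Qed.

Lemma norm_leZ Om f c k : measurable Om -> fat Om -> rcont f -> 0 <= c ->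
  norm_le Om f c -> norm_le Om (fun t => k * f t) (cmod k * c).
Proof.
move=> mOm fOm cf c0.
have kc0 : 0 <= cmod k * c by rewrite mulr_ge0 // cmod_ge0.
have ckf : rcont (fun t => k * f t) by apply: rcontM => //; exact: rcont_cst.
case: exponent_cases => [[py _]|[r [pr r0 _]]].
  move=> /(norm_le_infty _ py c0 fOm cf) h; apply/norm_le_infty => // t Omt.
  by rewrite cmodM ler_wpM2l ?cmod_ge0 ?h.
move=> /(norm_le_fin _ hp _ _ pr c0) h; apply/(norm_le_fin _ hp _ _ pr kc0).
under eq_integral do rewrite cmodM powRM ?cmod_ge0 // -mulrA EFinM.
rewrite ge0_integralZl //; last 3 first.
- exact: measurable_integrand.
- by move=> t _; rewrite lee_fin mulr_ge0 // powR_ge0.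
- by rewrite lee_fin powR_ge0.
by rewrite powRM ?cmod_ge0 // EFinM lee_wpmul2l // lee_fin powR_ge0.
Qed.

(** The measure contributes [l] and the weight [l ^ (2 nu + 1)]; the root of their product is
    [l ^ s]. *)
Lemma norm_le_dilation l Om f c : 0 < l -> measurable Om -> fat Om ->
  fat (dilation l @^-1` Om) -> rcont f -> 0 <= c ->
  norm_le Om f c <-> norm_le (dilation l @^-1` Om) (fun t => f (l * t)) (l `^ (- s) * c).
Proof.
move=> l0 mOm fOm fOm' cf c0.
have lc0 : 0 <= l `^ (- s) * c by rewrite mulr_ge0 // powR_ge0.
have clf : rcont (fun t => f (l * t)).
  move/rcontP : cf => cf; apply/rcontP => t e /(cf (l * t))[d d0 H].
  exists (d / l); rewrite ?divr_gt0 // => h hd; rewrite mulrDr; apply: H.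
  by rewrite normrM gtr0_norm // mulrC -ltr_pdivlMr.
case: exponent_cases => [[py s0]|[r [pr r0 sr]]].
  have -> : l `^ (- s) * c = c by rewrite s0 oppr0 powRr0 mul1r.
  rewrite !(norm_le_infty _ py c0) //; split=> h t; first by move=> /h.
  by move=> Omt; have := h (l^-1 * t); rewrite /= /dilation mulVKf ?gt_eqF //; apply.
rewrite (norm_le_fin _ hp _ _ pr c0) (norm_le_fin _ hp _ _ pr lc0).
rewrite (ge0_integral_dilation l0 mOm); last 2 first.
- exact: measurable_integrand.
- by move=> t _; rewrite lee_fin mulr_ge0 // powR_ge0.
have mOm' : measurable (dilation l @^-1` Om : set R).
  by rewrite -[X in measurable X]setTI; exact: (@measurable_dilation R l measurableT Om mOm).
under eq_integral do rewrite bessel_weightM mulrCA EFinM.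
rewrite ge0_integralZl //; last 3 first.
- exact: (measurable_integrand _ _ clf).
- by move=> t _; rewrite lee_fin mulr_ge0 // powR_ge0.
- by rewrite lee_fin bessel_weight_ge0.
have Lw : l * w l = l `^ (1 + (2 * nu + 1)).
  rewrite /bessel_weight gtr0_norm // (@powRD _ l 1); last by apply/implyP => _; rewrite gt_eqF.
  by rewrite powRr1 ?(ltW l0).
rewrite muleA -EFinM Lw.
rewrite powRM ?powR_ge0 // -powRrM sr.
have -> : - ((2 * nu + 2) / r) * r = - (1 + (2 * nu + 1)) by field; rewrite gt_eqF.
rewrite powRN EFinM; set L := l `^ _; set x := integral _ _ _.
have L0 : 0 < L by rewrite powR_gt0.
by rewrite lee_pdivlMl.
Qed.

Lemma norm_le_interval A f c : 0 < A -> rcont f -> 0 <= c ->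
  norm_le `[- A, A]%classic f c <->
  norm_le `[- (1 : R), 1]%classic (fun t => f (A * t)) (A `^ (- s) * c).
Proof.
move=> A0 cf c0.
have E : dilation A @^-1` `[- A, A]%classic = `[- (1 : R), 1]%classic.
  have H x : (`|A * x| <= A) = (`|x| <= 1).
    by rewrite normrM gtr0_norm // -[X in _ <= X]mulr1 ler_pM2l.
  by apply/seteqP; split => x /=; rewrite !in_itv /= /dilation -!ler_norml H.
by rewrite -E; apply: norm_le_dilation => //; [exact: fat_itv|rewrite E; exact: fat_itv].
Qed.

Lemma norm_le_setT l f c : 0 < l -> rcont f -> 0 <= c ->
  norm_le setT f c <-> norm_le setT (fun t => f (l * t)) (l `^ (- s) * c).
Proof.
move=> l0 cf c0; rewrite -[X in _ <-> norm_le X _ _](preimage_setT (dilation l)).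
by apply: norm_le_dilation => //; rewrite ?preimage_setT; exact: fat_setT.
Qed.

Lemma norm_le_limit Om f c : (forall e, 0 < e -> norm_le Om f (c + e)) -> norm_le Om f c.
Proof.
by move=> H; apply/lee_addgt0Pr => e e0; rewrite -EFinD; exact: H.
Qed.

Lemma norm_le_fatou (Q : nat -> R -> R[i]) (A : nat -> R) f c :
  (forall j, 0 < A j) -> (forall K, exists J, forall j, (J <= j)%N -> K <= A j) ->
  (forall j, rcont (Q j)) -> rcont f -> 0 <= c ->
  (forall t e, 0 < e -> exists J, forall j, (J <= j)%N -> cmod (Q j t - f t) <= e) ->
  (forall j, norm_le `[- A j, A j]%classic (Q j) c) -> norm_le setT f c.
Proof.
move=> A0 Ainf cQ cf c0 Qf hQ.
have memA t : exists J, forall j, (J <= j)%N -> t \in `[- A j, A j]%classic.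
  have [J HJ] := Ainf `|t|; exists J => j /HJ; rewrite inE /= in_itv /= ler_norml //.
case: exponent_cases => [[py s0]|[r [pr r0 sr]]].
  apply/norm_le_infty => //; first exact: fat_setT.
  move=> t _; apply/ler_addgt0Pr => e e0.
  have [J1 H1] := Qf t e e0; have [J2 H2] := memA t.
  have := H1 (maxn J1 J2) (leq_maxl _ _); have /set_mem := H2 (maxn J1 J2) (leq_maxr _ _).
  set j := maxn _ _ => tj h.
  have := (norm_le_infty _ py c0 (fat_itv (A0 j)) (cQ j)).1 (hQ j) t tj => h'.
  rewrite -[f t](subrK (Q j t)) (le_trans (cmodD _ _)) // addrC lerD // cmod_distC //.
(* For fixed [t] with [f t != 0] and [j] large, [eta * cmod (f t) <= cmod (Q j t)]. The integrand of
   the shrunken function is thus below the lower limit in Fatou's lemma, without any limit of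
   powers. *)
suff H eta : 0 < eta < 1 -> norm_le setT (fun t => eta%:C * f t) c.
  (* Here [eta = (c + e / 2) / (c + e)], which lies in (0, 1) also for [c = 0] and satisfies
     [c <= eta * (c + e)]. *)
  apply: norm_le_limit => e e0; pose eta := c / (c + e) + e / (2 * (c + e)).
  have ce0 : 0 < c + e by lra.
  have he : eta * (c + e) = c + e / 2 by rewrite /eta; field; rewrite gt_eqF.
  have eta0 : 0 < eta by rewrite -(pmulr_lgt0 _ ce0) he; lra.
  have eta1 : eta < 1 by rewrite -(ltr_pM2r ce0) he; lra.
  have := H eta; rewrite eta0 eta1 => /(_ isT) h.
  have ceta : rcont (fun t => eta%:C * f t) by apply: rcontM => //; exact: rcont_cst.
  have := norm_leZ (eta%:C)^-1 measurableT fat_setT ceta c0 h.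
  rewrite cmodV cmod_real gtr0_norm //.
  have eta_neq0 : eta%:C != 0 :> R[i] by rewrite -cmod_gt0 cmod_real normr_gt0 gt_eqF.
  have -> : (fun t => (eta%:C)^-1 * (eta%:C * f t)) = f.
    by apply/funext => t; exact: mulKf.
  apply: norm_leW; rewrite mulrC ler_pdivrMr // mulrC he; lra.
move=> /andP[eta0 eta1]; apply/(norm_le_fin _ hp _ _ pr c0).
pose F j t := ((fun t => (cmod (Q j t) `^ r * w t)%:E) \_ `[- A j, A j]) t.
have mF j : measurable_fun setT (F j).
  apply/(measurable_restrictT _ _).1 => //; exact: measurable_integrand.
have F0 j t : setT t -> (0 <= F j t)%E.
  by move=> _; rewrite /F patchE; case: ifP => // _; rewrite lee_fin mulr_ge0 // powR_ge0.
have := fatou mu measurableT mF F0.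
have H1 : (limn_einf (fun n => \int[mu]_(x in setT) F n x) <= (c `^ r)%:E)%E.
  apply: limn_einf_le => j; rewrite -integral_mkcond.
  by apply/(norm_le_fin _ hp _ _ pr c0); exact: hQ.
move=> /le_trans /(_ H1); apply: le_trans; apply: ge0_le_integral => //.
- by move=> t _; rewrite lee_fin mulr_ge0 // powR_ge0.
- by apply: measurable_integrand; apply: rcontM => //; exact: rcont_cst.
- rewrite (_ : (fun t => _) = -%E \o (fun t => limn_esup ((fun n t => - F n t)%E ^~ t))); last by [].
  apply: measurableT_comp => //; apply: measurable_fun_limn_esup => // n.
  rewrite (_ : (fun t => _) = -%E \o F n); last by [].
  by apply: measurableT_comp; [exact: oppe_measurable|exact: mF].
move=> t _; have [ft0|ft0] := eqVneq (f t) 0.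
  rewrite ft0 mulr0 cmod0 powR0 ?gt_eqF // mul0r; apply: (@limn_einf_ge _ _ _ 0) => j _.
  exact: F0.
rewrite -cmod_gt0 in ft0.
have eft : 0 < (1 - eta) * cmod (f t) by rewrite mulr_gt0 // subr_gt0.
have [J1 H1'] := Qf t _ eft.
have [J2 H2] := memA t.
apply: (@limn_einf_ge _ _ _ (maxn J1 J2)) => j; rewrite geq_max => /andP[j1 j2].
rewrite /F patchE H2 // lee_fin ler_wpM2r ?bessel_weight_ge0 // ge0_ler_powR ?nnegrE ?cmod_ge0 ?(ltW r0) //.
rewrite cmodM cmod_real gtr0_norm //.
have := H1' j j1; have := cmod_lerB (f t) (Q j t); rewrite cmod_distC; lra.
Qed.

(** The second hypothesis on the interval keeps it away from [0], where the weight may vanish: there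
    the weight is at least [(v - u) ^ (2 nu + 1)], so that the integral has the order of a full
    power [s] of the length. *)
Lemma norm_le_lower Om f c u v m : measurable Om -> fat Om -> rcont f -> 0 <= c -> 0 <= m -> u < v ->
  (forall t, u <= t <= v -> Om t /\ m <= cmod (f t)) ->
  (forall t, u <= t <= v -> v - u <= `|t|) ->
  norm_le Om f c -> m * (v - u) `^ s <= c.
Proof.
move=> mOm fOm cf c0 m0 uv Hm Ht; case: exponent_cases => [[py s0]|[r [pr r0 sr]]].
  rewrite (norm_le_infty _ py c0) // => h; rewrite s0 powRr0 mulr1.
  have uuv : u <= u <= v by rewrite lexx ltW.
  by have [h1 h2] := Hm u uuv; rewrite (le_trans h2) // h.
move=> /(norm_le_fin _ hp _ _ pr c0) h.
have vu0 : 0 < v - u by rewrite subr_gt0.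
have H : (((m * (v - u) `^ s) `^ r)%:E <= (c `^ r)%:E)%E.
  apply: le_trans h; apply: (@le_trans _ _ (\int[mu]_(t in `[u, v]) (cmod (f t) `^ r * w t)%:E)%E); last first.
    apply: ge0_subset_integral => //.
    - exact: measurable_integrand.
    - by move=> t _; rewrite lee_fin mulr_ge0 // powR_ge0.
    - by move=> t /=; rewrite in_itv /= => /Hm[].
  apply: (@le_trans _ _ (\int[mu]_(t in `[u, v]) (m `^ r * (v - u) `^ (2 * nu + 1))%:E)%E).
    rewrite integral_cst //= lebesgue_measure_itv /= lte_fin uv -EFinB -EFinM lee_fin.
    rewrite powRM ?powR_ge0 // -powRrM sr divfK ?gt_eqF // -mulrA ler_wpM2l ?powR_ge0 //.
    rewrite (_ : (2 * nu + 2) = (2 * nu + 1) + 1); last by ring.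
    rewrite (@powRD _ (v - u) (2 * nu + 1) 1); last by apply/implyP => _; rewrite gt_eqF.
    by rewrite powRr1 ?(ltW vu0).
  apply: ge0_le_integral => //.
  - by move=> t _; rewrite lee_fin mulr_ge0 ?powR_ge0.
  - exact: measurable_integrand.
  - move=> t /=; rewrite in_itv /= => tuv; rewrite lee_fin ler_pM ?powR_ge0 //.
      by rewrite ge0_ler_powR ?nnegrE ?cmod_ge0 ?(ltW r0) //; case: (Hm t tuv).
    by rewrite bessel_weight_ge ?(ltW vu0) ?Ht.
rewrite leNgt; apply/negP => hc; move: H; rewrite lee_fin leNgt.
by rewrite gt0_ltr_powR ?nnegrE // mulr_ge0 // powR_ge0.
Qed.

Lemma norm_le_bounded A f M : 0 < A -> rcont f -> 0 <= M ->
  (forall t, `|t| <= A -> cmod (f t) <= M) ->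
  exists2 c, 0 <= c & norm_le `[- A, A]%classic f c.
Proof.
move=> A0 cf M0 fM; case: exponent_cases => [[py s0]|[r [pr r0 sr]]].
  exists M => //; apply/norm_le_infty => //; first exact: fat_itv.
  by move=> t /=; rewrite in_itv /= -ler_norml; exact: fM.
pose K := M `^ r * A `^ (2 * nu + 1) * (2 * A).
have K0 : 0 <= K by rewrite !mulr_ge0 ?powR_ge0 // ltW.
exists (K `^ r^-1); first exact: powR_ge0.
apply/(norm_le_fin _ hp _ _ pr (powR_ge0 K r^-1)); rewrite -powRrM mulVf ?gt_eqF //.
rewrite powRr1 //.
apply: (@le_trans _ _ (\int[mu]_(t in `[(- A)%R, A]) (M `^ r * A `^ (2 * nu + 1))%:E)%E).
  apply: ge0_le_integral => //.
  - by move=> t _; rewrite lee_fin mulr_ge0 // powR_ge0.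
  - exact: measurable_integrand.
  - move=> t /=; rewrite in_itv /= -ler_norml => tA; rewrite lee_fin ler_pM ?powR_ge0 //.
    by rewrite ge0_ler_powR ?nnegrE ?cmod_ge0 ?(ltW r0) ?fM.
  exact: bessel_weight_le.
rewrite integral_cst //= lebesgue_measure_itv /= lte_fin gtrN // -EFinB opprK -EFinM lee_fin /K.
by rewrite ler_wpM2l ?mulr_ge0 ?powR_ge0 // mulr2n mulrDl mul1r.
Qed.

End WeightedNormTheory.

(** * Comparison of weighted norms for polynomials *)

Section Nikolskii.
Context {R : realType}.
Local Notation mu := (@lebesgue_measure R).
Variables (nu : R) (p : \bar R).
Hypothesis (hnu : - (1 / 2) <= nu) (hp : (0 < p)%E).
Local Notation w := (bessel_weight nu).
Local Notation norm_le := (norm_le nu p).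
Local Notation s := (scale_exp nu p).
Implicit Types (f g : R -> R[i]) (t x A c r : R).

Let a0 : 0 <= 2 * nu + 1. Proof. by move: hnu; rewrite div1r; lra. Qed.

(** Either [e n <= eta * cmod (f t)], or [f t] is itself of the order of [e n]. Hence
    [cmod (Q n t) ^ r] is at most [(1 + eta) ^ r * cmod (f t) ^ r + (b * e n) ^ r], for every
    exponent [r > 0]. The last term integrates to [2 * (b * (e n * n ^ s)) ^ r], which explains the
    hypothesis on [e]; [G] is the room left for it between [eta] and [dl]. *)
Lemma norm_le_approx (Q : nat -> R -> R[i]) f c dl (e : nat -> R) :
  (forall n, rcont (Q n)) -> rcont f -> 0 < c -> 0 < dl -> norm_le setT f c ->
  (forall n t, `|t| <= n%:R -> cmod (Q n t - f t) <= e n) ->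
  (forall n, 0 <= e n) ->
  (forall k, 0 < k -> exists J, forall n, (J <= n)%N -> e n * n%:R `^ s <= k) ->
  exists J, forall n, (J <= n)%N -> norm_le `[- n%:R, n%:R]%classic (Q n) ((1 + dl) * c).
Proof.
move=> cQ cf c0 dl0 hf Qf e0 elim.
have dc0 : 0 <= (1 + dl) * c by rewrite mulr_ge0 ?ltW // ltr_wpDl // ltW.
case: (exponent_cases nu hp) => [[py s0]|[r [pr r0 sr]]].
  have dc : 0 < dl * c by rewrite mulr_gt0.
  have [J HJ] := elim _ dc; exists J.+1 => n Jn.
  have n0 : 0 < n%:R :> R by rewrite ltr0n (leq_trans _ Jn).
  apply/norm_le_infty => //; first exact: fat_itv.
  move=> t /=; rewrite in_itv /= -ler_norml => tn.
  have := (norm_le_infty nu py (ltW c0) fat_setT cf).1 hf t I => ft.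
  have := HJ n (ltnW Jn); rewrite s0 powRr0 mulr1 => en.
  rewrite -[Q n t](subrK (f t)) (le_trans (cmodD _ _)) //.
  by have := Qf n t tn; lra.
pose eta := dl / 2; have eta0 : 0 < eta by rewrite divr_gt0.
pose G := ((1 + dl) `^ r - (1 + eta) `^ r) * c `^ r.
have G0 : 0 < G.
  rewrite mulr_gt0 ?powR_gt0 // subr_gt0 gt0_ltr_powR ?nnegrE //; rewrite /eta; lra.
pose b := 1 + eta^-1; have b0 : 0 < b by rewrite ltr_wpDl // invr_gt0.
have G2 : 0 < G / 2 by rewrite divr_gt0.
have [J HJ] := elim ((G / 2) `^ r^-1 / b) (divr_gt0 (powR_gt0 _ G2) b0).
exists J.+1 => n Jn.
have n0 : 0 < n%:R :> R by rewrite ltr0n (leq_trans _ Jn).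
apply/(norm_le_fin _ hp _ _ pr dc0).
have cfr := (norm_le_fin nu hp _ _ pr (ltW c0)).1 hf.
have mI : measurable (`[- n%:R, n%:R]%classic : set R) by [].
apply: (@le_trans _ _ (\int[mu]_(t in `[(- n%:R)%R, n%:R])
   (((1 + eta) `^ r)%:E * (cmod (f t) `^ r * w t)%:E + (((b * e n) `^ r) * n%:R `^ (2 * nu + 1))%:E))%E).
  apply: ge0_le_integral => //.
  - by move=> t _; rewrite lee_fin mulr_ge0 // powR_ge0.
  - exact: measurable_integrand.
  - apply: emeasurable_funD => //; apply: measurable_funeM; exact: measurable_integrand.
  move=> t /=; rewrite in_itv /= -ler_norml => tn.
  rewrite -EFinM -EFinD lee_fin.
  have H : cmod (Q n t) `^ r <= (1 + eta) `^ r * cmod (f t) `^ r + (b * e n) `^ r.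
    have Qle : cmod (Q n t) <= cmod (f t) + e n.
      rewrite -[Q n t](subrK (f t)) addrC (le_trans (cmodD _ _)) // lerD2l; exact: Qf.
    have [h|h] := leP (e n) (eta * cmod (f t)).
      rewrite -powRM ?cmod_ge0 ?addr_ge0 ?(ltW eta0) // (@le_trans _ _ (((1 + eta) * cmod (f t)) `^ r)) //.
        rewrite ge0_ler_powR ?nnegrE ?cmod_ge0 ?mulr_ge0 ?cmod_ge0 ?addr_ge0 ?(ltW eta0) ?(ltW r0) //.
        by rewrite (le_trans Qle) // mulrDl mul1r lerD2l.
      by rewrite lerDl powR_ge0.
    apply: (@le_trans _ _ ((b * e n) `^ r)); last by rewrite lerDr mulr_ge0 // powR_ge0.
    rewrite ge0_ler_powR ?nnegrE ?cmod_ge0 ?mulr_ge0 ?(ltW b0) ?(ltW r0) //.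
    rewrite (le_trans Qle) // /b mulrDl mul1r addrC lerD2l.
    by rewrite -ler_pdivrMl ?invr_gt0 // invrK ltW.
  apply: (le_trans (ler_wpM2r (bessel_weight_ge0 nu t) H)).
  rewrite mulrDl -mulrA lerD2l ler_wpM2l ?powR_ge0 //; exact: bessel_weight_le.
rewrite ge0_integralD //; last 3 first.
- by move=> t _; rewrite -EFinM lee_fin !mulr_ge0 // ?powR_ge0.
- apply: measurable_funeM; exact: measurable_integrand.
- by move=> t _; rewrite lee_fin mulr_ge0 ?powR_ge0.
rewrite ge0_integralZl //; last 3 first.
- exact: measurable_integrand.
- by move=> t _; rewrite lee_fin !mulr_ge0 // ?powR_ge0.
- by rewrite lee_fin powR_ge0.
have fsub : (\int[mu]_(t in `[(- n%:R)%R, n%:R]) (cmod (f t) `^ r * w t)%:E <= (c `^ r)%:E)%E.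
  apply: le_trans cfr; apply: ge0_subset_integral => //.
    exact: measurable_integrand.
  by move=> t _; rewrite lee_fin !mulr_ge0 // ?powR_ge0.
rewrite integral_cst //= lebesgue_measure_itv /= lte_fin gtrN // -EFinB opprK -EFinM.
have -> : ((1 + dl) * c) `^ r = (1 + eta) `^ r * c `^ r + G.
  by rewrite powRM ?(ltW c0) ?addr_ge0 ?(ltW dl0) // /G; ring.
have -> : (((1 + eta) `^ r * c `^ r + G)%:E = ((1 + eta) `^ r)%:E * (c `^ r)%:E + G%:E)%E.
  by rewrite EFinD EFinM.
rewrite leeD //; first by rewrite lee_wpmul2l // lee_fin powR_ge0.
rewrite lee_fin.
have -> : (b * e n) `^ r * n%:R `^ (2 * nu + 1) * (n%:R + n%:R) = 2 * (b * (e n * n%:R `^ s)) `^ r.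
  rewrite !powRM ?mulr_ge0 ?powR_ge0 ?(ltW b0) // -powRrM sr divfK ?gt_eqF //.
  rewrite (_ : 2 * nu + 2 = 2 * nu + 1 + 1); last by ring.
  rewrite (@powRD _ n%:R (2 * nu + 1) 1); last by apply/implyP => _; rewrite gt_eqF.
  by rewrite powRr1 ?ler0n //; ring.
rewrite (_ : G = 2 * (G / 2)); last by field.
rewrite ler_pM2l // (@le_trans _ _ (((G / 2) `^ r^-1) `^ r)) //; last first.
  by rewrite -powRrM mulVf ?gt_eqF // powRr1 // ltW.
rewrite ge0_ler_powR ?nnegrE ?(ltW r0) ?powR_ge0 //.
  by rewrite !mulr_ge0 ?powR_ge0 // ltW.
by rewrite mulrC -ler_pdivlMr // HJ // ltnW.
Qed.

(** The interval lies on the side of [x] away from [0], at distance [l / 2] from [x], so that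
    [norm_le_lower] applies to it. *)
Lemma far_interval (x l : R) : 0 < l -> exists u v, v - u = l / 2 /\ u < v /\
  forall t, u <= t <= v -> [/\ `|t - x| <= l, `|t| <= `|x| + l & v - u <= `|t|].
Proof.
move=> l0; have [x0|x0] := leP 0 x.
  exists (x + l / 2), (x + l); split; [by field|split; first by lra].
  move=> t /andP[t1 t2]; have t0 : 0 <= t by lra.
  by rewrite (ger0_norm x0) (ger0_norm t0) ler_norml; split; [apply/andP; split| |]; lra.
exists (x - l), (x - l / 2); split; [by field|split; first by lra].
move=> t /andP[t1 t2]; have t0 : t <= 0 by lra.
by rewrite (ltr0_norm x0) (ler0_norm t0) ler_norml; split; [apply/andP; split| |]; lra.
Qed.

(* At a maximum of [|q(t)| (n^2 - t^2)^k] the Bernstein-Walsh estimate keeps [|q|] comparable to its value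
   on an interval of length of order [1 - |t| / n], on which the norm is then bounded below. *)
Lemma nikolskii (D : nat) dl : (0 < D)%N -> 0 < dl < 1 -> exists2 K, 0 <= K &
  forall (n : nat) (q : {poly R[i]}) c, (0 < n)%N -> (size q <= (D * n).+1)%N -> 0 <= c ->
  norm_le `[- n%:R, n%:R]%classic (fun t => q.[t%:C]) c ->
  forall x, `|x| <= (1 - dl) * n%:R -> cmod q.[x%:C] <= K * c.
Proof.
move=> D0 /andP[dl0 dl1].
(* The power of the damping factor must exceed [s], the power of the interval length in
   [norm_le_lower]; then [y ^+ k <= y ^ s] at the end. *)
have [k ks] : exists k : nat, s < k%:R.
  by exists (Num.Def.archi_bound s); apply: archi_boundP; exact: scale_exp_ge0.
have DR : 0 < D%:R :> R by rewrite ltr0n.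
(* [4 ^+ k] bounds the growth of [q] near the maximum point and [expR 1] comes from [poly_osc_le].
   With this constant [q] loses at most half of its value within distance [l], and
   [l / 2 = beta * (d / A)]. *)
pose e4 : R := 4 ^+ k * expR 1; have e40 : 0 < e4 by rewrite mulr_gt0 ?expR_gt0 ?exprn_gt0.
have e41 : 1 <= e4.
  by rewrite mulr_ege1 ?exprn_ege1 ?ler1n //; apply/ltW; rewrite expR_gt1.
pose beta : R := (64 * e4 * D%:R)^-1; have beta0 : 0 < beta by rewrite invr_gt0 !mulr_gt0.
exists (2 * beta `^ (- s) * (2 / dl) ^+ k).
  by rewrite !mulr_ge0 ?powR_ge0 ?exprn_ge0 ?divr_ge0 // ltW.
move=> n q c n0 sq c0 hq x xn.
pose A : R := n%:R; have A0 : 0 < A by rewrite ltr0n.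
have cq : rcont (fun t => q.[t%:C]).
  apply/rcontP => t e /(cdiff_ccont (cdiff_horner q t%:C))[d d0 H]; exists d => // u ud.
  by rewrite rmorphD; apply: H; rewrite cmod_real.
pose h t := cmod q.[t%:C] * (A ^+ 2 - t ^+ 2) ^+ k.
have ch : continuous h.
  move=> t; apply: cvgM; first exact: (continuous_cmod cq).
  apply: (continuous_comp (f := fun t => A ^+ 2 - t ^+ 2) (g := fun x => x ^+ k)).
    by apply: cvgB; [exact: cvg_cst|exact: exprn_continuous].
  exact: exprn_continuous.
have [x0 x0A hmax] : exists2 x0, x0 \in `[- A, A] & forall t, t \in `[- A, A] -> h t <= h x0.
  apply: EVT_max; first by rewrite -subr_ge0 opprK addr_ge0 // ltW.
  by apply: continuous_subspaceT; exact: ch.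
have {}hmax t : `|t| <= A -> h t <= h x0 by move=> tA; apply: hmax; rewrite in_itv /= -ler_norml.
have {}x0A : `|x0| <= A by rewrite ler_norml; move: x0A; rewrite in_itv.
have K0 : 0 <= 2 * beta `^ (- s) * (2 / dl) ^+ k.
  by rewrite !mulr_ge0 ?powR_ge0 ?exprn_ge0 ?divr_ge0 // ltW.
have fact t : A ^+ 2 - t ^+ 2 = (A - `|t|) * (A + `|t|).
  by rewrite -(real_normK (num_real t)); ring.
have xA : `|x| <= A by rewrite (le_trans xn) // -[leRHS]mul1r ler_pM2r // lerBlDr lerDl ltW.
have dlA : 0 < dl * A ^+ 2 by rewrite mulr_gt0 // exprn_gt0.
have xfac : dl * A ^+ 2 <= A ^+ 2 - x ^+ 2.
  rewrite fact expr2 mulrA ler_pM ?mulr_ge0 ?(ltW dl0) ?(ltW A0) //.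
    by move: xn; rewrite -/A; lra.
  by rewrite lerDl.
have hx : cmod q.[x%:C] * (dl * A ^+ 2) ^+ k <= h x0.
  apply: le_trans (hmax x xA); rewrite ler_wpM2l ?cmod_ge0 //.
  by apply: lerXn2r; rewrite ?nnegrE ?(ltW dlA) // (le_trans _ xfac) // ltW.
have [hx0|hx0] := leP (h x0) 0.
  have : cmod q.[x%:C] * (dl * A ^+ 2) ^+ k <= 0 by exact: le_trans hx hx0.
  rewrite pmulr_lle0 ?exprn_gt0 // => h1; rewrite (le_trans h1) // mulr_ge0 //.
pose d := A - `|x0|.
have q00 : 0 < cmod q.[x0%:C].
  rewrite lt_neqAle cmod_ge0 andbT eq_sym; apply: contraTneq hx0 => E.
  by rewrite /h E mul0r ltxx.
have k0 : (0 < k)%N by rewrite -(ltr0n R) (le_lt_trans _ ks) // scale_exp_ge0.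
have d0 : 0 < d.
  rewrite lt_neqAle subr_ge0 x0A andbT; apply: contraTneq hx0 => E.
  by rewrite /h fact -/d -E mul0r expr0n gtn_eqF // mulr0 ltxx.
have dA : d <= A by rewrite /d gerBl.
have x0fac : A ^+ 2 - x0 ^+ 2 <= 2 * A * d.
  rewrite fact -/d [d * _]mulrC ler_wpM2r ?(ltW d0) //; move: x0A; lra.
have x0fac0 : 0 <= A ^+ 2 - x0 ^+ 2.
  by rewrite fact -/d mulr_ge0 ?(ltW d0) // addr_ge0 // ltW.
pose M := 4 ^+ k * cmod q.[x0%:C].
(* Within [d / 2] of the maximum point the factor [A ^+ 2 - t ^+ 2] shrinks at most by [4]: it is at
   most [2 * A * d] at [x0] and at least [A * d / 2] nearby. *)
have near u : `|u| <= d / 2 -> cmod q.[(x0 + u)%:C] <= M.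
  move=> ud; have tA : d / 2 <= A - `|x0 + u|.
    by rewrite lerBrDr -lerBrDl (le_trans (ler_normD _ _)) // -/d; move: ud; rewrite /d; lra.
  have tA' : `|x0 + u| <= A by rewrite -subr_ge0 (le_trans _ tA) // divr_ge0 // ltW.
  have ufac : A * d / 2 <= A ^+ 2 - (x0 + u) ^+ 2.
    rewrite fact (_ : A * d / 2 = d / 2 * A); last by ring.
    by rewrite ler_pM ?divr_ge0 ?(ltW d0) ?(ltW A0) // lerDl.
  have Ad : 0 < A * d / 2 by rewrite divr_gt0 // mulr_gt0.
  have := hmax _ tA'; rewrite /h => H.
  rewrite -(ler_pM2r (exprn_gt0 k Ad)) (@le_trans _ _ (cmod q.[(x0 + u)%:C] * (A ^+ 2 - (x0 + u) ^+ 2) ^+ k)) //.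
    rewrite ler_wpM2l ?cmod_ge0 //; apply: lerXn2r; rewrite ?nnegrE ?(ltW Ad) // (le_trans _ ufac) // ltW //.
  have -> : M * (A * d / 2) ^+ k = cmod q.[x0%:C] * (4 * (A * d / 2)) ^+ k.
    by rewrite [in RHS]exprMn /M; ring.
  rewrite (le_trans H) // ler_wpM2l ?cmod_ge0 //.
  apply: lerXn2r; rewrite ?nnegrE ?mulr_ge0 ?(ltW A0) ?(ltW d0) //.
  by rewrite (le_trans x0fac) // le_eqVlt; apply/orP; left; apply/eqP; field.
pose l := d / (32 * e4 * D%:R * A).
have DnR : 0 < D%:R * A by rewrite mulr_gt0.
have l0 : 0 < l by rewrite divr_gt0 // -mulrA mulr_gt0 // mulr_gt0.
have Dn0 : (0 < D * n)%N by rewrite muln_gt0 D0.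
have DA1 : 1 <= D%:R * A by rewrite /A -natrM ler1n.
have low u : `|u| <= l -> cmod q.[x0%:C] / 2 <= cmod q.[(x0 + u)%:C].
  move=> ul.
  have d20 : 0 < d / 2 by rewrite divr_gt0.
  have lsmall : l <= d / 2 / (D * n)%:R / 2.
    rewrite /l natrM -/A ler_pdivrMr; last by rewrite -mulrA !mulr_gt0.
    have -> : d / 2 / (D%:R * A) / 2 * (32 * e4 * D%:R * A) = d * (8 * e4).
      by field; rewrite !gt_eqF.
    rewrite ler_peMr ?(ltW d0) //; move: e41; lra.
  have := poly_osc_le sq Dn0 d20 near (le_trans ul lsmall).
  have -> : 8 * (M * expR 1) * ((D * n)%:R * `|u| / (d / 2)) =
     cmod q.[x0%:C] * (16 * e4 * (D%:R * A) * `|u| / d).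
    by rewrite /M /e4 natrM -/A; field; rewrite gt_eqF.
  have : 16 * e4 * (D%:R * A) * `|u| / d <= 2^-1.
    rewrite ler_pdivrMr // -ler_pdivlMl; last by rewrite !mulr_gt0.
    rewrite (le_trans ul) // /l le_eqVlt; apply/orP; left; apply/eqP; field.
    by rewrite !gt_eqF.
  move=> h1 h2; have h3 := ler_wpM2l (ltW q00) h1.
  have := cmod_lerB q.[x0%:C] q.[(x0 + u)%:C]; rewrite cmod_distC => h4; have := le_trans h4 (le_trans h2 h3).
  by rewrite lerBlDr -lerBlDl; apply: le_trans; rewrite [X in X - _]splitr addrK.
have lA : l <= d.
  rewrite /l ler_pdivrMr; last by rewrite -mulrA !mulr_gt0.
  rewrite ler_peMr ?(ltW d0) // -mulrA mulr_ege1 // mulr_ege1 ?ler1n //.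
have Hc : cmod q.[x0%:C] / 2 * (l / 2) `^ s <= c.
  have mI : measurable (`[- A, A]%classic : set R) by [].
  have q2 : 0 <= cmod q.[x0%:C] / 2 by rewrite divr_ge0 // cmod_ge0.
  have [u [v [uv [uv0 far]]]] := far_interval x0 l0; rewrite -uv.
  apply: (norm_le_lower hnu hp mI (fat_itv A0) cq c0 q2 uv0 _ _ hq) => t /far[t1 t2 t3] //.
  split; last by rewrite -(subrKC x0 t); exact: low.
  by rewrite /= in_itv /= -ler_norml (le_trans t2) // -lerBrDl.
pose y := d / A.
have y0 : 0 < y by rewrite divr_gt0.
have y1 : y <= 1 by rewrite ler_pdivrMr // mul1r.
have ly : l / 2 = beta * y by rewrite /l /beta /y; field; rewrite !gt_eqF.
have Hq : cmod q.[x0%:C] * y `^ s <= 2 * beta `^ (- s) * c.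
  move: Hc; rewrite ly powRM ?(ltW beta0) ?(ltW y0) // powRN => Hc.
  have b0 : 0 < beta `^ s by rewrite powR_gt0.
  rewrite mulrAC ler_pdivlMr //; move: Hc.
  have -> : cmod q.[x0%:C] / 2 * (beta `^ s * y `^ s) = cmod q.[x0%:C] * y `^ s * beta `^ s / 2 by ring.
  by rewrite ler_pdivrMr // [c * 2]mulrC.
have yk : y ^+ k <= y `^ s.
  by rewrite -powR_mulrn ?(ltW y0) // ger_powR ?y0 // ltW.
have hx0M : h x0 <= cmod q.[x0%:C] * ((2 / dl) ^+ k * y ^+ k) * (dl * A ^+ 2) ^+ k.
  rewrite -mulrA ler_wpM2l ?cmod_ge0 // -!exprMn.
  apply: lerXn2r; first by rewrite nnegrE.
    rewrite nnegrE; apply: mulr_ge0; last exact: ltW.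
    by apply: mulr_ge0; [exact: divr_ge0 (ler0n _ _) (ltW dl0)|exact: ltW].
  rewrite (le_trans x0fac) // le_eqVlt; apply/orP; left; apply/eqP.
  by rewrite /y; field; rewrite !gt_eqF.
have := le_trans hx hx0M; rewrite ler_pM2r ?exprn_gt0 // => /le_trans; apply.
rewrite (@le_trans _ _ (cmod q.[x0%:C] * y `^ s * (2 / dl) ^+ k)) //.
  rewrite -mulrA [y `^ s * _]mulrC ler_wpM2l ?cmod_ge0 // ler_wpM2l //.
  by rewrite exprn_ge0 // divr_ge0 // ltW.
rewrite [X in _ <= X]mulrAC ler_wpM2r ?exprn_ge0 ?divr_ge0 ?(ltW dl0) //.
Qed.

End Nikolskii.

(** * The maximum principle *)

Section RealBounds.
Context {R : realType}.
Implicit Types (x y t K c s : R).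

Lemma expR1_le4 : expR 1 <= 4 :> R.
Proof.
have h : (2 : R)^-1 <= expR (- 2^-1).
  by apply: le_trans (expR_ge1Dx _); lra.
have : expR (2^-1 : R) <= 2.
  by rewrite -[leLHS]invrK -expRN -[leRHS]invrK lef_pV2 ?posrE ?expR_gt0 // invr_gt0.
move=> h2; have -> : (1 : R) = 2^-1 + 2^-1 by field.
rewrite expRD; have := expR_ge0 (2^-1 : R); nra.
Qed.

Lemma expR_nat_le4 n : expR n%:R <= 4 ^+ n :> R.
Proof.
rewrite -[n%:R]mulr1 expRM_natl; apply: lerXn2r; rewrite ?nnegrE ?expR_ge0 //.
exact: expR1_le4.
Qed.

(** With an integer [m > s], the exponential series bounds [th ^+ n] by a multiple of [n ^- m.+1],
    which leaves one spare power of [n]. *)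
Lemma geometric_powR_small K th s k : 0 <= K -> 0 < th < 1 -> 0 < k ->
  exists J, forall n, (J <= n)%N -> K * th ^+ n * n%:R `^ s <= k.
Proof.
move=> K0 /andP[th0 th1] k0; pose b := - ln th.
have b0 : 0 < b by rewrite oppr_gt0 ln_lt0 // th0.
have [m sm] : exists m : nat, s < m%:R.
  exists (Num.Def.archi_bound `|s|); rewrite (le_lt_trans (ler_norm s)) //; exact: archi_boundP.
pose C := K * (m.+1)`!%:R / b ^+ m.+1.
have C0 : 0 <= C by rewrite !mulr_ge0 ?invr_ge0 ?exprn_ge0 // ltW.
have [J HJ] : exists J : nat, C / k < J%:R.
  by exists (Num.Def.archi_bound (C / k)); apply: archi_boundP; rewrite divr_ge0 // ltW.
exists J.+1 => n Jn.
have n0 : 0 < n%:R :> R by rewrite ltr0n (leq_trans _ Jn).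
have n1 : 1 <= n%:R :> R by rewrite ler1n -(ltr0n R).
have thn : th ^+ n <= (m.+1)`!%:R / (b * n%:R) ^+ m.+1.
  have -> : th ^+ n = (expR (b * n%:R))^-1.
    by rewrite mulrC expRM_natl -exprVn -expRN opprK lnK.
  have bn0 : 0 < b * n%:R by rewrite mulr_gt0.
  rewrite -[leRHS]invrK lef_pV2 ?posrE ?expR_gt0 //; last first.
    by rewrite invr_gt0 divr_gt0 ?exprn_gt0 // ltr0n fact_gt0.
  rewrite invf_div; apply: le_trans (expR_ge1Dxn m (ltW bn0)); by rewrite lerDr.
have ns : n%:R `^ s <= n%:R ^+ m by rewrite -powR_mulrn ?ler0n // ler_powR // ltW.
apply: (@le_trans _ _ (C / n%:R)).
  rewrite -mulrA (le_trans (ler_wpM2l K0 (ler_pM _ _ thn ns))) ?powR_ge0 ?exprn_ge0 ?(ltW th0) //.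
  rewrite /C le_eqVlt; apply/orP; left; apply/eqP; rewrite exprMn !exprS; field.
  by rewrite ?expf_neq0 ?gt_eqF.
rewrite ler_pdivrMr // mulrC -ler_pdivrMr // (le_trans (ltW HJ)) // ler_nat ltnW //.
Qed.

End RealBounds.

Section MaximumPrinciple.
Context {R : realType}.
Implicit Types (F G : R[i] -> R[i]) (z w h : R[i]) (x y a b c d M : R).

(** The linear and the quadratic Taylor terms cancel over the four points: a discrete mean value
    property with a cubic error. *)
Lemma four_point_mean G z : (forall z, cdiff G z) -> exists B r, [/\ 0 <= B, 0 < r &
  forall t, 0 < t <= r -> 4 * cmod (G z) <=
    cmod (G (z + t%:C)) + cmod (G (z - t%:C)) + cmod (G (z + 'i * t%:C)) + cmod (G (z - 'i * t%:C))
    + B * t ^+ 3].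
Proof.
move=> dG; have [d d0 Hd] := cdiff_ccont (dG z) ltr01.
pose r := d / 2; have r0 : 0 < r by rewrite divr_gt0.
have rd : r < d by rewrite ltr_pdivrMr // mulr2n mulrDr mulr1 ltrDl.
pose M := cmod (G z) + 1.
have dH w : cdiff (fun w => G (z + w)) w.
  apply: (@cdiff_comp _ (fun w => z + w) G) => //.
  by apply: cdiffD; [exact: cdiff_cst|exact: cdiff_id].
have HM w : cmod w <= r -> cmod (G (z + w)) <= M.
  move=> wr; rewrite -[G (z + w)](subrK (G z)) (le_trans (cmodD _ _)) // addrC lerD2l.
  by apply: Hd; exact: le_lt_trans rd.
have M0 : 0 <= M by rewrite addr_ge0 // cmod_ge0.
exists (32 * M / r ^+ 3), (r / 2); split; first by rewrite !mulr_ge0 // invr_ge0 exprn_ge0 // ltW.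
  by rewrite divr_gt0.
move=> t /andP[t0 tr].
pose S w : R[i] := \sum_(k < 3) taylor_coeff (fun w => G (z + w)) k * w ^+ k.
have rem w : cmod w = t -> cmod (G (z + w) - S w)
   <= 8 * M * (t / r) ^+ 3.
  by move=> wt; have := @taylor_remainder _ _ dH w 3 r M r0 HM; rewrite wt; apply.
have c1 : cmod t%:C = t by rewrite cmod_real gtr0_norm.
have c2 : cmod ('i * t%:C) = t by rewrite cmodM cmod_i mul1r.
have := rem _ c1; have := rem (- t%:C); rewrite cmodN => /(_ c1).
have := rem _ c2; have := rem (- ('i * t%:C)); rewrite cmodN => /(_ c2).
move=> h1 h2 h3 h4.
have ES w : S w = G z + taylor_coeff (fun w => G (z + w)) 1 * w + taylor_coeff (fun w => G (z + w)) 2 * w ^+ 2.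
  by rewrite /S !big_ord_recl big_ord0 /= taylor_coeff0 // addr0 expr0 mulr1 expr1 addr0 !addrA.
have Egen (u v : R[i]) : v ^+ 2 = - (u ^+ 2) -> 4%:R * G z = S u + S (- u) + S v + S (- v).
  by move=> uv; rewrite !ES !sqrrN uv; ring.
have := Egen t%:C ('i * t%:C); rewrite exprMn sqr_i mulN1r => /(_ erefl) E.
have -> : 4 * cmod (G z) = cmod (4%:R * G z) by rewrite cmodM cmod_nat.
have tri w : cmod (G (z + w) - S w) <= 8 * M * (t / r) ^+ 3 -> cmod (S w) <= cmod (G (z + w)) + 8 * M * (t / r) ^+ 3.
  move=> hh; rewrite -[S w](subKr (G (z + w))) (le_trans (cmodB _ _)) // lerD2l //.
rewrite E (le_trans (cmodD _ _)) // (le_trans (lerD (cmodD _ _) (lexx _))) //.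
rewrite (le_trans (lerD (lerD (cmodD _ _) (lexx _)) (lexx _))) //.
have -> : 32 * M / r ^+ 3 * t ^+ 3 = 4 * (8 * M * (t / r) ^+ 3).
  by field; rewrite gt_eqF.
have id4 (g1 g2 g3 g4 e : R) : g1 + e + (g2 + e) + (g3 + e) + (g4 + e) = g1 + g2 + g3 + g4 + 4 * e by ring.
by rewrite -id4; exact: (lerD (lerD (lerD (tri _ h4) (tri _ h3)) (tri _ h2)) (tri _ h1)).
Qed.

(** The added term [ep * (x ^+ 2 + y ^+ 2)] makes the modulus strictly subharmonic. At an interior
    maximum of the sum the four-point mean would gain [4 * ep * h ^+ 2], more than the cubic error
    for small [h]. *)
Lemma max_rectangle G a b c d M : (forall z, cdiff G z) -> a <= b -> c <= d ->
  (forall x y, a <= x <= b -> c <= y <= d -> (x == a) || (x == b) || (y == c) || (y == d) ->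
    cmod (G (x +i* y)) <= M) ->
  forall x y, a <= x <= b -> c <= y <= d -> cmod (G (x +i* y)) <= M.
Proof.
move=> dG ab cd HM x y xab ycd.
pose B := (`|a| + `|b|) ^+ 2 + (`|c| + `|d|) ^+ 2.
have B0 : 0 <= B by rewrite addr_ge0 // sqr_ge0.
apply/ler_addgt0Pr => e e0; pose ep := e / (B + 1).
have B1 : 0 < B + 1 by lra.
have ep0 : 0 < ep by rewrite divr_gt0.
pose u (q : R * R) := cmod (G (q.1 +i* q.2)) + ep * (q.1 ^+ 2 + q.2 ^+ 2).
have cu : continuous u.
  move=> q; apply: cvgD; last first.
    apply: cvgM; first exact: cvg_cst.
    apply: cvgD; rewrite ?expr2; apply: cvgM; do ?[exact: cvg_fst|exact: cvg_snd].
  apply/cvgrPdist_le => e' e'0; have [dl dl0 Hd] := cdiff_ccont (dG (q.1 +i* q.2)) e'0.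
  exists (ball q.1 (dl / 2), ball q.2 (dl / 2)) => /=.
    by split; apply: nbhsx_ballx; rewrite divr_gt0.
  move=> [s t] [/= hs ht]; rewrite (le_trans (cmod_leB _ _)) // cmod_distC.
  have -> : s +i* t = (q.1 +i* q.2) + ((s - q.1) +i* (t - q.2)).
    by apply: complex_ext => /=; ring.
  apply: Hd; rewrite (le_lt_trans (cmod_le_ReIm _)) //= (splitr dl) ltrD // distrC //.
pose K : set (R * R) := `[a, b] `*` `[c, d].
have cK : compact K by apply: compact_setX; exact: segment_compact.
have K0 : K !=set0 by exists (a, c); split; rewrite /= in_itv /= lexx.
have [q qK qmax] := compact_EVT_max K0 cK (continuous_subspaceT cu).
case: q qK qmax => s t /set_mem[/=]; rewrite !in_itv /= => sab tcd qmax.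
have Kin s' t' : a <= s' <= b -> c <= t' <= d -> u (s', t') <= u (s, t).
  by move=> h1 h2; apply: qmax; rewrite inE; split; rewrite /= in_itv.
have sqB s' t' : a <= s' <= b -> c <= t' <= d -> s' ^+ 2 + t' ^+ 2 <= B.
  move=> h1 h2.
  have sq (p q r : R) : p <= q <= r -> q ^+ 2 <= (`|p| + `|r|) ^+ 2.
    move=> /andP[pq qr]; rewrite -(real_normK (num_real q)).
    apply: lerXn2r; rewrite ?nnegrE ?addr_ge0 //.
    rewrite ler_norml; have := ler_norm r; have := ler_norm (- p); rewrite normrN.
    by have := normr_ge0 p; have := normr_ge0 r; lra.
  by rewrite /B lerD // sq.
have fin : cmod (G (s +i* t)) <= M -> cmod (G (x +i* y)) <= M + e.
  move=> h; have := Kin x y xab ycd; rewrite /u /= => h1.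
  have h2 : 0 <= ep * (x ^+ 2 + y ^+ 2) by rewrite mulr_ge0 ?(ltW ep0) // addr_ge0 // sqr_ge0.
  have h3 : ep * (s ^+ 2 + t ^+ 2) <= e.
    rewrite (le_trans (ler_wpM2l (ltW ep0) (sqB s t sab tcd))) // /ep mulrAC ler_pdivrMr //.
    by rewrite ler_wpM2l ?(ltW e0) // lerDl.
  lra.
have [bd|] := boolP ((s == a) || (s == b) || (t == c) || (t == d)).
  by apply: fin; exact: HM.
rewrite !negb_or => /andP[/andP[/andP[sa sb] tc] td]; exfalso.
have [C [r [C0 r0 H4]]] := four_point_mean (s +i* t) dG.
have s1 : a < s by rewrite lt_neqAle eq_sym sa; case/andP: sab.
have s2 : s < b by rewrite lt_neqAle sb; case/andP: sab.
have t1 : c < t by rewrite lt_neqAle eq_sym tc; case/andP: tcd.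
have t2 : t < d by rewrite lt_neqAle td; case/andP: tcd.
(* Small enough to keep the four points in the rectangle and to have [C * h ^+ 3 <= ep * h ^+ 2]. *)
pose h := Num.min (Num.min r (ep / (C + 1))) (Num.min (Num.min (s - a) (b - s)) (Num.min (t - c) (d - t))).
have C1 : 0 < C + 1 by lra.
have h0 : 0 < h by rewrite !lt_min !subr_gt0 r0 divr_gt0 // s1 s2 t1 t2.
have : h <= h by [].
rewrite {2}/h !le_min => /andP[/andP[hr he] /andP[/andP[ha hb] /andP[hc hd]]].
have := H4 h; rewrite h0 hr => /(_ isT).
have E1 : (s +i* t) + h%:C = (s + h) +i* t by apply: complex_ext => /=; ring.
have E2 : (s +i* t) - h%:C = (s - h) +i* t by apply: complex_ext => /=; ring.
have E3 : (s +i* t) + 'i * h%:C = s +i* (t + h).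
  by apply: complex_ext; rewrite ?cReD ?cImD ?cReM ?cImM /=; ring.
have E4 : (s +i* t) - 'i * h%:C = s +i* (t - h).
  by apply: complex_ext; rewrite ?cReB ?cImB ?cReM ?cImM /=; ring.
rewrite E1 E2 E3 E4.
have in1 : c <= t - h <= d by rewrite lerBrDr -lerBrDl hc lerBlDr (le_trans (ltW t2)) // lerDl ltW.
have in2 : c <= t + h <= d by rewrite -lerBrDl hd andbT (le_trans (ltW t1)) // lerDl ltW.
have in3 : a <= s - h <= b by rewrite lerBrDr -lerBrDl ha lerBlDr (le_trans (ltW s2)) // lerDl ltW.
have in4 : a <= s + h <= b by rewrite -lerBrDl hb andbT (le_trans (ltW s1)) // lerDl ltW.
have := Kin (s + h) t; have := Kin (s - h) t; have := Kin s (t + h); have := Kin s (t - h).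
rewrite /u /= => k1 k2 k3 k4.
have {}k1 := k1 sab; have {}k2 := k2 sab.
have {}k1 := k1 in1; have {}k2 := k2 in2; have {}k3 := k3 in3 tcd; have {}k4 := k4 in4 tcd.
have hC : C * h ^+ 3 <= ep * h ^+ 2.
  rewrite exprS mulrA ler_wpM2r ?sqr_ge0 //.
  by rewrite (@le_trans _ _ ((C + 1) * h)) ?ler_wpM2r ?(ltW h0) ?lerDl // mulrC -ler_pdivlMr.
have eh : 0 < ep * h ^+ 2 by rewrite mulr_gt0 // exprn_gt0.
move: k1 k2 k3 k4 hC eh; clear.
move: (cmod _) (cmod _) (cmod _) (cmod _) (cmod _) => g1 g2 g3 g4 g5.
by move: (C * h ^+ 3) => Ch; nra.
Qed.

End MaximumPrinciple.

(** * Functions of exponential type *)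

Section ExponentialType.
Context {R : realType}.
Implicit Types (F G : R[i] -> R[i]) (z w h : R[i]) (x y a b c d M C T sg : R).

(** One explicit bound instead of the family in [exp_type]: each estimate uses a single [T],
    slightly above [1], or below [1] after a dilation. *)
Definition growth_le F C T := (forall z, cdiff F z) /\ forall z, cmod (F z) <= C * expR (T * cmod z).

Lemma growth_ge0 F C T : growth_le F C T -> 0 <= C.
Proof.
move=> [_ /(_ 0)]; rewrite cmod0 mulr0 expR0 mulr1; exact: le_trans (cmod_ge0 _).
Qed.

Definition taylor_poly F m : {poly R[i]} := \poly_(k < m) taylor_coeff F k.

Lemma size_taylor_poly F m : (size (taylor_poly F m) <= m)%N.
Proof. exact: size_poly. Qed.

Lemma taylor_polyE F m z : (taylor_poly F m).[z] = \sum_(k < m) taylor_coeff F k * z ^+ k.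
Proof. exact: horner_poly. Qed.

(** On the disc of radius [4 * n] the function is at most [C * expR (8 * n%:R)], hence at most
    [C * 2 ^+ (16 * n)], while [32 * n] Taylor terms gain [2 ^- (32 * n)]. This is the origin of the
    [32]. *)
Lemma growth_le_taylor F C T (n : nat) z : growth_le F C T -> T <= 2 -> cmod z <= 2 * n%:R ->
  cmod (F z - (taylor_poly F (32 * n)).[z]) <= 8 * C * 2^-1 ^+ n.
Proof.
move=> gF T2 zn; have C0 := growth_ge0 gF; case: gF => dF FC.
have [n0|n0] := posnP n.
  move: zn; rewrite n0 muln0 mulr0 => z0.
  have {z0}-> : z = 0 by apply/eqP; rewrite -cmod_eq0 eq_le z0 cmod_ge0.
  rewrite taylor_polyE big_ord0 subr0 (le_trans (FC 0)) // cmod0 mulr0 expR0 expr0 !mulr1.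
  by rewrite ler_peMl // ler1n.
have nR : 0 < n%:R :> R by rewrite ltr0n.
pose r : R := 4 * n%:R; have r0 : 0 < r by rewrite mulr_gt0.
pose M := C * expR (8 * n%:R).
have HM w : cmod w <= r -> cmod (F w) <= M.
  move=> wr; rewrite (le_trans (FC w)) // ler_wpM2l // ler_expR.
  have : T * cmod w <= 2 * r by rewrite (le_trans (ler_wpM2r (cmod_ge0 _) T2)) // ler_pM2l.
  by rewrite /r; lra.
have zr : cmod z <= r / 2 by rewrite /r; lra.
have := @taylor_remainder _ F dF z (32 * n) r M r0 HM zr.
rewrite taylor_polyE => /le_trans; apply; rewrite /M mulrA -[leLHS]mulrA ler_wpM2l ?mulr_ge0 //.
have h1 : (cmod z / r) ^+ (32 * n) <= (2^-1) ^+ (32 * n).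
  apply: lerXn2r; rewrite ?nnegrE ?divr_ge0 ?cmod_ge0 ?(ltW r0) //.
  by rewrite ler_pdivrMr // mulrC; move: zr; lra.
have h2 : expR (8 * n%:R) <= 4 ^+ (8 * n) :> R by rewrite -natrM; exact: expR_nat_le4.
apply: (le_trans (ler_pM (expR_ge0 _) _ h2 h1)).
  by rewrite exprn_ge0 // divr_ge0 ?cmod_ge0 // ltW.
rewrite exprM [X in _ * X]exprM -exprMn.
apply: lerXn2r; rewrite ?nnegrE ?mulr_ge0 ?exprn_ge0 ?invr_ge0 //.
have -> : (4 : R) = 2 ^+ 2 by rewrite expr2; ring.
rewrite -exprM (_ : (32 = 16 + 15 + 1)%N) // !exprD mulrA mulrA.
rewrite -exprMn divff // expr1n mul1r expr1.
rewrite ler_piMl ?invr_ge0 // exprn_ile1 ?invr_ge0 // invf_le1 // ler1n //.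
Qed.

Lemma cdiff_rcont F : (forall z, cdiff F z) -> rcont (fun t => F t%:C).
Proof. by move=> dF; exact: (ccont_rcont_h 0 (fun z => cdiff_ccont (dF z))). Qed.

(** The Taylor polynomials with [32 * n] terms are exponentially close to [F] on [[-n, n]], so their
    norms there are bounded. The Nikolskii bound then holds on half the interval with a constant
    independent of [n]. *)
Lemma growth_bounded_real nu (p : \bar R) F C T c : - (1 / 2) <= nu -> (0 < p)%E ->
  growth_le F C T -> T <= 2 -> 0 <= c -> norm_le nu p setT (fun t => F t%:C) c ->
  exists2 M, 0 <= M & forall x, cmod (F x%:C) <= M.
Proof.
move=> hnu hp gF T2 c0 hF; have C0 := growth_ge0 gF.
have half01 : 0 < (2^-1 : R) < 1.
  by apply/andP; split; [rewrite invr_gt0|rewrite invf_lt1 // ltr1n].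
have [K K0 HK] := nikolskii hnu hp (isT : (0 < 32)%N) half01.
have hF1 : norm_le nu p setT (fun t => F t%:C) (c + 1) by apply: norm_leW hF; rewrite lerDl.
have c10 : 0 < c + 1 by lra.
pose e n : R := 8 * C * 2^-1 ^+ n.
have e0 n : 0 <= e n by rewrite /e !mulr_ge0 // exprn_ge0 // invr_ge0.
have cQ n : rcont (fun t => (taylor_poly F (32 * n)).[t%:C]).
  by apply: cdiff_rcont => z; exact: cdiff_horner.
have cF : rcont (fun t => F t%:C) by apply: cdiff_rcont; case: gF.
have Qe n t : `|t| <= n%:R -> cmod ((taylor_poly F (32 * n)).[t%:C] - F t%:C) <= e n.
  move=> tn; rewrite cmod_distC; apply: growth_le_taylor gF T2 _.
  by rewrite cmod_real (le_trans tn) // ler_peMl // ler1n.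
have elim (k : R) : 0 < k -> exists J, forall n, (J <= n)%N -> e n * n%:R `^ scale_exp nu p <= k.
  by move=> k0; apply: geometric_powR_small => //; rewrite mulr_ge0.
have [J HJ] := norm_le_approx hnu hp cQ cF c10 ltr01 hF1 Qe e0 elim.
exists (K * ((1 + 1) * (c + 1)) + 8 * C).
  by rewrite addr_ge0 ?mulr_ge0 // ltW.
move=> x; have [m xm] : exists m : nat, 2 * `|x| < m%:R.
  by exists (Num.Def.archi_bound (2 * `|x|)); apply: archi_boundP; rewrite mulr_ge0.
pose n := (maxn J m).+1.
have xn : `|x| <= (1 - 2^-1) * n%:R.
  have : m%:R <= n%:R :> R by rewrite ler_nat (leq_trans (leq_maxr J m)).
  by move: xm; lra.
have Jn : (J <= n)%N by rewrite (leq_trans (leq_maxl J m)).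
have c20 : 0 <= (1 + 1) * (c + 1) by rewrite mulr_ge0 // ltW.
have := HK n _ _ isT (leqW (size_taylor_poly F (32 * n))) c20 (HJ n Jn) x xn => h1.
have h2 : cmod (F x%:C - (taylor_poly F (32 * n)).[x%:C]) <= 8 * C.
  rewrite cmod_distC; apply: (le_trans (Qe n x _)).
    by rewrite (le_trans xn) // ler_piMl // lerBlDr lerDl invr_ge0.
  by rewrite /e ler_piMr ?mulr_ge0 // exprn_ile1 ?invr_ge0 // invf_le1 // ler1n.
by rewrite -[F _](subrKC (taylor_poly F (32 * n)).[x%:C]) (le_trans (cmodD _ _)) // lerD.
Qed.

(** The rate [64] is the degree [32 * m] divided by the half-length [m / 2]. It is crude but uniform
    in [x], as the Phragmen-Lindelof argument and [bessel_bounded] require. *)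
Lemma growth_strip F C T M x y : growth_le F C T -> T <= 2 -> (forall t, cmod (F t%:C) <= M) ->
  cmod (F (x +i* y)) <= (M + 16 * C) * expR (64 * `|y|).
Proof.
move=> gF T2 FM; have C0 := growth_ge0 gF.
have M0 : 0 <= M by exact: le_trans (cmod_ge0 _) (FM 0).
have [m xm] : exists m : nat, 2 * (`|x| + `|y|) < m%:R.
  by exists (Num.Def.archi_bound (2 * (`|x| + `|y|))); apply: archi_boundP; rewrite mulr_ge0 // addr_ge0.
have m0 : 0 < m%:R :> R by rewrite (le_lt_trans _ xm) // mulr_ge0 // addr_ge0.
have e8 : 8 * C * 2^-1 ^+ m <= 8 * C.
  by rewrite ler_piMr ?mulr_ge0 // exprn_ile1 ?invr_ge0 // invf_le1 // ler1n.
have near z : cmod z <= m%:R -> cmod (F z - (taylor_poly F (32 * m)).[z]) <= 8 * C.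
  move=> zm; apply: le_trans (growth_le_taylor gF T2 _) e8.
  by rewrite (le_trans zm) // ler_peMl // ler1n.
have r0 : 0 < m%:R / 2 :> R by rewrite divr_gt0.
have SM s : `|s| <= m%:R / 2 -> cmod (taylor_poly F (32 * m)).[(x + s)%:C] <= M + 8 * C.
  move=> sm; set S := (taylor_poly _ _).[_].
  rewrite -[S](subrKC (F (x + s)%:C)) (le_trans (cmodD _ _)) // lerD // cmod_distC near //.
  rewrite cmod_real (le_trans (ler_normD _ _)) //; have := normr_ge0 y; move: xm; lra.
have := bernstein_walsh ('i * y%:C) (leqW (size_taylor_poly F (32 * m))) r0 SM.
have -> : x%:C + 'i * y%:C = x +i* y by rewrite [RHS]complexEr.
rewrite cmodM cmod_i mul1r cmod_real natrM.
have -> : 32 * m%:R * (`|y| / (m%:R / 2)) = 64 * `|y| by field; rewrite gt_eqF.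
move=> h1; have h2 : cmod (F (x +i* y) - (taylor_poly F (32 * m)).[x +i* y]) <= 8 * C.
  apply: near; rewrite (le_trans (cmod_le_ReIm _)) //=; have := normr_ge0 x; have := normr_ge0 y; move: xm; lra.
rewrite -[F _](subrKC (taylor_poly F (32 * m)).[x +i* y]) (le_trans (cmodD _ _)) //.
rewrite (le_trans (lerD h1 h2)) //.
have : 8 * C <= 8 * C * expR (64 * `|y|).
  by rewrite ler_peMr ?mulr_ge0 // -expR0 ler_expR mulr_ge0.
have -> : (M + 16 * C) * expR (64 * `|y|) = (M + 8 * C) * expR (64 * `|y|) + 8 * C * expR (64 * `|y|) by ring.
by rewrite lerD2l.
Qed.

(** Reflection in the imaginary axis, which carries the quadrant estimate to the left half of the
    upper half-plane. *)
Lemma cdiff_reflect F z : (forall z, cdiff F z) -> cdiff (fun z => (F (- z^*%C))^*%C) z.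
Proof.
move=> dF; have [D HD] := dF (- z^*%C); exists (- D^*%C) => e /HD[d d0 H].
exists d => // h hd; have := H (- h^*%C); rewrite cmodN cmod_conj => /(_ hd).
rewrite -opprD -rmorphD mulrN opprK => {}H.
rewrite -cmod_conj rmorphB /= rmorphB /= !conjcK rmorphM /= rmorphN /= conjcK mulNr opprK.
exact: H.
Qed.

Lemma growth_reflect F C T : growth_le F C T -> growth_le (fun z => (F (- z^*%C))^*%C) C T.
Proof.
move=> [dF FC]; split=> z; first exact: cdiff_reflect.
by rewrite cmod_conj (le_trans (FC _)) // cmodN cmod_conj.
Qed.

(* Phragmen-Lindelof in a quadrant: the multiplier [exp (i sg z + i ep z^2)] has modulus at most 1
   there, damps the growth on vertical lines far to the right, and on the remaining half-strip
   [T < sg] already makes the product small. *)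
Lemma phragmen_lindelof_quadrant F C T M sg : growth_le F C T -> T <= 2 -> 0 <= T -> T < sg ->
  (forall t, cmod (F t%:C) <= M) ->
  forall x y, 0 <= x -> 0 <= y -> cmod (F (x +i* y)) <= (M + 16 * C) * expR (sg * y).
Proof.
move=> gF T2 T0 Tsg FM x y x0 y0; have C0 := growth_ge0 gF.
have M0 : 0 <= M by exact: le_trans (cmod_ge0 _) (FM 0).
pose M' := M + 16 * C; have M'0 : 0 <= M' by rewrite addr_ge0 // mulr_ge0.
have sg0 : 0 < sg by exact: le_lt_trans Tsg.
have [dF FC] := gF.
suff H ep : 0 < ep -> cmod (F (x +i* y)) <= M' * expR (sg * y + 2 * ep * (x * y)).
  have [xy0|xy0] := eqVneq (x * y) 0.
    by have := H 1 ltr01; rewrite xy0 mulr0 addr0.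
  have xyp : 0 < x * y by rewrite lt_neqAle eq_sym xy0 mulr_ge0.
  apply/ler_addgt0Pr => e e0.
  have M1 : 0 < M' * expR (sg * y) + 1.
    by rewrite ltr_wpDl // mulr_ge0 // expR_ge0.
  pose q := ln (1 + e / (M' * expR (sg * y) + 1)).
  have q0 : 0 < q by rewrite ln_gt0 // ltrDl divr_gt0.
  have := H (q / (2 * (x * y))) (divr_gt0 q0 (mulr_gt0 (ltr0Sn _ 1) xyp)).
  have gen (u : R) : u != 0 -> 2 * (q / (2 * u)) * u = q by move=> u0; field.
  rewrite gen //.
  rewrite expRD lnK; last by rewrite posrE addr_gt0 // divr_gt0.
  move=> /le_trans; apply; rewrite mulrA mulrDr mulr1 lerD2l mulrCA.
  rewrite -[leRHS]mulr1 ler_wpM2l ?(ltW e0) // ler_pdivrMr // mul1r lerDl //.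
move=> ep0.
(* On the right edge the damping [2 * ep * (u * v)] then absorbs the factor [expR (64 * v)] of
   [growth_strip]. *)
pose X := x + 64 / (2 * ep).
have X0 : 0 <= X by rewrite addr_ge0 // divr_ge0 // mulr_ge0 // ltW.
have Ts : 0 < sg - T by rewrite subr_gt0.
(* On the top edge [(sg - T) * v >= T * u] then holds for all [u <= X], so the growth bound
   suffices. *)
pose Y := y + T * X / (sg - T).
have Y0 : 0 <= Y by rewrite addr_ge0 // divr_ge0 ?(ltW Ts) // mulr_ge0.
pose G z := F z * cexp ('i * sg%:C * z + 'i * ep%:C * (z * z)).
have dG z : cdiff G z.
  apply: cdiffM => //; apply: (@cdiff_comp _ (fun z => 'i * sg%:C * z + 'i * ep%:C * (z * z)) cexp).
    apply: cdiffD; apply: cdiffM; do ?[exact: cdiff_cst|exact: cdiff_id].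
    by apply: cdiffM; exact: cdiff_id.
  exact: cdiff_cexp.
have GE u v : cmod (G (u +i* v)) = cmod (F (u +i* v)) * expR (- (sg * v) - 2 * ep * (u * v)).
  rewrite /G cmodM cmod_cexp; congr (_ * expR _).
  by rewrite !(cReD, cReM, cImM) /=; ring.
have bd u v : 0 <= u <= X -> 0 <= v <= Y -> (u == 0) || (u == X) || (v == 0) || (v == Y) ->
    cmod (G (u +i* v)) <= M'.
  move=> /andP[u0 uX] /andP[v0 vY] h; rewrite GE.
  have uv0 : 0 <= 2 * ep * (u * v) by rewrite !mulr_ge0 // ltW.
  have growth : T * (u + v) <= sg * v -> cmod (F (u +i* v)) * expR (- (sg * v) - 2 * ep * (u * v)) <= M'.
    move=> hT; apply: (@le_trans _ _ (C * expR (T * (u + v)) * expR (- (sg * v) - 2 * ep * (u * v)))).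
      rewrite ler_wpM2r ?expR_ge0 // (le_trans (FC _)) // ler_wpM2l // ler_expR ler_wpM2l //.
      by rewrite (le_trans (cmod_le_ReIm _)) //= !ger0_norm.
    rewrite -mulrA -expRD; apply: (@le_trans _ _ C).
      rewrite ler_piMr // expR_le1.
      move: (T * (u + v)) (sg * v) (2 * ep * (u * v)) hT uv0; clear=> p1 p2 p3 ? ?; lra.
    by rewrite /M'; move: M0 C0; lra.
  case/orP: h => [/orP[/orP[/eqP E|/eqP E]|/eqP E]|/eqP E].
  - by apply: growth; rewrite E add0r ler_wpM2r // ltW.
  - have h1 := growth_strip u v gF T2 FM; rewrite (ger0_norm v0) in h1.
    apply: (le_trans (ler_wpM2r (expR_ge0 _) h1)).
    rewrite -[_ * expR _ * expR _]mulrA -expRD -/M' ler_piMr //.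
    rewrite expR_le1.
    have : 64 * v <= 2 * ep * (u * v).
      rewrite mulrA ler_wpM2r // E /X mulrDr -[leLHS]add0r lerD ?mulr_ge0 ?(ltW ep0) //.
      by rewrite le_eqVlt; apply/orP; left; apply/eqP; field; rewrite gt_eqF.
    by have : 0 <= sg * v by [rewrite mulr_ge0 // ltW]; lra.
  - rewrite E !mulr0 oppr0 addr0 expR0 mulr1 -[u +i* 0]/(u%:C) (le_trans (FM _)) //.
    by rewrite /M' lerDl mulr_ge0.
  - apply: growth; rewrite mulrDr -lerBrDr -mulrBl (le_trans (ler_wpM2l T0 uX)) //.
    have -> : (sg - T) * v = (sg - T) * y + T * X by rewrite E /Y; field; rewrite gt_eqF.
    by rewrite lerDr mulr_ge0 // ltW.
have xX : 0 <= x <= X by rewrite x0 lerDl divr_ge0 // mulr_ge0 // ltW.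
have yY : 0 <= y <= Y by rewrite y0 lerDl divr_ge0 ?(ltW Ts) // mulr_ge0.
have := max_rectangle dG X0 Y0 bd xX yY; rewrite GE => h.
rewrite -ler_pdivrMr ?expR_gt0 // -expRN (le_trans _ h) // ler_wpM2l ?cmod_ge0 // ler_expR.
by rewrite opprD.
Qed.

Lemma phragmen_lindelof F C T M sg : growth_le F C T -> T <= 2 -> 0 <= T -> T < sg ->
  (forall z, F (- z) = F z) -> (forall t, cmod (F t%:C) <= M) ->
  forall z, cmod (F z) <= (M + 16 * C) * expR (sg * `|complex.Im z|).
Proof.
move=> gF T2 T0 Tsg Fe FM.
have upper x y : 0 <= y -> cmod (F (x +i* y)) <= (M + 16 * C) * expR (sg * y).
  move=> y0; have [x0|/ltW x0] := leP 0 x.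
    exact: (phragmen_lindelof_quadrant gF).
  have := @phragmen_lindelof_quadrant _ C T M sg (growth_reflect gF) T2 T0 Tsg _ (- x) y.
  rewrite oppr_ge0 cmod_conj; have -> : - ((- x) +i* y)^*%C = x +i* y.
    by rewrite -[LHS]/((- - x) +i* (- - y)) !opprK.
  apply => // t; rewrite cmod_conj conjc_real -rmorphN; exact: FM.
move=> [x y] /=; have [y0|/ltW y0] := leP 0 y; first by rewrite ger0_norm // upper.
rewrite ler0_norm // -Fe; have -> : - (x +i* y) = (- x) +i* (- y) by [].
by apply: upper; rewrite oppr_ge0.
Qed.

End ExponentialType.

(** * Polynomial approximation of entire functions *)

Section ChebyshevTruncation.
Context {R : realType}.
Implicit Types (F : R[i] -> R[i]) (z w u : R[i]) (x y t h C T M K th sg : R).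

Lemma sum_geometric_le x n m : 0 <= x -> x < 1 ->
  \sum_(n <= k < m) x ^+ k <= x ^+ n / (1 - x).
Proof.
move=> x0 x1; have x10 : 0 < 1 - x by rewrite subr_gt0.
rewrite ler_pdivlMr //; have [mn|/ltnW nm] := leqP m n.
  by rewrite big_geq // mul0r exprn_ge0.
suff -> : (\sum_(n <= k < m) x ^+ k) * (1 - x) = x ^+ n - x ^+ m.
  by rewrite gerBl exprn_ge0.
elim: m nm => [|m IH].
  by rewrite leqn0 => /eqP ->; rewrite big_geq // subrr mul0r.
rewrite leq_eqVlt => /orP[/eqP ->|]; first by rewrite big_geq // subrr mul0r.
rewrite ltnS => nm; rewrite big_nat_recr //= mulrDl IH // exprSr; ring.
Qed.

Lemma Im_joukowski u r : 1 <= r -> cmod u = r ->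
  `|complex.Im ((u + u^-1) / 2)| <= (r - r^-1) / 2 /\ cmod ((u + u^-1) / 2) <= r.
Proof.
move=> r1 ur; have r0 : 0 < r by exact: lt_le_trans r1.
have u0 : u != 0 by rewrite -cmod_gt0 ur.
have rr : r^-1 <= r by rewrite (le_trans _ r1) // invf_le1.
split; last first.
  rewrite cmodM cmodV (cmod_nat 2) ler_pdivrMr // (le_trans (cmodD _ _)) // cmodV ur.
  by rewrite mulr2n mulrDr mulr1 lerD2l.
have -> : u^-1 = (r ^- 2)%:C * u^*%C.
  apply: (mulfI u0); rewrite divff // mulrCA.
  case: u ur u0 => a b /(congr1 (fun x => x ^+ 2)); rewrite cmod_sqr /= => h _.
  have h' : r ^- 2 * (a ^+ 2 + b ^+ 2) = 1 by rewrite h mulVf // expf_neq0 // gt_eqF.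
  by apply: complex_ext; rewrite ?cReM ?cImM /= -?h'; ring.
have Iu : `|complex.Im u| <= r by rewrite -ur cmod_Im.
have -> : complex.Im ((u + (r ^- 2)%:C * u^*%C) / 2) = complex.Im u * ((1 - r ^- 2) / 2).
  case: u {ur u0 Iu} => a b; rewrite -[2]/(2%:R) -(rmorph_nat (real_complex R)) -fmorphV /=.
  by rewrite ?cImM /=; ring.
have rr2 : 0 <= 1 - r ^- 2 by rewrite subr_ge0 invf_le1 ?exprn_gt0 // exprn_ege1.
rewrite normrM [X in _ * X]ger0_norm ?divr_ge0 // (le_trans (ler_wpM2r _ Iu)) ?divr_ge0 //.
by rewrite le_eqVlt; apply/orP; left; apply/eqP; field; rewrite gt_eqF.
Qed.

(** Cut at the largest even number not above [n], which is the degree in the polynomial problem; for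
    odd [n] the coefficient lost at the top has odd index. *)
Definition even_part (q : {poly R[i]}) n : {poly R[i]} :=
  \poly_(k < (n./2).*2.+1) (if odd k then 0 else q`_k).

Lemma size_even_part q n : (size (even_part q n) <= (n./2).*2.+1)%N.
Proof. exact: size_poly. Qed.

Lemma even_part_even q n z : (even_part q n).[- z] = (even_part q n).[z].
Proof.
rewrite !horner_poly; apply: eq_bigr => k _; case: ifPn => [_|ok]; first by rewrite !mul0r.
by rewrite exprNn -signr_odd (negbTE ok) expr0 mul1r.
Qed.

Lemma horner_even_part (q : {poly R[i]}) n z : (size q <= n.+1)%N ->
  (even_part q n).[z] = (q.[z] + q.[- z]) / 2.
Proof.
move=> sq; rewrite horner_poly !(horner_coef_wide _ sq) -big_split mulr_suml /=.
have E (k : nat) : (q`_k * z ^+ k + q`_k * (- z) ^+ k) / 2 = (if odd k then 0 else q`_k) * z ^+ k.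
  by rewrite exprNn -signr_odd; case: odd; rewrite ?expr1 ?expr0 ?mul0r ?mulN1r ?mul1r ?mulrN ?subrr ?mul0r // -mulr2n -(mulr_natr (q`_k * z ^+ k)) mulfK // pnatr_eq0.
transitivity (\sum_(k < n.+1) (if odd k then 0 else q`_k) * z ^+ k); last first.
  by apply: eq_bigr => k _; rewrite E.
have [m [Em|Em]] : exists m, n = m.*2 \/ n = m.*2.+1.
  exists n./2; case on : (odd n); [right|left]; by rewrite -[LHS]odd_double_half on.
  by rewrite Em doubleK.
by rewrite Em /= uphalf_double [RHS]big_ord_recr /= odd_double /= mul0r addr0.
Qed.

Lemma chebyshev_le1 k x : -1 <= x <= 1 -> cmod (chebyshev k).[x%:C] <= 1.
Proof.
move=> x1; pose u := x +i* Num.sqrt (1 - x ^+ 2).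
have x2 : 0 <= 1 - x ^+ 2 by rewrite subr_ge0 -[x ^+ 2]real_normK ?num_real // exprn_ile1 // ler_norml.
have u1 : cmod u = 1.
  by apply/eqP; rewrite -(@eqrXn2 _ 2) ?cmod_ge0 // cmod_sqr /= sqr_sqrtr // expr1n; apply/eqP; ring.
have u0 : u != 0 by rewrite -cmod_gt0 u1.
have -> : x%:C = (u + u^-1) / 2 by rewrite joukowski_unit.
rewrite horner_chebyshev // cmodM cmodV (cmod_nat 2) ler_pdivrMr // mul1r.
by rewrite (le_trans (cmodD _ _)) // cmodV !cmodX u1 expr1n invr1.
Qed.

Lemma chebyshev_truncation (b : nat -> R[i]) m n r K x : 1 < r -> (n <= m)%N ->
  (forall u, cmod u = r -> cmod (\sum_(j < m.+1) b j *: chebyshev j).[(u + u^-1) / 2] <= K) ->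
  -1 <= x <= 1 ->
  cmod ((\sum_(j < n.+1) b j *: chebyshev j).[x%:C] - (\sum_(j < m.+1) b j *: chebyshev j).[x%:C])
    <= 4 * K / (1 - r^-1) * r^-1 ^+ n.
Proof.
move=> r1 nm H x1; have r0 : 0 < r by exact: lt_trans r1.
have ri0 : 0 <= r^-1 by rewrite invr_ge0 ltW.
have ri1 : r^-1 < 1 by rewrite invf_lt1.
have K0 : 0 <= K.
  apply: le_trans (H r%:C _); first exact: cmod_ge0.
  by rewrite cmod_real ger0_norm // ltW.
rewrite -!(big_mkord xpredT (fun j => b j *: chebyshev j)) (big_cat_nat (n := n.+1) (p := m.+1)) //=.
rewrite hornerD opprD addNKr cmodN horner_sum (le_trans (cmod_sum _ _ _)) //.
apply: (@le_trans _ _ (4 * K * \sum_(n.+1 <= k < m.+1) r^-1 ^+ k)).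
  rewrite mulr_sumr; apply: ler_sum_nat => k /andP[nk km].
  rewrite hornerZ cmodM -[leRHS]mulr1 ler_pM ?cmod_ge0 ?chebyshev_le1 //.
  by rewrite exprVn ler_pdivlMr ?exprn_gt0 // (cheb_coef_le r0 H).
rewrite -[leRHS]mulrA ler_wpM2l ?mulr_ge0 // [leRHS]mulrC (le_trans (sum_geometric_le _ _ ri0 ri1)) //.
apply: ler_wpM2r; first by rewrite invr_ge0 subr_ge0 ltW.
by rewrite exprS ler_piMl ?exprn_ge0 // ltW.
Qed.

(* On the ellipse with semi-axis sum [1 + h] the rescaled function is at most [expR (sg h n)], so that its
   Chebyshev coefficients of index above [n] are small as soon as [expR (sg h) < 1 + h]. *)
Lemma even_truncation F C T M sg (n : nat) : growth_le F C T -> T <= 2 -> 0 <= T -> T < sg ->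
  sg < 1 -> (forall z, F (- z) = F z) -> (forall t, cmod (F t%:C) <= M) ->
  let h := (1 - sg) / 2 in
  exists Q : {poly R[i]}, [/\ (size Q <= (n./2).*2.+1)%N, forall z, Q.[- z] = Q.[z] &
   forall t, `|t| <= n%:R -> cmod (Q.[t%:C] - F t%:C) <=
     (4 * (M + 24 * C) / (1 - (1 + h)^-1) + 8 * C) * Num.max (expR (sg * h) / (1 + h)) 2^-1 ^+ n].
Proof.
move=> gF T2 T0 Tsg sg1 Fe FM h; have C0 := growth_ge0 gF.
have M0 : 0 <= M by exact: le_trans (cmod_ge0 _) (FM 0).
have sg0 : 0 < sg by exact: le_lt_trans Tsg.
have PL := phragmen_lindelof gF T2 T0 Tsg Fe FM.
have h0 : 0 < h by rewrite divr_gt0 // subr_gt0.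
have h1 : h <= 1 / 2 by rewrite /h; lra.
set r := 1 + h; have r0 : 0 < r by rewrite addr_gt0.
have r1 : 1 < r by rewrite ltrDl.
have rV1 : 0 < 1 - r^-1 by rewrite subr_gt0 invf_lt1.
set K2 := M + 24 * C; have K20 : 0 <= K2 by rewrite addr_ge0 // mulr_ge0.
set K := _ + 8 * C; have K0 : 0 <= K.
  by rewrite addr_ge0 ?mulr_ge0 // invr_ge0 ltW.
set th1 := _ / r; set th := Num.max _ _.
have th10 : 0 <= th1 by rewrite divr_ge0 ?expR_ge0 // ltW.
case: n => [|n0].
  exists 0; rewrite size_poly0; split => // [z|t]; first by rewrite !horner0.
  rewrite normr_le0 => /eqP ->; rewrite horner0 sub0r cmodN expr0 mulr1.
  have := gF.2 0; rewrite cmod0 mulr0 expR0 mulr1 => /le_trans; apply.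
  apply: (@le_trans _ _ (8 * C)); first by rewrite ler_peMl // (ler_nat _ 1 8).
  by rewrite /K lerDr !mulr_ge0 // invr_ge0 ltW.
set n := n0.+1; have n0R : 0 < n%:R :> R by rewrite ltr0n.
have nC : (n%:R : R[i]) != 0 by rewrite pnatr_eq0.
(* A Taylor polynomial, rescaled to [[-1, 1]], stands in for [F], so that Chebyshev expansions
   remain finite sums. *)
pose S := taylor_poly F (32 * n); pose S1 := S \Po (n%:R *: 'X).
have S1E z : S1.[z] = S.[n%:R * z] by rewrite horner_comp hornerZ hornerX.
have szX (c : R[i]) : (size (c *: 'X : {poly R[i]}) <= 2)%N.
  by rewrite (leq_trans (size_scale_leq _ _)) // size_polyX.
have szc (p : {poly R[i]}) (c : R[i]) k : (size p <= k.+1)%N -> (size (p \Po (c *: 'X)) <= k.+1)%N.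
  move=> sp; rewrite (leq_trans (size_comp_poly_leq _ _)) // ltnS.
  have := szX c; case: (size (c *: 'X)) => [|[|[|//]]] _; rewrite ?muln0 // muln1.
  by move: sp; case: (size p).
have sS1 : (size S1 <= (32 * n).+1)%N by apply: szc; rewrite leqW // size_taylor_poly.
have [b S1b] := cheb_span_size sS1.
have ST z : cmod z <= 2 * n%:R -> cmod (F z - S.[z]) <= 8 * C * 2^-1 ^+ n.
  by move=> zn; exact: (growth_le_taylor gF T2 zn).
have H u : cmod u = r ->
    cmod (\sum_(j < (32 * n).+1) b j *: chebyshev j).[(u + u^-1) / 2] <= K2 * expR (sg * h) ^+ n.
  move=> ur; rewrite -S1b S1E; have [Iu Mu] := Im_joukowski (ltW r1) ur.
  set v := _ / _ in Iu Mu *; set z := _ * v.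
  have zn : cmod z <= 2 * n%:R.
    rewrite cmodM cmod_nat mulrC ler_wpM2r ?ler0n // (le_trans Mu) //; move: h1; rewrite /r; clear; lra.
  have Iz : `|complex.Im z| <= n%:R * h.
    have -> : complex.Im z = n%:R * complex.Im v.
      rewrite /z -(rmorph_nat (real_complex R)) cImM /=; ring.
    rewrite normrM (ger0_norm (ler0n _ _)) ler_wpM2l ?ler0n // (le_trans Iu) //.
    rewrite ler_pdivrMr // -(ler_pM2r r0) mulrBl mulVf ?gt_eqF // /r; nra.
  rewrite -[S.[z]](subKr (F z)) (le_trans (cmodB _ _)) //.
  have e1 : 1 <= expR (sg * h) ^+ n by rewrite exprn_ege1 // (le_trans _ (expR_ge1Dx _)) // lerDl mulr_ge0 // ltW.
  have b1 : cmod (F z) <= (M + 16 * C) * expR (sg * h) ^+ n.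
    rewrite (le_trans (PL z)) // ler_wpM2l ?addr_ge0 ?mulr_ge0 //.
    rewrite -expRM_natl ler_expR mulrCA ler_wpM2l // ltW //.
  have b2 : cmod (F z - S.[z]) <= 8 * C * expR (sg * h) ^+ n.
    rewrite (le_trans (ST z zn)) // ler_wpM2l ?mulr_ge0 // (le_trans _ e1) //.
    by rewrite exprn_ile1 // invf_le1 // ler1n.
  rewrite (le_trans (lerD b1 b2)) // -mulrDl ler_wpM2r ?exprn_ge0 ?expR_ge0 // /K2; lra.
have nm : (n <= 32 * n)%N by rewrite leq_pmull.
pose P := \sum_(j < n.+1) b j *: chebyshev j.
have sP : (size P <= n.+1)%N.
  rewrite (leq_trans (size_sum _ _ _)) //; apply/bigmax_leqP => j _; rewrite (leq_trans (size_scale_leq _ _)) //.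
  by rewrite (leq_trans (size_chebyshev _)).
pose q := P \Po (n%:R^-1 *: 'X).
have sq : (size q <= n.+1)%N by exact: szc.
have qF t : `|t| <= n%:R -> cmod (q.[t%:C] - F t%:C) <= K * th ^+ n.
  move=> tn; have x1 : -1 <= t / n%:R <= 1.
    by rewrite -ler_norml normrM normfV (ger0_norm (ler0n _ _)) ler_pdivrMr // mul1r.
  have qE : q.[t%:C] = P.[(t / n%:R)%:C].
    rewrite horner_comp hornerZ hornerX mulrC rmorphM fmorphV rmorph_nat //.
  have SE : S.[t%:C] = S1.[(t / n%:R)%:C].
    by rewrite S1E rmorphM fmorphV rmorph_nat mulrCA mulfV // mulr1.
  have tr := chebyshev_truncation r1 nm H x1.
  rewrite -S1b -/P -qE -SE in tr.
  have st : cmod (S.[t%:C] - F t%:C) <= 8 * C * 2^-1 ^+ n.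
    by rewrite cmod_distC ST // cmod_real (le_trans tn) // ler_peMl ?ler0n // (ler_nat _ 1 2).
  apply: (le_trans (cmod_dist_triangle S.[t%:C] _ _)); apply: (le_trans (lerD tr st)).
  rewrite [leRHS]mulrDl; apply: lerD.
    have -> : 4 * (K2 * expR (sg * h) ^+ n) / (1 - r^-1) * r^-1 ^+ n
            = 4 * K2 / (1 - r^-1) * th1 ^+ n by rewrite /th1 exprMn; ring.
    apply: ler_wpM2l; first by rewrite !mulr_ge0 // invr_ge0 ltW.
    by rewrite lerXn2r ?nnegrE // ?le_max ?lexx // th10.
  by rewrite ler_wpM2l ?mulr_ge0 // lerXn2r ?nnegrE // ?le_max ?th10 ?lexx ?orbT.
exists (even_part q n); split=> [|z|t tn].
- exact: size_even_part.
- exact: even_part_even.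
rewrite (horner_even_part _ sq).
have -> : (q.[t%:C] + q.[- t%:C]) / 2 - F t%:C
        = ((q.[t%:C] - F t%:C) + (q.[(- t)%:C] - F (- t)%:C)) / 2.
  by rewrite rmorphN /= Fe; field.
rewrite cmodM cmodV (cmod_nat 2) ler_pdivrMr // (le_trans (cmodD _ _)) //.
by rewrite mulr_natr mulr2n lerD ?qF ?normrN.
Qed.

Lemma even_approximants F C T M sg : growth_le F C T -> T <= 2 -> 0 <= T -> T < sg -> sg < 1 ->
  (forall z, F (- z) = F z) -> (forall t, cmod (F t%:C) <= M) ->
  exists Q : nat -> {poly R[i]}, exists K th, [/\ 0 <= K, 0 < th < 1,
   forall n, (size (Q n) <= (n./2).*2.+1)%N /\ (forall z, (Q n).[- z] = (Q n).[z]),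
   forall n t, `|t| <= n%:R -> cmod ((Q n).[t%:C] - F t%:C) <= K * th ^+ n &
   forall k e, 0 < e -> exists J, forall n, (J <= n)%N -> cmod ((Q n)`_k - taylor_coeff F k) <= e].
Proof.
move=> gF T2 T0 Tsg sg1 Fe FM; have C0 := growth_ge0 gF.
have M0 : 0 <= M by exact: le_trans (cmod_ge0 _) (FM 0).
have sg0 : 0 < sg by exact: le_lt_trans Tsg.
pose h := (1 - sg) / 2; have h0 : 0 < h by rewrite divr_gt0 // subr_gt0.
have h1 : h <= 1 / 2 by rewrite /h; lra.
have r0 : 0 < 1 + h by rewrite addr_gt0.
(* As [sg = 1 - 2 * h], one has [(1 + h) * (1 - sg * h) = 1 + h ^+ 2 + 2 * h ^+ 3 > 1]. *)
have th11 : expR (sg * h) / (1 + h) < 1.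
  rewrite ltr_pdivrMr // mul1r.
  have sh : 0 < 1 - sg * h by have : sg * h <= h by [rewrite ler_piMl // ltW]; move: h1; lra.
  apply: (@le_lt_trans _ _ (1 - sg * h)^-1).
    rewrite -[leLHS]invrK -expRN lef_pV2 ?posrE ?expR_gt0 //.
    by rewrite (le_trans _ (expR_ge1Dx _)).
  rewrite -(ltr_pM2r sh) mulVf ?gt_eqF //.
  have sgE : sg = 1 - 2 * h by rewrite /h; field.
  by rewrite sgE; nra.
have := fun n => even_truncation n gF T2 T0 Tsg sg1 Fe FM.
move=> /choice[Q]; rewrite -/h.
set K := _ + 8 * C; set th := Num.max _ _ => HQ; exists Q, K, th.
have K0 : 0 <= K.
  by rewrite addr_ge0 ?mulr_ge0 ?addr_ge0 ?mulr_ge0 // invr_ge0 subr_ge0 invf_le1 // lerDl ltW.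
have th1 : 0 < th < 1.
  by rewrite lt_max gt_max th11 [X in _ || X]invr_gt0 ltr0n orbT /= invf_lt1 // ltr1n.
have [t0 t1] := andP th1.
split=> // [n|n t|k e e0]; [by case: (HQ n)|by have [_ _ H] := HQ n; exact: H|].
(* The difference from the Taylor polynomial is at most [2 * (K * th ^+ n)] on [[-n, n]] and has
   degree at most [32 * n]; at radius [1] the coefficient bound costs [2 * expR 32]. *)
have k0 : 0 < e / (4 * expR 32) by rewrite divr_gt0 // mulr_gt0 // expR_gt0.
have [J HJ] := geometric_powR_small 0 K0 th1 k0.
exists (maxn J k.+1) => n; rewrite geq_max => /andP[/HJ {}HJ kn].
have n0 : (0 < n)%N by exact: leq_trans kn.
have nR : 0 < n%:R :> R by rewrite ltr0n.
have [sQ _ QF] := HQ n.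
pose S := taylor_poly F (32 * n).
have -> : (Q n)`_k - taylor_coeff F k = (Q n - S)`_k.
  by rewrite coefB coef_poly (leq_trans kn) // leq_pmull.
have sz : (size (Q n - S)%R <= (32 * n).+1)%N.
  rewrite (leq_trans (size_polyD _ _)) // geq_max size_polyN; apply/andP; split.
    rewrite (leq_trans sQ) // ltnS (@leq_trans n) ?leq_pmull //.
    by rewrite -[leqRHS]odd_double_half leq_addl.
  by rewrite leqW // size_taylor_poly.
have B s : `|s| <= n%:R -> cmod (Q n - S).[s%:C] <= 2 * (K * th ^+ n).
  move=> sn; rewrite hornerD hornerN (le_trans (cmod_dist_triangle (F s%:C) _ _)) //.
  have zn : cmod (s%:C : R[i]) <= 2 * n%:R.
    by rewrite cmod_real (le_trans sn) // ler_peMl ?ler0n // (ler_nat _ 1 2).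
  rewrite [X in X * _]mulr2n [leRHS]mulrDl mul1r; apply: lerD; first exact: QF.
  apply: (le_trans (growth_le_taylor gF T2 zn)).
  apply: ler_pM; rewrite ?mulr_ge0 ?exprn_ge0 ?invr_ge0 //.
    by rewrite /K lerDr mulr_ge0 ?mulr_ge0 ?addr_ge0 ?mulr_ge0 // invr_ge0 subr_ge0 invf_le1 // lerDl ltW.
  by rewrite lerXn2r // ?nnegrE ?invr_ge0 ?(ltW t0) // le_max lexx orbT.
have := poly_coef_le_interval k sz nR ltr01 B.
rewrite expr1n mulr1 natrM div1r mulfK ?gt_eqF // => /le_trans; apply.
move: HJ; rewrite powRr0 mulr1 ler_pdivlMr ?mulr_gt0 ?expR_gt0 // => /(le_trans _); apply.
by rewrite le_eqVlt; apply/orP; left; apply/eqP; ring.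
Qed.

End ChebyshevTruncation.

(** * Power series *)

Section GeometricSums.
Context {R : realType}.
Implicit Types (u v : nat -> R[i]) (z w S T : R[i]) (c : nat -> R) (M B : R).

(** The series of entire functions converge at this fixed rate. Linearity, uniqueness and bounds of
    sums then reduce to estimates of finite sums, without limits in [R[i]]. *)
Definition geom_cvg u S := exists M, forall n, cmod (S - \sum_(k < n) u k) <= M * 2^-1 ^+ n.

Lemma half_power_small M e : 0 <= M -> 0 < e -> exists J, forall n, (J <= n)%N -> M * 2^-1 ^+ n <= e.
Proof.
move=> M0 e0; have h : 0 < (2^-1 : R) < 1 by rewrite invr_gt0 ltr0n /= invf_lt1 ?ltr1n.
have [J HJ] := geometric_powR_small 0 M0 h e0; exists J => n /HJ.
by rewrite powRr0 mulr1.
Qed.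

Lemma geom_cvg_le u S B : geom_cvg u S -> (forall n, cmod (\sum_(k < n) u k) <= B) -> cmod S <= B.
Proof.
move=> [M HM] HB; apply/ler_addgt0Pr => e e0.
have M0 : 0 <= M by have := HM 0%N; rewrite expr0 mulr1; apply: le_trans; exact: cmod_ge0.
have [n Hn] := half_power_small M0 e0; rewrite -[S](subrK (\sum_(k < n) u k)).
by rewrite (le_trans (cmodD _ _)) // addrC lerD // (le_trans (HM _)) // Hn.
Qed.

Lemma geom_cvgZ u S w : geom_cvg u S -> geom_cvg (fun k => w * u k) (w * S).
Proof.
move=> [M HM]; exists (cmod w * M) => n; rewrite -mulr_sumr -mulrBr cmodM -mulrA.
by rewrite ler_wpM2l ?cmod_ge0.
Qed.

Lemma geom_cvgD u v S T : geom_cvg u S -> geom_cvg v T -> geom_cvg (fun k => u k + v k) (S + T).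
Proof.
move=> [M HM] [B HB]; exists (M + B) => n; rewrite big_split /= opprD addrACA mulrDl.
exact: le_trans (cmodD _ _) (lerD (HM n) (HB n)).
Qed.

Lemma geom_cvg_unique u S T : geom_cvg u S -> geom_cvg u T -> S = T.
Proof.
move=> uS /(geom_cvgZ (-1)) uT; apply/eqP; rewrite -subr_eq0 -cmod_eq0 eq_le cmod_ge0 andbT.
rewrite -[- T]mulN1r; apply: (geom_cvg_le (geom_cvgD uS uT)) => n.
by rewrite big1 ?cmod0 // => k _; rewrite mulN1r subrr.
Qed.

Lemma geom_cvg_cons u S : geom_cvg (fun k => u k.+1) S -> geom_cvg u (u 0%N + S).
Proof.
move=> [M HM]; have M0 : 0 <= M.
  by have := HM 0%N; rewrite expr0 mulr1; apply: le_trans; exact: cmod_ge0.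
exists (cmod (u 0%N) + 2 * M) => -[|n].
  rewrite big_ord0 subr0 expr0 mulr1 (le_trans (cmodD _ _)) // lerD2l.
  have := HM 0%N; rewrite big_ord0 subr0 expr0 mulr1 => /le_trans; apply.
  by rewrite ler_peMl // (ler_nat _ 1 2).
rewrite big_ord_recl /= opprD addrACA subrr add0r (le_trans (HM n)) // exprS mulrA.
by rewrite ler_wpM2r ?exprn_ge0 ?invr_ge0 // mulrDl mulrAC mulfV // mul1r lerDr divr_ge0 ?cmod_ge0.
Qed.

Lemma real_geom_cvg c M : (forall k, `|c k| <= M * 2^-1 ^+ k) ->
  exists S : R, forall n, `|S - \sum_(k < n) c k| <= 2 * M * 2^-1 ^+ n.
Proof.
move=> cM; have h1 : `|2^-1 : R| < 1 by rewrite ger0_norm ?invr_ge0 // invf_lt1 ?ltr1n.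
have h0 : 0 <= (2^-1 : R) by rewrite invr_ge0.
have M0 : 0 <= M by have := cM 0%N; rewrite expr0 mulr1; apply: le_trans.
have cc : cvgn (series c).
  apply: normed_cvg; apply: (@series_le_cvg _ _ (geometric M 2^-1)) => //.
  - by move=> k; rewrite /= normr_ge0.
  - by move=> k; rewrite /geometric /= mulr_ge0 // exprn_ge0.
  - exact: is_cvg_geometric_series.
exists (limn (series c)) => n; apply/ler_addgt0Pr => e e0.
move/cvgrPdist_le : cc => /(_ _ e0)[m _ Hm].
have {Hm} := Hm (maxn m n) (leq_maxl _ _); rewrite /series /= big_mkord.
set L := limn _; move=> HL; rewrite -(subrKA (\sum_(k < maxn m n) c k)).
rewrite (le_trans (ler_normD _ _)) // [leRHS]addrC lerD //.
rewrite -!(big_mkord xpredT c) (big_cat_nat (n := n)) ?leq_maxr //= addrAC subrr add0r.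
rewrite (le_trans (ler_norm_sum _ _ _)) //.
apply: (@le_trans _ _ (M * \sum_(n <= k < maxn m n) 2^-1 ^+ k)).
  by rewrite mulr_sumr; apply: ler_sum.
rewrite -[leRHS]mulrA [leRHS]mulrCA ler_wpM2l // (le_trans (sum_geometric_le _ _ _ _)) //.
  by rewrite invf_lt1 ?ltr1n.
by rewrite mulrC le_eqVlt; apply/orP; left; apply/eqP; field.
Qed.

Lemma geom_cvg_exists u M : (forall k, cmod (u k) <= M * 2^-1 ^+ k) -> exists S, geom_cvg u S.
Proof.
move=> uM; have [A HA] := @real_geom_cvg (fun k => complex.Re (u k)) M (fun k => le_trans (cmod_Re _) (uM k)).
have [B HB] := @real_geom_cvg (fun k => complex.Im (u k)) M (fun k => le_trans (cmod_Im _) (uM k)).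
exists (A +i* B), (2 * M + 2 * M) => n; rewrite (le_trans (cmod_le_ReIm _)) // mulrDl.
by rewrite cReB cImB cRe_sum cIm_sum; exact: lerD (HA n) (HB n).
Qed.

End GeometricSums.

(** * Entire functions as coefficient sequences *)

Section PowerSeries.
Context {R : realType}.
Implicit Types (a b : nat -> R[i]) (z w h : R[i]) (r M : R).

(* The coefficient sequences of entire functions. *)
Definition ecoef a := forall r, 0 < r -> exists M, forall k, cmod (a k) * r ^+ k <= M.

(* The value is [0] when the terms do not sum at a geometric rate; this does not happen for [ecoef a]. *)
Definition ps a z : R[i] := xget 0 [set S | geom_cvg (fun k => a k * z ^+ k) S].

Lemma ps_eq a z S : geom_cvg (fun k => a k * z ^+ k) S -> ps a z = S.
Proof. by move=> aS; apply: (geom_cvg_unique _ aS); rewrite /ps; case: xgetP => // /(_ _ aS). Qed.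

Lemma psP a z : ecoef a -> geom_cvg (fun k => a k * z ^+ k) (ps a z).
Proof.
move=> ea; suff [S aS] : exists S, geom_cvg (fun k => a k * z ^+ k) S by rewrite (ps_eq aS).
have r0 : 0 < 2 * (cmod z + 1) by rewrite mulr_gt0 // ltr_wpDl ?cmod_ge0.
have [M HM] := ea _ r0; apply: (@geom_cvg_exists _ _ M) => k.
rewrite exprVn ler_pdivlMr ?exprn_gt0 // (le_trans _ (HM k)) // cmodM cmodX -mulrA -exprMn.
rewrite ler_wpM2l ?cmod_ge0 // lerXn2r ?nnegrE ?mulr_ge0 ?addr_ge0 ?cmod_ge0 //.
by rewrite mulrC ler_pM2l // lerDl.
Qed.

Lemma ps_ext a b z : (forall k, a k = b k) -> ps a z = ps b z.
Proof. by move=> /funext ->. Qed.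

Lemma psD a b z : ecoef a -> ecoef b -> ps (fun k => a k + b k) z = ps a z + ps b z.
Proof.
move=> ea eb; apply: ps_eq; under eq_fun do rewrite mulrDl.
by apply: geom_cvgD; exact: psP.
Qed.

Lemma psZ a w z : ecoef a -> ps (fun k => w * a k) z = w * ps a z.
Proof. by move=> ea; apply: ps_eq; under eq_fun do rewrite -mulrA; apply: geom_cvgZ; exact: psP. Qed.

Lemma ps0 a : ecoef a -> ps a 0 = a 0%N.
Proof.
move=> ea; apply: ps_eq; exists (cmod (a 0%N)) => -[|n].
  by rewrite big_ord0 subr0 expr0 mulr1.
rewrite big_ord_recl expr0 mulr1 big1 => [|k _]; last by rewrite expr0n /= mulr0.
by rewrite addr0 subrr cmod0 mulr_ge0 ?cmod_ge0 ?exprn_ge0 ?invr_ge0.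
Qed.

Lemma ps_shift a z : ecoef (fun k => a k.+1) -> ps a z = a 0%N + z * ps (fun k => a k.+1) z.
Proof.
move=> ea; apply: ps_eq; rewrite -[a 0%N]mulr1 -[X in _ * X](expr0 z).
apply: (@geom_cvg_cons _ (fun k => a k * z ^+ k)).
by under eq_fun do rewrite exprS mulrCA; apply: geom_cvgZ; exact: psP.
Qed.

Lemma ps_dilation a w z : ps (fun k => w ^+ k * a k) z = ps a (w * z).
Proof.
rewrite /ps (_ : (fun k => _ * _ * z ^+ k) = (fun k => a k * (w * z) ^+ k)) //.
by apply/funext => k; rewrite exprMn mulrA (mulrC (a k)).
Qed.

Lemma ps_le a z r M : ecoef a -> 0 < r -> (forall k, cmod (a k) * r ^+ k <= M) -> cmod z <= r / 2 ->
  cmod (ps a z) <= 2 * M.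
Proof.
move=> ea r0 aM zr; apply: (geom_cvg_le (psP z ea)) => n.
have M0 : 0 <= M by rewrite (le_trans _ (aM 0%N)) // mulr_ge0 ?cmod_ge0 ?exprn_ge0 // ltW.
rewrite (le_trans (cmod_sum _ _ _)) //.
apply: (@le_trans _ _ (\sum_(0 <= k < n) M * 2^-1 ^+ k)).
  rewrite big_mkord; apply: ler_sum => k _; rewrite cmodM cmodX.
  apply: (@le_trans _ _ (cmod (a k) * (r / 2) ^+ k)).
    by rewrite ler_wpM2l ?cmod_ge0 // lerXn2r ?nnegrE ?cmod_ge0 // divr_ge0 // ltW.
  by rewrite exprMn mulrA ler_wpM2r // exprn_ge0 // invr_ge0.
rewrite -mulr_sumr mulrC ler_wpM2r // (le_trans (sum_geometric_le _ _ _ _)) ?invr_ge0 //.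
  by rewrite invf_lt1 ?ltr1n.
by rewrite expr0 le_eqVlt; apply/orP; left; apply/eqP; field.
Qed.

Lemma ecoefD a b : ecoef a -> ecoef b -> ecoef (fun k => a k + b k).
Proof.
move=> ea eb r r0; have [M HM] := ea r r0; have [M' HM'] := eb r r0; exists (M + M') => k.
rewrite (le_trans _ (lerD (HM k) (HM' k))) // -mulrDl ler_wpM2r ?exprn_ge0 ?(ltW r0) //.
exact: cmodD.
Qed.

Lemma ecoefZ a w : ecoef a -> ecoef (fun k => w * a k).
Proof.
move=> ea r r0; have [M HM] := ea r r0; exists (cmod w * M) => k.
by rewrite cmodM -mulrA ler_wpM2l ?cmod_ge0.
Qed.

Lemma ecoef_shift a : ecoef a -> ecoef (fun k => a k.+1).
Proof.
move=> ea r r0; have [M HM] := ea r r0; exists (M / r) => k.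
by rewrite ler_pdivlMr // -mulrA -exprSr.
Qed.

Lemma ecoef_unshift a : ecoef (fun k => a k.+1) -> ecoef a.
Proof.
move=> ea r r0; have [M HM] := ea r r0; exists (cmod (a 0%N) + M * r).
have M0 : 0 <= M by rewrite (le_trans _ (HM 0%N)) // mulr_ge0 ?cmod_ge0 ?exprn_ge0 // ltW.
case=> [|k]; first by rewrite expr0 mulr1 lerDl mulr_ge0 // ltW.
by rewrite exprSr mulrA (le_trans (ler_wpM2r (ltW r0) (HM k))) // lerDr cmod_ge0.
Qed.

Lemma natr_le_exp2 k : k%:R <= 2 ^+ k :> R.
Proof. by rewrite -natrX ler_nat ltnW // ltn_expl. Qed.

Lemma ecoef_natmul a : ecoef a -> ecoef (fun k => k%:R * a k).
Proof.
move=> ea r r0; have r20 : 0 < 2 * r by rewrite mulr_gt0.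
have [M HM] := ea _ r20; exists M => k; rewrite (le_trans _ (HM k)) // cmodM cmod_nat exprMn.
rewrite [leRHS]mulrCA -[leLHS]mulrA; apply: ler_wpM2r; last exact: natr_le_exp2.
by rewrite mulr_ge0 ?cmod_ge0 ?exprn_ge0 // ltW.
Qed.

Definition ediff a k := k.+1%:R * a k.+1.

Lemma ecoef_ediff a : ecoef a -> ecoef (ediff a).
Proof. by move=> ea; apply: (@ecoef_shift (fun k => k%:R * a k)); exact: ecoef_natmul. Qed.

Lemma exp_increment_le z h r k : 1 <= r -> cmod z <= r -> cmod (z + h) <= r ->
  cmod ((z + h) ^+ k - z ^+ k) <= k%:R * cmod h * r ^+ k.
Proof.
move=> r1 zr zhr; have r0 : 0 <= r by exact: le_trans r1.
elim: k => [|k IH]; first by rewrite !expr0 subrr cmod0 !mul0r.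
have -> : (z + h) ^+ k.+1 - z ^+ k.+1 = (z + h) * ((z + h) ^+ k - z ^+ k) + h * z ^+ k.
  by rewrite !exprS; ring.
have b1 := ler_pM (cmod_ge0 _) (cmod_ge0 _) zhr IH.
have b2 : cmod h * cmod z ^+ k <= cmod h * r ^+ k.+1.
  rewrite ler_wpM2l ?cmod_ge0 // (@le_trans _ _ (r ^+ k)) //; last by rewrite exprS ler_peMl ?exprn_ge0.
  by rewrite lerXn2r ?nnegrE ?cmod_ge0.
rewrite (le_trans (cmodD _ _)) // !cmodM cmodX (le_trans (lerD b1 b2)) //.
by rewrite le_eqVlt; apply/orP; left; apply/eqP; rewrite exprS -natr1; ring.
Qed.

Lemma exp_taylor2_le z h r k : 1 <= r -> cmod z <= r -> cmod (z + h) <= r ->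
  cmod ((z + h) ^+ k - z ^+ k - k%:R * z ^+ k.-1 * h) <= k%:R ^+ 2 * cmod h ^+ 2 * r ^+ k.
Proof.
move=> r1 zr zhr; have r0 : 0 <= r by exact: le_trans r1.
elim: k => [|k IH]; first by rewrite !expr0 subrr !mul0r subrr cmod0 expr0n !mul0r.
have -> : (z + h) ^+ k.+1 - z ^+ k.+1 - k.+1%:R * z ^+ k.+1.-1 * h =
   z * ((z + h) ^+ k - z ^+ k - k%:R * z ^+ k.-1 * h) + h * ((z + h) ^+ k - z ^+ k).
  by case: k {IH} => [|k] /=; rewrite ?expr0 -?natr1 !exprS; ring.
have b1 := ler_pM (cmod_ge0 _) (cmod_ge0 _) zr IH.
have b2 := ler_wpM2l (cmod_ge0 h) (exp_increment_le k r1 zr zhr).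
have b3 : k%:R * cmod h ^+ 2 * r ^+ k <= k%:R * cmod h ^+ 2 * r ^+ k.+1.
  by rewrite ler_wpM2l ?mulr_ge0 ?exprn_ge0 ?cmod_ge0 // exprS ler_peMl ?exprn_ge0.
have b4 : 0 <= k.+1%:R * cmod h ^+ 2 * r ^+ k.+1 by rewrite !mulr_ge0 ?exprn_ge0 ?cmod_ge0.
rewrite (le_trans (cmodD _ _)) // !cmodM (le_trans (lerD b1 b2)) //.
move: b3 b4; rewrite !exprS -!natr1 expr0; move: (cmod h) (k%:R) (r ^+ k) => H K P; clear.
by move=> b3 b4; nra.
Qed.

Lemma ps_cderivative a z : ecoef a -> cderivative (ps a) z (ps (ediff a) z).
Proof.
move=> ea; set r := cmod z + 1; have r1 : 1 <= r by rewrite lerDr cmod_ge0.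
have r0 : 0 < r by exact: lt_le_trans r1.
(* In [8 = 4 * 2], the power [4 ^+ k] absorbs the factor [k ^ 2] of the second-order remainder and
   [2 ^+ k] gives the geometric rate. *)
have r80 : 0 < 8 * r by rewrite mulr_gt0.
have [M HM] := ea _ r80.
have M0 : 0 <= M by rewrite (le_trans _ (HM 0%N)) // mulr_ge0 ?cmod_ge0 ?exprn_ge0 // ltW.
move=> e e0; exists (Num.min 1 (e / (2 * M + 1))).
  by rewrite lt_min ltr01 divr_gt0 // ltr_wpDl // mulr_ge0.
move=> h; rewrite lt_min => /andP[/ltW h1 he].
have zr : cmod z <= r by rewrite lerDl.
have zhr : cmod (z + h) <= r by rewrite (le_trans (cmodD _ _)) // lerD2l.
suff H : cmod (ps a (z + h) - ps a z - ps (ediff a) z * h) <= 2 * M * cmod h ^+ 2.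
  rewrite (le_trans H) // exprS expr1 mulrA ler_wpM2r ?cmod_ge0 //.
  move: he; rewrite ltr_pdivlMr ?ltr_wpDl ?mulr_ge0 // => /ltW; apply: le_trans.
  by rewrite mulrC ler_wpM2l ?cmod_ge0 // lerDl.
have D : geom_cvg (fun k => k%:R * a k * z ^+ k.-1 * h) (ps (ediff a) z * h).
  rewrite -[X in geom_cvg _ X]add0r.
  have -> : 0 = 0%:R * a 0%N * z ^+ 0.-1 * h by rewrite !mul0r.
  apply: (@geom_cvg_cons _ (fun k => k%:R * a k * z ^+ k.-1 * h)).
  under eq_fun do rewrite mulrC; rewrite mulrC; apply: geom_cvgZ.
  by apply: psP; exact: ecoef_ediff.
have E := geom_cvgD (geom_cvgD (psP (z + h) ea) (geom_cvgZ (-1) (psP z ea))) (geom_cvgZ (-1) D).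
rewrite -[- ps a z]mulN1r -[- (_ * h)]mulN1r; apply: (geom_cvg_le E) => n.
rewrite (le_trans (cmod_sum _ _ _)) //.
apply: (@le_trans _ _ (\sum_(0 <= k < n) M * cmod h ^+ 2 * 2^-1 ^+ k)).
  rewrite big_mkord; apply: ler_sum => k _.
  have -> : a k * (z + h) ^+ k + -1 * (a k * z ^+ k) + -1 * (k%:R * a k * z ^+ k.-1 * h)
    = a k * ((z + h) ^+ k - z ^+ k - k%:R * z ^+ k.-1 * h) by ring.
  rewrite cmodM (le_trans (ler_wpM2l (cmod_ge0 _) (exp_taylor2_le k r1 zr zhr))) //.
  rewrite exprVn ler_pdivlMr ?exprn_gt0 //.
  have k4 : k%:R ^+ 2 <= 4 ^+ k :> R.
    have -> : (4 : R) = 2 ^+ 2 by ring.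
    by rewrite -exprM mulnC exprM lerXn2r ?nnegrE ?exprn_ge0 // natr_le_exp2.
  have := HM k; have -> : (8 : R) = 4 * 2 by ring.
  rewrite !exprMn => H; have h2 : 0 <= cmod h ^+ 2 by rewrite exprn_ge0 ?cmod_ge0.
  apply: (@le_trans _ _ (cmod (a k) * (4 ^+ k * 2 ^+ k * r ^+ k) * cmod h ^+ 2)); last by rewrite ler_wpM2r.
  have -> : cmod (a k) * (k%:R ^+ 2 * cmod h ^+ 2 * r ^+ k) * 2 ^+ k =
     k%:R ^+ 2 * (cmod (a k) * (2 ^+ k * r ^+ k) * cmod h ^+ 2) by ring.
  have -> : cmod (a k) * (4 ^+ k * 2 ^+ k * r ^+ k) * cmod h ^+ 2 =
     4 ^+ k * (cmod (a k) * (2 ^+ k * r ^+ k) * cmod h ^+ 2) by ring.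
  by rewrite ler_wpM2r // !mulr_ge0 ?cmod_ge0 ?exprn_ge0 // ltW.
rewrite -mulr_sumr -mulrA mulrC mulrA.
have := sum_geometric_le 0 n (_ : 0 <= 2^-1 :> R) (_ : 2^-1 < 1 :> R).
rewrite invr_ge0 ler0n invf_lt1 ?ltr1n // expr0 => /(_ isT isT) S2.
have S2' : \sum_(0 <= k < n) 2^-1 ^+ k <= 2 :> R.
  by rewrite (le_trans S2) // le_eqVlt; apply/orP; left; apply/eqP; field.
have h2 : 0 <= M * cmod h ^+ 2 by rewrite mulr_ge0 // exprn_ge0 ?cmod_ge0.
have := ler_wpM2r h2 S2'; rewrite mulrC mulrAC; congr (_ <= _); ring.
Qed.

End PowerSeries.

(** * The Bessel operator on power series *)

Section PowerSeriesIdentities.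
Context {R : realType}.
Implicit Types (F : R[i] -> R[i]) (a b c : nat -> R[i]) (z w h D : R[i]) (r M C T S : R).

Lemma cdiff_ps a z : ecoef a -> cdiff (ps a) z.
Proof. by move=> ea; exists (ps (ediff a) z); exact: ps_cderivative. Qed.

(** Divide by [t] away from [0] and use continuity at [0]: the shifted series vanishes as well, and
    the index drops. *)
Lemma ps_eq0 c k : ecoef c -> (forall t : R, ps c t%:C = 0) -> c k = 0.
Proof.
elim: k c => [|k IH] c ec c0; first by rewrite -(ps0 ec) (c0 0).
have es := ecoef_shift ec; apply: (IH (fun k => c k.+1) es).
have H (t : R) : t != 0 -> ps (fun k => c k.+1) t%:C = 0.
  move=> t0; have := c0 t; rewrite (ps_shift _ es) -(ps0 ec) (c0 0) add0r => /eqP.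
  by rewrite mulf_eq0 fmorph_eq0 (negbTE t0) /= => /eqP.
move=> t; have [->|] := eqVneq t 0; last exact: H.
apply/eqP; rewrite -cmod_eq0 eq_le cmod_ge0 andbT; apply/ler_addgt0Pr => e e0.
have [d d0 Hd] := cdiff_ccont (cdiff_ps 0 es) e0; rewrite add0r.
have d2 : 0 < d / 2 by rewrite divr_gt0.
have := Hd (d / 2)%:C; rewrite add0r (H _ (lt0r_neq0 d2)) sub0r cmodN; apply.
by rewrite cmod_real ger0_norm ?(ltW d2) // ltr_pdivrMr // ltr_pMr // (ltr_nat _ 1 2).
Qed.

Lemma ps_even_coef a k : ecoef a -> (forall z, ps a (- z) = ps a z) -> odd k -> a k = 0.
Proof.
move=> ea ae ok; pose c j := (-1) ^+ j * a j + -1 * a j.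
have e1 : ecoef (fun j => (-1) ^+ j * a j).
  move=> r /ea[M HM]; exists M => j.
  by rewrite cmodM cmodX cmodN cmod1 expr1n mul1r.
have ec : ecoef c by apply: ecoefD => //; exact: ecoefZ.
have := @ps_eq0 c k ec; rewrite /c -signr_odd ok expr1 => H.
have /eqP : -1 * a k + -1 * a k = 0.
  apply: H => t; rewrite psD ?psZ //; last exact: ecoefZ.
  by rewrite ps_dilation !mulN1r ae subrr.
by rewrite -mulr2n mulrn_eq0 /= mulN1r oppr_eq0 => /eqP.
Qed.

Lemma ecoef_poly (q : {poly R[i]}) : ecoef (fun k => q`_k).
Proof.
move=> r r0; exists (\sum_(j < size q) cmod q`_j * r ^+ j) => k.
have P j : 0 <= cmod q`_j * r ^+ j by rewrite mulr_ge0 ?cmod_ge0 ?exprn_ge0 // ltW.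
have [kq|kq] := ltnP k (size q).
  by rewrite (bigD1 (Ordinal kq)) //= lerDl sumr_ge0.
by rewrite nth_default // cmod0 mul0r sumr_ge0.
Qed.

Lemma ps_poly (q : {poly R[i]}) z : ps (fun k => q`_k) z = q.[z].
Proof.
apply: ps_eq; exists ((cmod q.[z] + \sum_(j < size q) cmod (q`_j * z ^+ j)) * 2 ^+ size q) => n.
have [nq|nq] := leqP (size q) n.
  rewrite -horner_coef_wide // subrr cmod0 !mulr_ge0 ?exprn_ge0 ?invr_ge0 //.
  by rewrite addr_ge0 ?cmod_ge0 // sumr_ge0 // => *; exact: cmod_ge0.
have h : 1 <= 2 ^+ size q * 2^-1 ^+ n :> R.
  rewrite exprVn ler_pdivlMr ?exprn_gt0 // mul1r ler_eXn2l ?(ltr_nat _ 1 2) //.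
  exact: ltnW.
rewrite -mulrA (le_trans _ (ler_peMr _ h)) //; last first.
  by rewrite addr_ge0 ?cmod_ge0 // sumr_ge0 // => *; exact: cmod_ge0.
rewrite (le_trans (cmodB _ _)) // lerD2l (le_trans (cmod_sum _ _ _)) //.
rewrite -!(big_mkord xpredT (fun j => cmod (q`_j * z ^+ j))).
by rewrite [leRHS](big_cat_nat (n := n)) ?(ltnW nq) //= lerDl sumr_ge0 // => *; exact: cmod_ge0.
Qed.

Lemma ecoef_taylor F C T : 0 <= T -> growth_le F C T -> ecoef (taylor_coeff F).
Proof.
move=> T0 [dF FC] r r0; exists (2 * (C * expR (T * r))) => k.
by apply: taylor_coeff_le => // z zr; rewrite -zr.
Qed.

Lemma ps_taylor F C T z : 0 <= T -> growth_le F C T -> ps (taylor_coeff F) z = F z.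
Proof.
move=> T0 gF; have C0 := growth_ge0 gF; have [dF FC] := gF.
pose r := 2 * cmod z + 1; have r0 : 0 < r by rewrite ltr_wpDl // mulr_ge0 ?cmod_ge0.
apply: ps_eq; exists (8 * (C * expR (T * r))) => n.
have zr : cmod z <= r / 2 by rewrite ler_pdivlMr // mulrC lerDl.
have FM w : cmod w <= r -> cmod (F w) <= C * expR (T * r).
  by move=> wr; rewrite (le_trans (FC _)) // ler_wpM2l // ler_expR ler_wpM2l.
rewrite (le_trans (taylor_remainder dF n r0 FM zr)) // ler_wpM2l ?mulr_ge0 ?expR_ge0 //.
rewrite lerXn2r ?nnegrE ?divr_ge0 ?cmod_ge0 ?invr_ge0 ?(ltW r0) //.
by rewrite ler_pdivrMr // mulrC.
Qed.

Lemma cderivative_le F z0 D M : (forall z, cdiff F z) -> cderivative F z0 D ->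
  (forall z, cmod (z - z0) <= 1 -> cmod (F z) <= M) -> cmod D <= 2 * M.
Proof.
move=> dF FD FM; pose G w := F (z0 + w).
have dG w : cdiff G w.
  by apply: (cdiff_comp (g := F)) => //; apply: cdiffD; [exact: cdiff_cst|exact: cdiff_id].
have GM w : cmod w <= 1 -> cmod (G w) <= M by move=> w1; apply: FM; rewrite addrC addKr.
have M0 : 0 <= M by apply: le_trans (GM 0 _); rewrite ?cmod_ge0 ?cmod0.
set a1 := taylor_coeff G 1.
have a1M : cmod a1 <= 2 * M.
  have := @taylor_coeff_le _ _ dG 1 1 M ltr01; rewrite expr1 mulr1; apply=> w w1.
  by apply: GM; rewrite w1.
suff -> : D = a1 by [].
apply/eqP; rewrite -subr_eq0 -cmod_eq0 eq_le cmod_ge0 andbT; apply/ler_addgt0Pr => e e0; rewrite add0r.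
have e2 : 0 < e / 2 by rewrite divr_gt0.
have [d d0 Hd] := FD _ e2.
have M8 : 0 < 8 * M + 1 by rewrite ltr_wpDl // mulr_ge0.
pose t := Num.min (d / 2) (Num.min (1 / 2) (e / 2 / (8 * M + 1))).
have t0 : 0 < t by rewrite !lt_min !divr_gt0.
have td : t < d.
  rewrite (@le_lt_trans _ _ (d / 2)) ?ge_min ?lexx // ltr_pdivrMr // ltr_pMr // (ltr_nat _ 1 2) //.
have t1 : t <= 1 / 2 by rewrite !ge_min lexx orbT.
have te : 8 * M * t <= e / 2.
  have : t <= e / 2 / (8 * M + 1) by rewrite !ge_min lexx !orbT.
  rewrite ler_pdivlMr // => /(le_trans _); apply.
  by rewrite mulrC ler_wpM2l ?(ltW t0) // lerDl.
have ct : cmod (t%:C : R[i]) = t by rewrite cmod_real ger0_norm // ltW.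
have b1 := Hd t%:C; rewrite ct in b1; have {}b1 := b1 td.
have b2 := @taylor_remainder _ _ dG t%:C 2 1 M ltr01 GM; rewrite ct divr1 in b2.
have {}b2 := b2 t1.
rewrite !big_ord_recl big_ord0 addr0 expr0 mulr1 expr1 (taylor_coeff0 dG) -/a1 in b2.
rewrite -(ler_pM2r t0) -{1}ct -cmodM.
have -> : (D - a1) * t%:C = (G t%:C - (G 0 + a1 * t%:C)) - (F (z0 + t%:C) - F z0 - D * t%:C).
  by rewrite /G addr0; ring.
rewrite (le_trans (cmodB _ _)) // (le_trans (lerD b2 b1)) // expr2 !mulrA -mulrDl ler_pM2r //.
by rewrite (le_trans (lerD te (lexx _))) // -splitr.
Qed.

End PowerSeriesIdentities.

Section Bessel.
Context {R : realType}.
Variable nu : R.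
Hypothesis hnu : - (1 / 2) <= nu.
Implicit Types (a b : nat -> R[i]) (z w h D : R[i]) (r s t M C T S : R).

Lemma derive1_littleo (f : R -> R) t (d : R) : (forall e : R, 0 < e -> exists2 k : R, 0 < k &
   forall h : R, `|h| < k -> `|f (t + h) - f t - d * h| <= e * `|h|) -> derive1 f t = d.
Proof.
move=> H; rewrite /derive1; apply/cvg_lim => //; apply/cvgrPdist_le => e e0.
have [k k0 Hk] := H e e0; exists k => // h; rewrite /ball_ /= sub0r normrN => hk h0.
have -> : d - h^-1 *: (f (h + t) - f t) = - h^-1 * (f (t + h) - f t - d * h).
  by rewrite -[_ *: _]/(h^-1 * (f (h + t) - f t)) [h + t]addrC; field.
by rewrite normrM normrN normfV ler_pdivrMl ?normr_gt0 // [leRHS]mulrC; exact: Hk.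
Qed.

Lemma cderive_real (F : R[i] -> R[i]) t D : cderivative F t%:C D ->
  cderive (fun s => F s%:C) t = D.
Proof.
move=> FD; rewrite /cderive; apply: complex_ext => /=; apply: derive1_littleo => e e0;
  have [k k0 Hk] := FD e e0; exists k => // h hk; have := Hk h%:C;
  rewrite cmod_real => /(_ hk); apply: le_trans; rewrite rmorphD /=.
- by apply: le_trans (cmod_Re _); rewrite !cReB cReM /= mulr0 subr0.
- by apply: le_trans (cmod_Im _); rewrite !cImB cImM /= mulr0 add0r.
Qed.

Lemma cderive_ps a : ecoef a -> cderive (fun s => ps a s%:C) = fun t => ps (ediff a) t%:C.
Proof. by move=> ea; apply/funext => t; apply: cderive_real; exact: ps_cderivative. Qed.

(** The operator maps [z ^ (k + 2)] to [bessel_factor k * z ^ k], since [(k + 2) * (k + 1) + (2 * nu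
    + 1) * (k + 2)] has this value. *)
Definition bessel_factor (k : nat) : R := k.+2%:R * (k.+2%:R + 2 * nu).

Definition bessel_coef a k : R[i] := (bessel_factor k)%:C * a k.+2.

Lemma bessel_coefE a k : bessel_coef a k =
  ediff (ediff a) k + (2 * nu + 1)%:C * ediff a k.+1.
Proof.
rewrite /bessel_coef /ediff -!(rmorph_nat (real_complex R)) !mulrA -!rmorphM -mulrDl -rmorphD.
by congr (_%:C * _); rewrite /bessel_factor -!natr1; ring.
Qed.

Lemma ecoef_bessel a : ecoef a -> ecoef (bessel_coef a).
Proof.
move=> ea; have ed := ecoef_ediff ea; rewrite (funext (bessel_coefE a)); apply: ecoefD.
  exact: ecoef_ediff.
by apply: (@ecoefZ _ (fun k => ediff a k.+1)); exact: ecoef_shift.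
Qed.

Lemma ps_bessel_coef a z : ecoef a -> ps (bessel_coef a) z =
  ps (ediff (ediff a)) z + (2 * nu + 1)%:C * ps (fun k => ediff a k.+1) z.
Proof.
move=> ea; have ed := ecoef_ediff ea; rewrite (funext (bessel_coefE a)) psD ?psZ //.
- exact: ecoef_shift.
- exact: ecoef_ediff.
- by apply: (@ecoefZ _ (fun k => ediff a k.+1)); exact: ecoef_shift.
Qed.

Lemma ps_bessel_coef_neq0 a z : ecoef a -> a 1%N = 0 -> z != 0 -> ps (bessel_coef a) z =
  ps (ediff (ediff a)) z + (2 * nu + 1)%:C / z * ps (ediff a) z.
Proof.
move=> ea a1 z0; rewrite ps_bessel_coef // (ps_shift z (ecoef_shift (ecoef_ediff ea))).
have -> : ediff a 0 = 0 by rewrite /ediff a1 mulr0.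
by rewrite add0r -mulrA mulKf.
Qed.

Lemma lim_dnbhs (f : R -> R[i]) (L : R[i]) : (forall e : R, 0 < e -> exists2 d : R, 0 < d &
    forall s, `|s| < d -> s != 0 -> cmod (f s - L) <= e) ->
  lim ((f s : R[i]^o) @[s --> 0^']) = L.
Proof.
move=> H; apply: (@cvg_lim (R[i]^o)); first exact: norm_hausdorff.
apply/cvgrPdist_le => -[e eI]; rewrite ltcE /= => /andP[/eqP eI0 e0].
have [d d0 Hd] := H e e0; exists d => // s; rewrite /ball_ /= sub0r normrN => sd s0.
by rewrite cmodE lecE /= eI0 eqxx /= cmod_distC; exact: Hd.
Qed.

(** With [a 1 = 0] the quotient of the first derivative by the variable is again a power series, so
    the limit that defines the value at [0] is given by continuity. *)
Lemma bessel_ps a : ecoef a -> a 1%N = 0 ->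
  bessel nu (fun t => ps a t%:C) = fun t => ps (bessel_coef a) t%:C.
Proof.
move=> ea a1; have ed := ecoef_ediff ea; apply/funext => r; rewrite /bessel.
rewrite (cderive_ps ea) (cderive_ps ed).
have E s : s != 0 -> ps (ediff (ediff a)) s%:C + ((2 * nu + 1) / s)%:C * ps (ediff a) s%:C
   = ps (bessel_coef a) s%:C.
  move=> s0; rewrite ps_bessel_coef_neq0 // ?fmorph_eq0 //.
  by rewrite [((2 * nu + 1) / s)%:C]rmorphM fmorphV.
case: eqVneq => [->|r0]; last exact: E.
apply: lim_dnbhs => e e0; have [d d0 Hd] := cdiff_ccont (cdiff_ps 0 (ecoef_bessel ea)) e0.
exists d => // s sd s0; have := Hd s%:C; rewrite add0r cmod_real => /(_ sd).
by congr (cmod (_ - _) <= _); rewrite -E.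
Qed.

Definition bessel_const N : R := \prod_(j < N) bessel_factor j.*2.

Lemma bessel_factor_gt0 k : 0 < bessel_factor k.
Proof.
by rewrite mulr_gt0 // -addn2 natrD -addrA ltr_wpDl //; move: hnu; lra.
Qed.

Lemma bessel_const_gt0 N : 0 < bessel_const N.
Proof. by apply: prodr_gt0 => j _; exact: bessel_factor_gt0. Qed.

Lemma bessel_coef_odd a k : (forall j, odd j -> a j = 0) -> odd k -> bessel_coef a k = 0.
Proof. by move=> a0 ok; rewrite /bessel_coef a0 ?mulr0 //= negbK. Qed.

Lemma ecoef_iter_bessel N a : ecoef a -> ecoef (iter N bessel_coef a).
Proof. by elim: N => //= N IH ea; apply: ecoef_bessel; exact: IH. Qed.

Lemma iter_bessel_odd N a k : (forall j, odd j -> a j = 0) -> odd k ->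
  iter N bessel_coef a k = 0.
Proof. by elim: N k => [|N IH] k a0 /=; [exact: a0|apply: bessel_coef_odd => j; exact: IH]. Qed.

Lemma iter_bessel_ps N a : ecoef a -> (forall j, odd j -> a j = 0) ->
  iter N (bessel nu) (fun t => ps a t%:C) = fun t => ps (iter N bessel_coef a) t%:C.
Proof.
move=> ea a0; elim: N => //= N ->; apply: bessel_ps; first exact: ecoef_iter_bessel.
exact: iter_bessel_odd.
Qed.

Lemma iter_bessel_coef0 N a : iter N bessel_coef a 0%N = (bessel_const N)%:C * a N.*2.
Proof.
suff H k : iter N bessel_coef a k = (\prod_(j < N) bessel_factor (k + j.*2))%:C * a (k + N.*2)%N.
  by rewrite H.
elim: N k a => [|N IH] k a /=; first by rewrite big_ord0 mul1r addn0.
by rewrite -iterS iterSr IH /bessel_coef big_ord_recr /= mulrA -rmorphM doubleS !addnS.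
Qed.

Lemma iter_bessel_ps0 N a : ecoef a -> (forall j, odd j -> a j = 0) ->
  iter N (bessel nu) (fun t => ps a t%:C) 0 = (bessel_const N)%:C * a N.*2.
Proof.
by move=> ea a0; rewrite iter_bessel_ps // ps0 ?iter_bessel_coef0 //; exact: ecoef_iter_bessel.
Qed.

(** Two Cauchy estimates on unit discs bound the derivatives, and division by [z] is harmless for
    [cmod z >= 1]. The unit disc is treated separately, through the coefficients. *)
Lemma bessel_le_local a z S : ecoef a -> a 1%N = 0 -> 1 <= cmod z ->
  (forall w, cmod (w - z) <= 2 -> cmod (ps a w) <= S) ->
  cmod (ps (bessel_coef a) z) <= (4 + 2 * (2 * nu + 1)) * S.
Proof.
move=> ea a1 z1 H; have ed := ecoef_ediff ea.
have z0 : z != 0 by rewrite -cmod_gt0 (lt_le_trans _ z1).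
have D1 v : cmod (v - z) <= 1 -> cmod (ps (ediff a) v) <= 2 * S.
  move=> vz; apply: (cderivative_le (fun u => cdiff_ps u ea) (ps_cderivative v ea)) => w wv.
  apply: H; rewrite (le_trans (cmod_dist_triangle v _ _)) //.
  by rewrite (le_trans (lerD wv vz)) // -mulr2n.
have D2 := cderivative_le (fun u => cdiff_ps u ed) (ps_cderivative z ed) D1.
have D1z : cmod (ps (ediff a) z) <= 2 * S by apply: D1; rewrite subrr cmod0.
have n0 : 0 <= 2 * nu + 1 by move: hnu; lra.
rewrite ps_bessel_coef_neq0 // (le_trans (cmodD _ _)) // !cmodM cmodV cmod_real ger0_norm //.
rewrite [leRHS]mulrDl; apply: lerD; first by rewrite (le_trans D2) // mulrA -natrM.
rewrite -mulrA (_ : 2 * _ * S = (2 * nu + 1) * (2 * S)); last by ring.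
rewrite ler_wpM2l // (le_trans _ D1z) // ler_piMl ?cmod_ge0 //.
by rewrite invf_le1 // (lt_le_trans _ z1).
Qed.

Lemma growth_le_bessel a C T : 0 <= T -> ecoef a -> a 1%N = 0 -> growth_le (ps a) C T ->
  exists C', growth_le (ps (bessel_coef a)) C' T.
Proof.
move=> T0 ea a1 gF; have C0 := growth_ge0 gF; have [_ FC] := gF.
have eb := ecoef_bessel ea; have [M HM] := eb 2 (ltr0Sn _ 1).
have M0 : 0 <= M by rewrite (le_trans _ (HM 0%N)) // mulr_ge0 ?cmod_ge0 ?exprn_ge0.
have n0 : 0 <= 4 + 2 * (2 * nu + 1) by move: hnu; lra.
exists ((4 + 2 * (2 * nu + 1)) * (C * expR (T * 2)) + 2 * M); split=> z; first exact: cdiff_ps.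
have e1 : 1 <= expR (T * cmod z).
  by rewrite (le_trans _ (expR_ge1Dx _)) // lerDl mulr_ge0 ?cmod_ge0.
rewrite mulrDl; have [z1|z1] := leP 1 (cmod z).
  apply: (@le_trans _ _ ((4 + 2 * (2 * nu + 1)) * (C * expR (T * 2) * expR (T * cmod z)))).
    apply: bessel_le_local => // w wz; rewrite (le_trans (FC _)) // -mulrA ler_wpM2l //.
    rewrite -expRD ler_expR -mulrDr ler_wpM2l //.
    by rewrite -lerBlDr (le_trans (cmod_lerB _ _)).
  by rewrite mulrA lerDl mulr_ge0 ?expR_ge0 // mulr_ge0.
apply: (@le_trans _ _ (2 * M)).
  by apply: (ps_le eb (ltr0Sn _ 1) HM); rewrite divff // ltW.
rewrite -[leLHS]add0r lerD ?ler_peMr ?mulr_ge0 ?expR_ge0 //.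
Qed.

Lemma bessel_bounded a C T M : 0 <= T -> T <= 2 -> ecoef a -> a 1%N = 0 -> growth_le (ps a) C T ->
  (forall t, cmod (ps a t%:C) <= M) -> exists M', forall t, cmod (ps (bessel_coef a) t%:C) <= M'.
Proof.
move=> T0 T2 ea a1 gF FM; have C0 := growth_ge0 gF.
have M0 : 0 <= M by exact: le_trans (cmod_ge0 _) (FM 0).
have eb := ecoef_bessel ea; have [M1 HM] := eb 2 (ltr0Sn _ 1).
have M10 : 0 <= M1 by rewrite (le_trans _ (HM 0%N)) // mulr_ge0 ?cmod_ge0 ?exprn_ge0.
have n0 : 0 <= 4 + 2 * (2 * nu + 1) by move: hnu; lra.
(* [128 = 64 * 2]: [growth_strip] is used within distance [2] of the real axis. *)
exists ((4 + 2 * (2 * nu + 1)) * ((M + 16 * C) * expR 128) + 2 * M1) => t.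
have [t1|t1] := leP 1 `|t|.
  apply: (@le_trans _ _ ((4 + 2 * (2 * nu + 1)) * ((M + 16 * C) * expR 128))); last first.
    by rewrite lerDl mulr_ge0.
  apply: bessel_le_local => //; first by rewrite cmod_real.
  move=> [x y] wt; rewrite (le_trans (growth_strip x y gF T2 FM)) //.
  rewrite ler_wpM2l ?addr_ge0 ?mulr_ge0 // ler_expR.
  have := le_trans (cmod_Im _) wt; rewrite cImB /= subr0 => y2.
  by rewrite (_ : 128 = 64 * 2) ?ler_wpM2l // -natrM.
apply: (@le_trans _ _ (2 * M1)).
  by apply: (ps_le eb (ltr0Sn _ 1) HM); rewrite divff // cmod_real ltW.
by rewrite lerDr mulr_ge0 // mulr_ge0 ?expR_ge0 // addr_ge0 // mulr_ge0.
Qed.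

Lemma iter_bessel_bounded N a C T M : 0 <= T -> T <= 2 -> ecoef a -> (forall j, odd j -> a j = 0) ->
  growth_le (ps a) C T -> (forall t, cmod (ps a t%:C) <= M) ->
  exists2 M', 0 <= M' & forall t, cmod (ps (iter N bessel_coef a) t%:C) <= M'.
Proof.
move=> T0 T2 ea a0 gF FM.
suff [C' [M' [_ H]]] : exists C' M', growth_le (ps (iter N bessel_coef a)) C' T /\
    forall t, cmod (ps (iter N bessel_coef a) t%:C) <= M'.
  by exists M' => //; exact: le_trans (cmod_ge0 _) (H 0).
elim: N => [|N [C' [M' [g H]]]] /=; first by exists C, M.
have eN := ecoef_iter_bessel N ea; have o1 := iter_bessel_odd N a0 (isT : odd 1).
have [C1 g1] := growth_le_bessel T0 eN o1 g.
by have [M1 H1] := bessel_bounded T0 T2 eN o1 g H; exists C1, M1.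
Qed.

End Bessel.

(** * Compactness *)

Section ExponentialTypeCoefficients.
Context {R : realType}.
Implicit Types (F : R[i] -> R[i]) (a b c : nat -> R[i]) (z w h D : R[i]) (r M C T S e x t : R).

(* Exponential type at most [1], expressed by bounds that survive coefficientwise limits. *)
Definition expo_coef a := forall e, 0 < e -> exists C, forall k r, 0 < r ->
  cmod (a k) * r ^+ k <= C * expR ((1 + e) * r).

Lemma expo_coef_ecoef a : expo_coef a -> ecoef a.
Proof. by move=> H r r0; have [C HC] := H 1 ltr01; exists (C * expR ((1 + 1) * r)) => k; exact: HC. Qed.

Lemma ps_exp_type a : expo_coef a -> exp_type 1 (ps a).
Proof.
move=> ea; have ec := expo_coef_ecoef ea; split; first by apply/entire_cdiff => z; exact: cdiff_ps.
(* The coefficient bound is used at radius [(1 + d) * cmod z]. This makes the series geometric and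
   the exponent [(1 + d) ^+ 2 <= 1 + 3 * d <= 1 + e]. *)
move=> e e0; pose d := Num.min 1 (e / 3).
have d0 : 0 < d by rewrite lt_min ltr01 divr_gt0.
have d1 : d <= 1 by rewrite ge_min lexx.
have de : 3 * d <= e.
  by rewrite mulrC -ler_pdivlMr // ge_min lexx orbT.
have [C HC] := ea d d0; have C0 : 0 <= C.
  have := HC 0%N 1 ltr01; rewrite -(pmulr_lge0 _ (expR_gt0 ((1 + d) * 1))).
  by apply: le_trans; rewrite expr0 mulr1 cmod_ge0.
have rho0 : 0 <= (1 + d)^-1 by rewrite invr_ge0 addr_ge0 // ltW.
have rho1 : (1 + d)^-1 < 1 by rewrite invf_lt1 ?ltrDl // addr_gt0.
have k0 : 0 <= C / (1 - (1 + d)^-1) by rewrite divr_ge0 // subr_ge0 ltW.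
exists (C / (1 - (1 + d)^-1) + cmod (ps a 0)) => z.
have [->|z0] := eqVneq z 0.
  by rewrite cmod0 mulr0 expR0 mulr1 lerDr.
have cz : 0 < cmod z by rewrite cmod_gt0.
apply: (@le_trans _ _ (C / (1 - (1 + d)^-1) * expR (1 * (1 + e) * cmod z))); last first.
  by rewrite ler_wpM2r ?expR_ge0 // lerDl cmod_ge0.
apply: (geom_cvg_le (psP z ec)) => n; rewrite (le_trans (cmod_sum _ _ _)) //.
apply: (@le_trans _ _ (\sum_(0 <= k < n) C * expR (1 * (1 + e) * cmod z) * (1 + d)^-1 ^+ k)).
  rewrite big_mkord; apply: ler_sum => k _; rewrite cmodM cmodX exprVn ler_pdivlMr ?exprn_gt0 ?addr_gt0 //.
  have r0 : 0 < (1 + d) * cmod z by rewrite mulr_gt0 // addr_gt0.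
  rewrite -[leLHS]mulrA -exprMn (mulrC (cmod z)) (le_trans (HC k _ r0)) // ler_wpM2l // ler_expR mul1r mulrA.
  rewrite ler_pM2r //; have : d * d <= d * 1 by rewrite ler_wpM2l // ltW.
  move: de; clear; lra.
rewrite -mulr_sumr [leRHS]mulrAC; apply: ler_wpM2l; first by rewrite mulr_ge0 ?expR_ge0.
by rewrite (le_trans (sum_geometric_le _ _ rho0 rho1)) // expr0 mul1r.
Qed.

Lemma exp_type_growth F T : 1 < T -> exp_type 1 F -> exists C, growth_le F C T.
Proof.
move=> T1 [/entire_cdiff dF HF]; have T0 : 0 < T - 1 by rewrite subr_gt0.
have [C HC] := HF _ T0; exists C; split=> // z.
by have := HC z; rewrite mul1r addrC subrK.
Qed.

End ExponentialTypeCoefficients.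

(** * Coefficientwise limits of extremal polynomials *)

Section Compactness.
Context {R : realType}.
Implicit Types (u : nat -> R) (q : nat -> nat -> R[i]).

(** The limit is the supremum of the [x] that bound [u] from below on a member of [U]; upper bounds
    follow since the complement of a set outside [U] belongs to [U]. *)
Lemma ultra_limit (U : set_system nat) (uU : UltraFilter U) u (M : R) : (forall j, `|u j| <= M) ->
  exists L : R, forall e : R, 0 < e -> U [set j | `|u j - L| <= e].
Proof.
move=> uM; pose A := [set x : R | U [set j | x <= u j]].
have FU : Filter U by exact: _.
have A0 : A (- M).
  by apply: filterE => j /=; have := uM j; rewrite ler_norml => /andP[].
have AM : ubound A M.
  move=> x /= Ux; have [j /= xj] := filter_ex Ux.
  by rewrite (le_trans xj) // (le_trans (ler_norm _)).
have hA : has_sup A by split; [exists (- M)|exists M].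
exists (sup A) => e e0.
have [x Ax xs] := sup_adherent e0 hA.
have nA : ~ A (sup A + e).
  by move=> H; have := ub_le_sup (ex_intro _ _ AM) H; rewrite gerDl leNgt e0.
have [//|UC] := in_ultra_setVsetC [set j | sup A + e <= u j] uU.
apply: filterS (filterI Ax UC) => j /= [xj /negP].
rewrite -ltNge => /ltW ju; rewrite ler_norml lerBlDl ju andbT.
by rewrite lerBrDl (le_trans (ltW xs)).
Qed.

(* The limits are taken along a free ultrafilter, so that all coefficients are treated at once. *)
Lemma select_limit q (B : nat -> R) : (forall j k, cmod (q j k) <= B k) ->
  exists (a : nat -> R[i]) (sub : nat -> nat), (forall m, (m <= sub m)%N) /\
  forall k (e : R), 0 < e -> exists J, forall m, (J <= m)%N -> cmod (q (sub m) k - a k) <= e.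
Proof.
move=> qB; have [U [uU oU]] := @ultraFilterLemma nat \oo _.
have FU : Filter U by exact: _.
have Lre k := @ultra_limit U uU (fun j => complex.Re (q j k)) (B k) (fun j => le_trans (cmod_Re _) (qB j k)).
have Lim k := @ultra_limit U uU (fun j => complex.Im (q j k)) (B k) (fun j => le_trans (cmod_Im _) (qB j k)).
have [are Hre] := choice Lre; have [aim Him] := choice Lim.
pose a k := are k +i* aim k.
have Ha k (e : R) : 0 < e -> U [set j | cmod (q j k - a k) <= e].
  move=> e0; have e2 : 0 < e / 2 by rewrite divr_gt0.
  apply: filterS (filterI (Hre k _ e2) (Him k _ e2)) => j /= [h1 h2].
  by rewrite (le_trans (cmod_le_ReIm _)) // cReB cImB [e]splitr lerD.
have h2 m : 0 < 2^-1 ^+ m :> R by rewrite exprn_gt0 // invr_gt0.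
have S m : exists j, (m <= j)%N /\ forall k, (k <= m)%N -> cmod (q j k - a k) <= 2^-1 ^+ m.
  have : U [set j | forall k, (k < m.+1)%N -> cmod (q j k - a k) <= 2^-1 ^+ m].
    elim: (m.+1) => [|n IH]; first by apply: filterE.
    apply: filterS (filterI IH (Ha n _ (h2 m))) => j /= [h1 hn] k.
    by rewrite ltnS leq_eqVlt => /orP[/eqP ->|/h1].
  have mU : U [set j | (m <= j)%N] by apply: oU; exists m.
  by move=> H; have [j /= [mj Hj]] := filter_ex (filterI mU H); exists j.
have [sub Hsub] := choice S; exists a, sub; split=> [m|k e e0]; first by case: (Hsub m).
have [J HJ] := @half_power_small R 1 e ler01 e0.
exists (maxn J k) => m; rewrite geq_max => /andP[/HJ Jm km].
by have [_ H] := Hsub m; rewrite (le_trans (H _ km)) // -[leLHS]mul1r.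
Qed.

Lemma ps_tail_le (c : nat -> R[i]) (z : R[i]) (r M : R) n : ecoef c -> 0 < r ->
  (forall k, cmod (c k) * r ^+ k <= M) -> cmod z <= r / 2 ->
  cmod (ps c z) <= \sum_(k < n) cmod (c k) * cmod z ^+ k + 2 * M * 2^-1 ^+ n.
Proof.
move=> ec r0 cM zr.
have M0 : 0 <= M by rewrite (le_trans _ (cM 0%N)) // mulr_ge0 ?cmod_ge0 ?exprn_ge0 // ltW.
have h0 : 0 <= (2^-1 : R) by rewrite invr_ge0.
have h1 : (2^-1 : R) < 1 by rewrite invf_lt1 ?ltr1n.
have T k : cmod (c k) * cmod z ^+ k <= M * 2^-1 ^+ k.
  apply: (@le_trans _ _ (cmod (c k) * (r / 2) ^+ k)).
    by rewrite ler_wpM2l ?cmod_ge0 // lerXn2r ?nnegrE ?cmod_ge0 // divr_ge0 // ltW.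
  by rewrite exprMn mulrA ler_wpM2r // exprn_ge0 // invr_ge0.
apply: (geom_cvg_le (psP z ec)) => m; rewrite (le_trans (cmod_sum _ _ _)) //.
under eq_bigr do rewrite cmodM cmodX.
rewrite -!(big_mkord xpredT (fun k => cmod (c k) * cmod z ^+ k)).
have P k : 0 <= cmod (c k) * cmod z ^+ k by rewrite mulr_ge0 ?exprn_ge0 ?cmod_ge0.
have [mn|/ltnW nm] := leqP m n.
  rewrite -[leLHS]addr0 lerD ?mulr_ge0 ?exprn_ge0 //.
  by rewrite [leRHS](big_cat_nat (n := m)) //= lerDl sumr_ge0.
rewrite [leLHS](big_cat_nat (n := n)) //= lerD2l.
apply: (@le_trans _ _ (\sum_(n <= k < m) M * 2^-1 ^+ k)); first by apply: ler_sum.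
rewrite -mulr_sumr -[leRHS]mulrA [leRHS]mulrCA ler_wpM2l // (le_trans (sum_geometric_le _ _ h0 h1)) //.
by rewrite mulrC le_eqVlt; apply/orP; left; apply/eqP; field.
Qed.

Variables (nu : R) (p : \bar R).
Hypotheses (hnu : - (1 / 2) <= nu) (hp : (0 < p)%E).
Local Notation norm_le := (norm_le nu p).

(** The Nikolskii bound on the interval shrunk by [1 - d], followed by Bernstein-Walsh: a
    coefficient bound of type [1 / (1 - d)] that is uniform in [n]. *)
Lemma norm_le_coef_bound (d : R) : 0 < d < 1 -> exists2 K : R, 0 <= K &
  forall n (q : {poly R[i]}) (c : R) k (t : R), (0 < n)%N -> (size q <= n.+1)%N -> 0 <= c ->
    norm_le `[- n%:R, n%:R]%classic (fun t => q.[t%:C]) c -> 0 < t ->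
    cmod q`_k * t ^+ k <= K * c * expR (t / (1 - d)).
Proof.
move=> d01; have [K K0 HK] := nikolskii hnu hp (ltn0Sn 0) d01.
have d1 : 0 < 1 - d by case/andP: d01 => _; rewrite subr_gt0.
exists (2 * K) => [|n q c k t n0 sq c0 qc t0]; first by rewrite mulr_ge0.
have nR : 0 < n%:R :> R by rewrite ltr0n.
have sq' : (size q <= (1 * n).+1)%N by rewrite mul1n.
have r0 : 0 < (1 - d) * n%:R by rewrite mulr_gt0.
have := poly_coef_le_interval k sq r0 t0 (HK n q c n0 sq' c0 qc).
have -> : n%:R * (t / ((1 - d) * n%:R)) = t / (1 - d) by field; rewrite !gt_eqF.
by rewrite !mulrA.
Qed.

Lemma extremal_limit (Q : nat -> {poly R[i]}) (n : nat -> nat) k0 (x : R) :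
  (forall j, (j < n j)%N) -> (forall j, (size (Q j) <= (n j).+1)%N) ->
  (forall j z, (Q j).[- z] = (Q j).[z]) ->
  (forall j, norm_le `[- (n j)%:R, (n j)%:R]%classic (fun t => (Q j).[t%:C]) 1) ->
  (forall e : R, 0 < e -> exists J, forall j, (J <= j)%N -> x - e <= cmod (Q j)`_k0) ->
  exists a, [/\ expo_coef a, forall k, odd k -> a k = 0,
    norm_le setT (fun t => ps a t%:C) 1 & x <= cmod (a k0)].
Proof.
move=> jn sQ Qe Qn Qx.
have n0 j : (0 < n j)%N by exact: leq_ltn_trans (jn j).
have CB (d : R) : 0 < d < 1 -> exists2 K : R, 0 <= K & forall j k (t : R), 0 < t ->
    cmod (Q j)`_k * t ^+ k <= K * expR (t / (1 - d)).
  move=> /norm_le_coef_bound[K K0 HK]; exists K => // j k t t0.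
  by have := HK _ _ 1 k t (n0 j) (sQ j) ler01 (Qn j) t0; rewrite mulr1.
have half : 0 < (1 / 2 : R) < 1 by apply/andP; split; lra.
have [K K0 HK] := CB _ half.
have [a [sub [msub Ha]]] := @select_limit (fun j k => (Q j)`_k) (fun=> K * expR (1 / (1 - 1 / 2)))
  (fun j k => ltac:(by have := HK j k 1 ltr01; rewrite expr1n mulr1)).
(* Bounds uniform in [j] pass to the limit coefficients. *)
have aB (S : R) k (t : R) : 0 < t -> (forall j, cmod (Q j)`_k * t ^+ k <= S) -> cmod (a k) * t ^+ k <= S.
  move=> t0 H; apply/ler_addgt0Pr => e e0; have tk : 0 < t ^+ k by rewrite exprn_gt0.
  have [J /(_ J (leqnn _)) HJ] := Ha k (e / t ^+ k) (divr_gt0 e0 tk).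
  rewrite ler_pdivlMr // in HJ.
  rewrite -[a k](subKr (Q (sub J))`_k) (le_trans (ler_wpM2r (ltW tk) (cmodB _ _))) // mulrDl.
  by rewrite lerD.
have ea : expo_coef a.
  (* Chosen so that [1 / (1 - d) = 1 + e]. *)
  move=> e e0; pose d := e / (1 + e).
  have e1 : 0 < 1 + e by rewrite addr_gt0.
  have d01 : 0 < d < 1 by rewrite divr_gt0 //= ltr_pdivrMr // mul1r ltrDr.
  have [K1 K10 HK1] := CB _ d01; exists K1 => k r r0; apply: aB => // j.
  have -> : (1 + e) * r = r / (1 - d) by rewrite /d; field; rewrite !gt_eqF // addrK.
  exact: HK1.
exists a; split=> //.
- move=> k ok; apply/eqP; rewrite -cmod_eq0 eq_le cmod_ge0 andbT; apply/ler_addgt0Pr => e e0.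
  have [J /(_ J (leqnn _)) HJ] := Ha k e e0; rewrite add0r; move: HJ.
  rewrite (_ : (Q (sub J))`_k = 0) ?sub0r ?cmodN //.
  have H z : ps (fun k => (Q (sub J))`_k) (- z) = ps (fun k => (Q (sub J))`_k) z.
    by rewrite 2!ps_poly.
  exact: (ps_even_coef (ecoef_poly (Q (sub J))) H ok).
- apply: (norm_le_fatou hp (Q := fun m t => (Q (sub m)).[t%:C]) (A := fun m => (n (sub m))%:R)) => //.
  + by move=> j; rewrite ltr0n.
  + move=> A; have [J HJ] : exists J : nat, A <= J%:R.
      by exists (Num.bound `|A|); rewrite (le_trans (ler_norm _)) // ltW // archi_boundP.
    exists J => j Jj; rewrite (le_trans HJ) // ler_nat.
    by rewrite (leq_trans Jj) // (leq_trans (msub j)) // ltnW.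
  + by move=> j; apply: cdiff_rcont => z; exact: cdiff_horner.
  + by apply: cdiff_rcont => z; apply: cdiff_ps; exact: expo_coef_ecoef.
  + move=> t e e0.
    pose r := 2 * `|t| + 1; have r0 : 0 < r by rewrite ltr_wpDl // mulr_ge0.
    pose S := K * expR (r / (1 - 1 / 2)).
    have S0 : 0 <= S by rewrite mulr_ge0 ?expR_ge0.
    have e2 : 0 < e / 2 by rewrite divr_gt0.
    (* Pointwise convergence for Fatou's lemma: [N] makes the tail small uniformly in [m], and the
       first [N] coefficients converge. *)
    have [N /(_ N (leqnn _)) HN] := @half_power_small R (2 * (S + S)) (e / 2) ltac:(by rewrite mulr_ge0 // addr_ge0) e2.
    have fin : exists J, forall m, (J <= m)%N ->
        \sum_(k < N) cmod ((Q (sub m))`_k - a k) * cmod (t%:C : R[i]) ^+ k <= e / 2.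
      elim: N {HN} (e / 2) e2 => [|N IH] e1 e10.
        by exists 0%N => m _; rewrite big_ord0 ltW.
      have e12 : 0 < e1 / 2 by rewrite divr_gt0.
      have [J1 H1] := IH _ e12; pose P := cmod (t%:C : R[i]) ^+ N.
      have P1 : 0 < P + 1 by rewrite ltr_wpDl // exprn_ge0 ?cmod_ge0.
      have [J2 H2] := Ha N (e1 / 2 / (P + 1)) (divr_gt0 e12 P1).
      exists (maxn J1 J2) => m; rewrite geq_max => /andP[/H1 h1 /H2 h2].
      rewrite big_ord_recr /= [e1]splitr lerD // -/P.
      rewrite ler_pdivlMr // in h2; rewrite (le_trans _ h2) // ler_wpM2l ?cmod_ge0 // lerDl //.
    have [J HJ] := fin; exists J => m /HJ h.
    have eq : ecoef (fun k => (Q (sub m))`_k + -1 * a k).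
      by apply: ecoefD; [exact: ecoef_poly|apply: ecoefZ; exact: expo_coef_ecoef].
    have -> : (Q (sub m)).[t%:C] - ps a t%:C = ps (fun k => (Q (sub m))`_k + -1 * a k) t%:C.
      rewrite psD ?psZ ?ps_poly ?mulN1r //; first exact: expo_coef_ecoef.
        exact: ecoef_poly.
      by apply: ecoefZ; exact: expo_coef_ecoef.
    have B k : cmod ((Q (sub m))`_k + -1 * a k) * r ^+ k <= S + S.
      rewrite mulN1r (le_trans (ler_wpM2r _ (cmodB _ _))) ?exprn_ge0 ?(ltW r0) // mulrDl lerD //.
        exact: HK.
      by apply: aB => // j; exact: HK.
    rewrite (le_trans (@ps_tail_le _ _ r _ N eq r0 B _)) //.
      by rewrite cmod_real ler_pdivlMr // mulrC lerDl.
    rewrite [e]splitr lerD //; move: h; congr (_ <= _); apply: eq_bigr => k _.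
    by rewrite mulN1r.
- apply/ler_addgt0Pr => e e0; have e2 : 0 < e / 2 by rewrite divr_gt0.
  have [J1 H1] := Qx _ e2; have [J2 H2] := Ha k0 _ e2.
  have h1 := H1 (sub (maxn J1 J2)) (leq_trans (leq_maxl _ _) (msub _)).
  have h2 := H2 _ (leq_maxr J1 J2).
  have h3 := cmod_lerB (Q (sub (maxn J1 J2)))`_k0 (a k0).
  move: h1 h2 h3; move: (cmod _) (cmod _) (cmod _) => u v y; clear; lra.
Qed.

End Compactness.

(** * A nontrivial entire function *)

Section Sinc.
Context {R : realType}.
Implicit Types (z w : R[i]) (t x y : R) (a g : nat -> R[i]).

Definition csin z : R[i] := (cexp ('i * z) - cexp (- ('i * z))) / (2 * 'i).

Lemma growth_le_csin : growth_le csin 1 1.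
Proof.
have i20 : (2 * 'i : R[i]) != 0 by rewrite -cmod_gt0 cmodM (cmod_nat 2) cmod_i mulr1.
split=> z.
  have d1 : cdiff (fun w => 'i * w) z by apply: cdiffM; [exact: cdiff_cst|exact: cdiff_id].
  apply: (@cdiffM _ (fun w => cexp ('i * w) - cexp (- ('i * w)))); last exact: cdiff_cst.
  apply: (@cdiffB _ (fun w => cexp ('i * w)) (fun w => cexp (- ('i * w)))).
    by apply: (@cdiff_comp _ (fun w => 'i * w) cexp) => //; exact: cdiff_cexp.
  apply: (@cdiff_comp _ (fun w => - ('i * w)) cexp); last exact: cdiff_cexp.
  have -> : (fun w => - ('i * w)) = (fun w : R[i] => 0 - 'i * w) by apply/funext => w; rewrite sub0r.
  by apply: cdiffB => //; exact: cdiff_cst.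
rewrite mul1r mul1r /csin cmodM cmodV cmodM (cmod_nat 2) cmod_i mulr1 ler_pdivrMr //.
rewrite (le_trans (cmodB _ _)) // !cmod_cexp mulr_natr mulr2n lerD // ler_expR.
  by rewrite (le_trans (ler_norm _)) // (le_trans (cmod_Re _)) // cmodM cmod_i mul1r.
by rewrite (le_trans (ler_norm _)) // (le_trans (cmod_Re _)) // cmodN cmodM cmod_i mul1r.
Qed.

Lemma csin_real t : csin t%:C = (sin t)%:C.
Proof.
have E x : cexp ('i * x%:C) = cos x +i* sin x.
  by rewrite /cexp cReM cImM /= !mul0r !mul1r sub0r oppr0 expR0 mul1r add0r.
rewrite /csin (_ : - ('i * t%:C) = 'i * (- t)%:C); last by rewrite rmorphN mulrN.
rewrite !E cosN sinN.
have -> : (cos t +i* sin t) - (cos t +i* - sin t) = (2 * 'i) * (sin t)%:C.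
  by apply: complex_ext; rewrite ?cReB ?cImB ?cReM ?cImM /=; ring.
by rewrite mulrAC mulfV ?mul1r // -cmod_gt0 cmodM (cmod_nat 2) cmod_i mulr1.
Qed.

Lemma csinN z : csin (- z) = - csin z.
Proof. by rewrite /csin mulrN opprK -[RHS]mulNr opprB. Qed.

(** Shifting the coefficients of the sine divides by [z] with no special case at [0]. *)
Definition sinc_coef k := taylor_coeff csin k.+1 : R[i].
Definition sinc := ps sinc_coef.

Lemma ecoef_sinc : ecoef sinc_coef.
Proof. by apply: ecoef_shift; exact: ecoef_taylor growth_le_csin. Qed.

Lemma sincE z : z * sinc z = csin z.
Proof.
rewrite -(ps_taylor z ler01 growth_le_csin) (ps_shift z ecoef_sinc).
rewrite (taylor_coeff0 growth_le_csin.1) -[0]/(0%:C) csin_real sin0.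
by rewrite add0r.
Qed.

Lemma sinc0 : sinc 0 != 0.
Proof.
rewrite /sinc ps0; last exact: ecoef_sinc.
have ea := ecoef_taylor ler01 growth_le_csin.
have := cderive_real (ps_cderivative 0%:C ea); rewrite (ps0 (ecoef_ediff ea)).
rewrite /ediff mul1r -/(sinc_coef 0) => E; apply/eqP => s0.
have : complex.Re (cderive (fun s : R => ps (taylor_coeff csin) s%:C) 0) = 1.
  have -> : (fun s : R => ps (taylor_coeff csin) s%:C) = (fun s => (sin s)%:C).
    by apply/funext => s; rewrite (ps_taylor _ ler01 growth_le_csin) csin_real.
  rewrite /cderive /= derive1E -[RHS](cos0 R).
  exact: derive_val.
by rewrite E s0 /= => /eqP; rewrite eq_sym oner_eq0.
Qed.

Lemma sincN z : sinc (- z) = sinc z.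
Proof.
have [->|z0] := eqVneq z 0; first by rewrite oppr0.
by have := csinN z; rewrite -(sincE (- z)) -(sincE z) mulNr => /oppr_inj/(mulfI z0).
Qed.

Lemma sinc_growth : exists2 K : R, 0 <= K & forall z, cmod (sinc z) <= K * expR (cmod z).
Proof.
have [M HM] := ecoef_sinc (ltr0Sn _ 1).
have M0 : 0 <= M by rewrite (le_trans _ (HM 0%N)) // mulr_ge0 ?cmod_ge0 ?exprn_ge0.
have M1 : 0 <= 2 * M + 1 by rewrite addr_ge0 // mulr_ge0.
exists (2 * M + 1) => // z; have [z1|z1] := leP 1 (cmod z).
  have := growth_le_csin.2 z; rewrite -sincE cmodM mul1r mul1r => H.
  apply: (@le_trans _ _ (expR (cmod z))); last first.
    by rewrite ler_peMl ?expR_ge0 // lerDr mulr_ge0.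
  by apply: le_trans H; rewrite ler_peMl ?cmod_ge0.
apply: (@le_trans _ _ (2 * M)).
  by apply: (ps_le ecoef_sinc (ltr0Sn _ 1) HM); rewrite divff // ltW.
rewrite (@le_trans _ _ (2 * M + 1)) ?lerDl // ler_peMr //.
by rewrite (le_trans _ (expR_ge1Dx _)) // lerDl cmod_ge0.
Qed.

Lemma sinc_decay : exists2 B : R, 0 <= B & forall t, cmod (sinc t%:C) * (1 + `|t|) <= B.
Proof.
have [K K0 HK] := sinc_growth.
exists (K * expR 1 * 2 + 2) => [|t]; first by rewrite addr_ge0 // !mulr_ge0 ?expR_ge0.
have H : `|t| * cmod (sinc t%:C) <= 1.
  rewrite -(cmod_real t) -cmodM sincE csin_real cmod_real ler_norml.
  by rewrite sin_geN1 sin_le1.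
have [t1|t1] := leP 1 `|t|.
  apply: (@le_trans _ _ 2); last by rewrite lerDr !mulr_ge0 ?expR_ge0.
  rewrite mulrDr mulr1 [X in _ + X]mulrC (_ : 2 = 1 + 1) // lerD //.
  by apply: le_trans H; rewrite ler_peMl ?cmod_ge0.
apply: (@le_trans _ _ (K * expR 1 * 2)); last by rewrite lerDl.
apply: ler_pM; rewrite ?cmod_ge0 ?addr_ge0 //; last by move: t1; lra.
by rewrite (le_trans (HK _)) // ler_wpM2l // ler_expR cmod_real ltW.
Qed.

Lemma power_le_expR (k : nat) (e : R) : 0 < e -> exists2 C : R, 0 <= C & forall x, 0 <= x -> x ^+ k <= C * expR (e * x).
Proof.
case: k => [|k] e0.
  by exists 1 => // x x0; rewrite expr0 mul1r (le_trans _ (expR_ge1Dx _)) // lerDl mulr_ge0 // ltW.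
have k0 : 0 < k.+1%:R :> R by [].
exists ((k.+1%:R / e) ^+ k.+1) => [|x x0]; first by rewrite exprn_ge0 // divr_ge0 // ltW.
have -> : e * x = k.+1%:R * (e * x / k.+1%:R) by field; rewrite gt_eqF.
rewrite expRM_natl -exprMn lerXn2r ?nnegrE ?mulr_ge0 ?expR_ge0 ?divr_ge0 ?invr_ge0 ?(ltW e0) //.
pose y := e * x / k.+1%:R; have H := expR_ge1Dx y; rewrite -/y.
have xE : x = k.+1%:R / e * y by rewrite /y; field; rewrite !gt_eqF.
rewrite [leLHS]xE.
by rewrite ler_wpM2l ?divr_ge0 ?(ltW e0) // (le_trans _ H) // lerDr.
Qed.

Definition pad_coef M g k : R[i] := if (k < M)%N then 0 else g (k - M)%N.

Lemma ps_pad M g : ecoef g -> ecoef (pad_coef M g) /\ forall z, ps (pad_coef M g) z = z ^+ M * ps g z.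
Proof.
move=> eg; elim: M => [|M [e1 E1]].
  have -> : pad_coef 0 g = g by apply/funext => k; rewrite /pad_coef ltn0 subn0.
  by split=> // z; rewrite expr0 mul1r.
have S : (fun k => pad_coef M.+1 g k.+1) = pad_coef M g.
  by apply/funext => k; rewrite /pad_coef ltnS subSS.
split; first by apply: ecoef_unshift; rewrite S.
by move=> z; rewrite ps_shift S // E1 exprS mulrA [pad_coef _ _ _]/pad_coef /= add0r.
Qed.

Variables (nu : R) (p : \bar R).
Hypotheses (hnu : - (1 / 2) <= nu) (hp : (0 < p)%E).
Local Notation norm_le := (norm_le nu p).
Local Notation mu := lebesgue_measure.

Lemma integral_oneDsqrV : (\int[mu]_(t in setT) ((oneDsqr t)^-1 : R)%:E = (pi : R)%:E)%E.
Proof.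
rewrite (@ge0_symfun_integralT _ (fun t => (oneDsqr t)^-1)).
- have -> : [set x : R | 0 <= x] = `[0%R, +oo[%classic by rewrite set_itvE.
  by rewrite integral0y_oneDsqr -EFinM mulrCA mulfV ?mulr1.
- by move=> x; rewrite invr_ge0 (le_trans ler01) // oneDsqr_ge1.
- exact: continuous_oneDsqrV.
- by move=> x; rewrite /= /oneDsqr sqrrN.
Qed.

Lemma norm_le_decay : exists L : nat, forall (f : R -> R[i]) (C : R), rcont f -> 0 <= C ->
  (forall t, cmod (f t) * (1 + `|t|) ^+ L <= C) -> exists2 c : R, 0 <= c & norm_le setT f c.
Proof.
have [[pE _]|[r [pE r0 _]]] := exponent_cases nu hp.
  exists 0%N => f C cf C0 H; exists C => //; apply/(norm_le_infty nu pE C0 fat_setT cf) => t _.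
  by have := H t; rewrite expr0 mulr1.
have n0 : 0 <= 2 * nu + 1 by move: hnu; lra.
(* The weight costs [2 * nu + 1] powers of [1 + |t|]; the two that remain make the integrand
   comparable with [(1 + t ^+ 2)^-1]. *)
pose L := Num.bound ((2 * nu + 3) / r).
have LE : 2 * nu + 3 <= r * L%:R.
  rewrite [leRHS]mulrC -ler_pdivrMr // /L ltW // archi_boundP // divr_ge0 ?(ltW r0) //; move: n0; lra.
exists L => f C cf C0 H.
pose c := (C `^ r * pi) `^ r^-1; have c0 : 0 <= c by exact: powR_ge0.
exists c => //; apply/(norm_le_fin nu hp setT f pE c0).
have -> : c `^ r = C `^ r * pi.
  by rewrite -powRrM mulVf ?gt_eqF // powRr1 // mulr_ge0 ?powR_ge0 // pi_ge0.
rewrite EFinM -integral_oneDsqrV -ge0_integralZl_EFin ?powR_ge0 //.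
- apply: ge0_le_integral => //.
  + by move=> t _; exact: integrand_ge0.
  + exact: measurable_integrand.
  + apply: measurable_funeM; apply/measurable_EFinP.
    by apply: continuous_measurable_fun; exact: continuous_oneDsqrV.
  move=> t _; rewrite -EFinM lee_fin.
  have T1 : 1 <= 1 + `|t| by rewrite lerDl.
  have T0 : 0 < 1 + `|t| by exact: lt_le_trans T1.
  have w1 : bessel_weight nu t <= (1 + `|t|) `^ (2 * nu + 1).
    by apply: bessel_weight_le => //; rewrite lerDr.
  have f1 : cmod (f t) `^ r <= C `^ r * (1 + `|t|) `^ (- (r * L%:R)).
    apply: (@le_trans _ _ ((C * (1 + `|t|) ^- L) `^ r)).
      rewrite ge0_ler_powR ?(ltW r0) ?nnegrE ?cmod_ge0 ?mulr_ge0 ?invr_ge0 ?exprn_ge0 ?(ltW T0) //.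
      by rewrite ler_pdivlMr ?exprn_gt0.
    rewrite powRM ?invr_ge0 ?exprn_ge0 ?(ltW T0) //.
    by rewrite -(powR_mulrn L (ltW T0)) -powRN -powRrM mulNr [L%:R * r]mulrC.
  rewrite (le_trans (ler_pM (powR_ge0 _ _) (bessel_weight_ge0 _ _) f1 w1)) //.
  rewrite -mulrA ler_wpM2l ?powR_ge0 // -powRD; last by rewrite (gt_eqF T0) implybT.
  apply: (@le_trans _ _ ((1 + `|t|) `^ (- 2%:R))).
    by rewrite ler_powR //; move: LE; lra.
  rewrite powRN powR_mulrn ?(ltW T0) // lef_pV2 ?posrE ?exprn_gt0 //.
  by rewrite /oneDsqr -(real_normK (num_real t)); have := normr_ge0 t; nra.
- by apply/measurable_EFinP; apply: continuous_measurable_fun; exact: continuous_oneDsqrV.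
Qed.

(* The function is [z ^ (2 N) * (sin (z / m) / (z / m)) ^ m] with [m] large. *)
Lemma test_function N : exists a, [/\ ecoef a, exp_type 1 (ps a), forall z, ps a (- z) = ps a z,
  exists2 c : R, 0 <= c & norm_le setT (fun t => ps a t%:C) c & a N.*2 != 0].
Proof.
have [L HL] := norm_le_decay; have [K K0 HK] := sinc_growth; have [B B0 HB] := sinc_decay.
(* [N.*2] factors compensate the power of [z], [L] give the decay for [norm_le_decay], and the
   successor keeps [m] positive. The type is [m * m^-1 = 1]. *)
pose m := (N.*2 + L).+1; have m0 : 0 < m%:R :> R by rewrite ltr0n.
have mC : (m%:R : R[i]) != 0 by rewrite pnatr_eq0.
pose G z := sinc (m%:R^-1 * z) ^+ m.
have dG z : cdiff G z.
  apply: (@cdiffX _ (fun w => sinc (m%:R^-1 * w))).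
  apply: (@cdiff_comp _ (fun w => m%:R^-1 * w) sinc); last by apply: cdiff_ps; exact: ecoef_sinc.
  by apply: cdiffM; [exact: cdiff_cst|exact: cdiff_id].
have gG : growth_le G (K ^+ m) 1.
  split=> // z; rewrite /G cmodX mul1r.
  have -> : cmod z = m%:R * cmod (m%:R^-1 * z).
    by rewrite cmodM cmodV cmod_nat mulrA mulfV ?mul1r // gt_eqF.
  by rewrite expRM_natl -exprMn lerXn2r ?nnegrE ?cmod_ge0 ?mulr_ge0 ?expR_ge0.
have eg := ecoef_taylor ler01 gG.
have [ea E] := ps_pad N.*2 eg; set a := pad_coef _ _ in ea E.
have E' z : ps a z = z ^+ N.*2 * G z by rewrite E (ps_taylor z ler01 gG).
have GN z : G (- z) = G z by rewrite /G mulrN sincN.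
have G0 : G 0 != 0 by rewrite /G mulr0 expf_neq0 //; exact: sinc0.
exists a; split; first exact: ea.
- split; first by apply/entire_cdiff => z; exact: cdiff_ps.
  move=> e e0; have [C C0 HC] := power_le_expR N.*2 e0.
  exists (C * K ^+ m) => z; rewrite (E' z) cmodM cmodX mul1r mulrDl mul1r addrC expRD.
  rewrite mulrACA; apply: ler_pM; rewrite ?exprn_ge0 ?cmod_ge0 //; first by apply: HC; exact: cmod_ge0.
  by have := gG.2 z; rewrite mul1r.
- move=> z; rewrite (E' z) (E' (- z)) GN; congr (_ * _).
  by rewrite exprNn -signr_odd odd_double expr0 mul1r.
- apply: (HL _ ((m%:R * B) ^+ m)); first by apply: cdiff_rcont => z; exact: cdiff_ps.
    by rewrite exprn_ge0 // mulr_ge0 // ltW.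
  move=> t; rewrite (E' t%:C) cmodM {1}/G !cmodX cmod_real.
  have T0 : 0 <= 1 + `|t| by rewrite addr_ge0.
  have t1 : `|t| ^+ N.*2 <= (1 + `|t|) ^+ N.*2 by rewrite lerXn2r ?nnegrE // lerDr.
  have s1 : cmod (sinc (m%:R^-1 * t%:C)) * (1 + `|t|) <= m%:R * B.
    have := HB (m%:R^-1 * t); rewrite rmorphM fmorphV rmorph_nat => H.
    rewrite (le_trans _ (ler_wpM2l (ltW m0) H)) // mulrCA ler_wpM2l ?cmod_ge0 //.
    rewrite mulrDr mulr1 normrM ger0_norm ?invr_ge0 ?(ltW m0) // mulrA mulfV ?gt_eqF // mul1r.
    by rewrite lerD2r ler1n.
  have s2 : (cmod (sinc (m%:R^-1 * t%:C)) * (1 + `|t|)) ^+ m <= (m%:R * B) ^+ m.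
    by rewrite lerXn2r ?nnegrE ?mulr_ge0 ?cmod_ge0 // ltW.
  apply: le_trans s2; rewrite exprMn [leLHS]mulrAC [leLHS]mulrC ler_wpM2l ?exprn_ge0 ?cmod_ge0 //.
  rewrite (le_trans (ler_wpM2r _ t1)) ?exprn_ge0 // -exprD.
  by rewrite ler_weXn2l ?lerDl.
- by rewrite /a /pad_coef ltnn subnn (taylor_coeff0 dG).
Qed.

End Sinc.

(** * Ratios of norms *)

Section NormValues.
Context {R : realType}.
Variables (nu : R) (p : \bar R).
Hypotheses (hnu : - (1 / 2) <= nu) (hp : (0 < p)%E).
Local Notation norm_le := (norm_le nu p).
Local Notation nrm Om f := (weighted_norm Om (bessel_weight nu) p f).
Local Notation s := (scale_exp nu p).
Implicit Types (f : R -> R[i]) (Om : set R) (c k l t u v : R).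

Lemma norm_le_neq0 Om f : measurable Om -> fat Om -> rcont f -> nonzero_on Om f -> ~ norm_le Om f 0.
Proof.
move=> mOm fOm cf [t0 Ot0 ft0] H.
have e0 : 0 < cmod (f t0) / 2 by rewrite divr_gt0 // cmod_gt0.
have [d d0 Hd] := (rcontP f).2 cf t0 _ e0.
have [u [v [uv Huv]]] := fOm t0 d Ot0 d0.
have low t : u <= t <= v -> Om t /\ cmod (f t0) / 2 <= cmod (f t).
  move=> /Huv[Ot td]; split=> //; have := Hd (t - t0) td; rewrite addrCA subrr addr0 => h1.
  have := cmod_lerB (f t0) (f t); rewrite cmod_distC => h2.
  by move: h1 h2; move: (cmod _) (cmod _) (cmod _) => x y z; clear; lra.
(* The interval is shortened so that its length is at most its distance from [0], as [norm_le_lower]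
   requires. *)
have [u' [v' [uv' [uu' [vv' far]]]]] : exists u' v', u' < v' /\ u <= u' /\ v' <= v /\
    forall t, u' <= t <= v' -> v' - u' <= `|t|.
  have [v0|v0] := ltP 0 v.
    exists (Num.max u (v / 2)), v; split; [|split; [|split]] => //.
    - by rewrite gt_max uv /= ltr_pdivrMr // mulr_natr mulr2n ltrDl.
    - by rewrite le_max lexx.
    - move=> t /andP[+ _]; rewrite ge_max => /andP[_ h].
      rewrite (le_trans _ (ler_norm _)) // (le_trans _ h) // lerBlDr [leLHS]splitr lerD2l.
      by rewrite le_max lexx orbT.
  have u0 : u < 0 by exact: lt_le_trans v0.
  exists u, (Num.min v (u / 2)); split; [|split; [|split]] => //.
  - rewrite lt_min uv /=; lra.
  - by rewrite ge_min lexx.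
  - move=> t /andP[_]; rewrite le_min => /andP[_ h].
    have h1 : - t <= `|t| by rewrite -normrN ler_norm.
    have h2 : Num.min v (u / 2) <= u / 2 by rewrite ge_min lexx orbT.
    move: h h1 h2; move: (Num.min _ _) `|t| => x y; clear; lra.
have low' t : u' <= t <= v' -> Om t /\ cmod (f t0) / 2 <= cmod (f t).
  by move=> /andP[h1 h2]; apply: low; rewrite (le_trans uu') //= (le_trans h2).
have := norm_le_lower hnu hp mOm fOm cf (lexx 0) (ltW e0) uv' low' far H.
by rewrite leNgt mulr_gt0 // powR_gt0 // subr_gt0.
Qed.

Lemma norm_value Om f : measurable Om -> fat Om -> rcont f -> nonzero_on Om f ->
  (nrm Om f < +oo)%E -> exists2 v, 0 < v & nrm Om f = v%:E.
Proof.
move=> mOm fOm cf nf lf; have := norm_le_neq0 mOm fOm cf nf; rewrite /norm_le => /negP; rewrite -ltNge.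
move: lf; case: (nrm Om f) => [v _|//|//]; rewrite lte_fin => v0.
by exists v.
Qed.

Lemma norm_le_finite Om f c : norm_le Om f c -> (nrm Om f < +oo)%E.
Proof. by move=> H; rewrite (le_lt_trans H) // ltry. Qed.

Lemma rcont_dilation f l : rcont f -> rcont (fun t => f (l * t)).
Proof.
move=> [c1 c2]; split => t.
  apply: (@continuous_comp _ _ _ (fun t : R => l * t) (fun t => complex.Re (f t))); last exact: c1.
  exact: mulrl_continuous.
apply: (@continuous_comp _ _ _ (fun t : R => l * t) (fun t => complex.Im (f t))); last exact: c2.
exact: mulrl_continuous.
Qed.

Lemma norm_scale f (k : R[i]) l v : rcont f -> nonzero_on setT f -> k != 0 -> 0 < l -> 0 < v ->
  nrm setT f = v%:E -> nrm setT (fun t => k * f (l * t)) = (cmod k * (l `^ (- s) * v))%:E.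
Proof.
move=> cf nf k0 l0 v0 fv.
have kc : 0 < cmod k by rewrite cmod_gt0.
have cl := rcont_dilation l cf.
have cg : rcont (fun t => k * f (l * t)) by apply: rcontM => //; exact: rcont_cst.
have ls0 : 0 < l `^ (- s) by exact: powR_gt0.
have fv' : norm_le setT f v by rewrite /norm_le fv.
have gv : norm_le setT (fun t => k * f (l * t)) (cmod k * (l `^ (- s) * v)).
  apply: (norm_leZ hp k measurableT fat_setT cl); first by rewrite mulr_ge0 ?ltW.
  by apply/(norm_le_setT nu hp l0 cf (ltW v0)).
have ng : nonzero_on setT (fun t => k * f (l * t)).
  have [t _ ft] := nf; exists (l^-1 * t) => //.
  have -> : l * (l^-1 * t) = t by rewrite mulrA mulfV ?gt_eqF // mul1r.
  by rewrite mulf_neq0.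
have [v' v'0 gv'] := norm_value measurableT fat_setT cg ng (norm_le_finite gv).
rewrite gv'; congr EFin; apply/eqP; rewrite eq_le; apply/andP; split.
  by move: gv; rewrite /norm_le gv' lee_fin.
have h1 : norm_le setT (fun t => k^-1 * (k * f (l * t))) (cmod k^-1 * v').
  by apply: (norm_leZ hp k^-1 measurableT fat_setT cg (ltW v'0)); rewrite /norm_le gv'.
have h2 : norm_le setT (fun t => f (l * t)) (l `^ (- s) * (l `^ s * ((cmod k)^-1 * v'))).
  move: h1; rewrite cmodV (_ : (fun t => k^-1 * (k * f (l * t))) = (fun t => f (l * t))); last first.
    by apply/funext => t; rewrite mulKf.
  by rewrite mulrA powRN mulVf ?gt_eqF ?powR_gt0 // mul1r.
have c0 : 0 <= l `^ s * ((cmod k)^-1 * v').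
  by rewrite mulr_ge0 ?powR_ge0 // mulr_ge0 ?invr_ge0 // ltW.
have := (norm_le_setT nu hp l0 cf c0).2 h2; rewrite /norm_le fv lee_fin => h3.
rewrite -ler_pdivlMl // powRN -ler_pdivlMl ?invr_gt0 ?powR_gt0 // invrK.
by [].
Qed.

End NormValues.

(** * The extremal problems in terms of coefficients *)

Section Ratios.
Context {R : realType}.
Variables (nu : R) (p : \bar R) (N : nat).
Hypotheses (hnu : - (1 / 2) <= nu) (hp : (0 < p)%E).
Local Notation norm_le := (norm_le nu p).
Local Notation nrm Om f := (weighted_norm Om (bessel_weight nu) p f).
Local Notation s := (scale_exp nu p).
Local Notation I := `[(-1 : R), 1]%classic.
Local Notation BeN := (iter N (bessel nu)).
Implicit Types (a : nat -> R[i]) (c l t u v x y : R) (q : {poly R[i]}).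

Definition bessel_value a := bessel_const nu N * cmod (a N.*2).

Lemma bessel_valueP a : ecoef a -> (forall j, odd j -> a j = 0) ->
  cmod (BeN (fun t => ps a t%:C) 0) = bessel_value a.
Proof.
move=> ea ao; rewrite iter_bessel_ps0 // cmodM cmod_real ger0_norm // ltW //.
exact: bessel_const_gt0.
Qed.

Definition entire_constant : \bar R :=
  sharp_constant setT (even_exp_type (1 : R) `&` weighted_Lp setT (bessel_weight nu) p)
    (weighted_norm setT (bessel_weight nu) p) BeN 0.

Definition poly_constant (n : nat) : \bar R :=
  sharp_constant I (@even_poly_deg_le R (n./2).*2) (weighted_norm I (bessel_weight nu) p) BeN 0.

Definition admissible a := [/\ ecoef a, forall j, odd j -> a j = 0 & exp_type 1 (ps a)].

Lemma admissible_even a z : admissible a -> ps a (- z) = ps a z.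
Proof.
move=> [ea ao _]; rewrite -mulN1r -ps_dilation; congr (ps _ z); apply/funext => k.
have [/ao ->|ok] := boolP (odd k); first by rewrite mulr0.
by rewrite -signr_odd (negbTE ok) expr0 mul1r.
Qed.

Lemma rcont_ps a : ecoef a -> rcont (fun t => ps a t%:C).
Proof. by move=> ea; apply: cdiff_rcont => z; exact: cdiff_ps. Qed.

Lemma nonzero_ps a k : ecoef a -> a k != 0 -> nonzero_on setT (fun t => ps a t%:C).
Proof.
move=> ea ak; apply: contrapT => H; case/eqP: ak; apply: ps_eq0 => // t.
by apply/eqP/negPn/negP => h; apply: H; exists t.
Qed.

Lemma rcont_measurable (f : R -> R[i]) (D : set R) : rcont f ->
  measurable_fun D (fun t => complex.Re (f t)) /\ measurable_fun D (fun t => complex.Im (f t)).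
Proof. by move=> [c1 c2]; split; apply: measurable_funTS; exact: continuous_measurable_fun. Qed.

Lemma admissible_mem a c : admissible a -> norm_le setT (fun t => ps a t%:C) c ->
  (even_exp_type (1 : R) `&` weighted_Lp setT (bessel_weight nu) p) (fun t => ps a t%:C).
Proof.
move=> aa fc; have [ea ao ta] := aa; split.
  exists (ps a); last by [].
  by split; [exact: ta|move=> z; exact: admissible_even].
have [m1 m2] := rcont_measurable setT (rcont_ps ea).
by split=> //; exact: norm_le_finite fc.
Qed.

Lemma entire_constant_ge a c : admissible a -> 0 < c -> norm_le setT (fun t => ps a t%:C) c ->
  a N.*2 != 0 -> ((bessel_value a / c)%:E <= entire_constant)%E.
Proof.
move=> aa c0 fc a0; have [ea ao ta] := aa; have cf := rcont_ps ea.
have nf := nonzero_ps ea a0.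
have [v v0 fv] := norm_value hnu hp measurableT fat_setT cf nf (norm_le_finite fc).
apply: le_ereal_sup_tmp; exists (bessel_value a / v)%:E.
  exists (fun t => ps a t%:C); first by split=> //; exact: admissible_mem fc.
  by rewrite (bessel_valueP ea ao) fv inver gt_eqF.
rewrite lee_fin ler_wpM2l ?mulr_ge0 ?cmod_ge0 ?(ltW (bessel_const_gt0 hnu _)) //.
by rewrite lef_pV2 ?posrE //; move: fc; rewrite /norm_le fv lee_fin.
Qed.

Lemma entire_constant_gt (y : \bar R) : (y < entire_constant)%E -> exists a v,
  [/\ admissible a, 0 < v, norm_le setT (fun t => ps a t%:C) v & (y < (bessel_value a / v)%:E)%E].
Proof.
move=> /ereal_sup_gt[_ [f [[[F [tF Fe] <-] [_ _ fin]] nf] <-]].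
have [C gF] := exp_type_growth (ltr1n _ 2 : 1 < 2) tF.
pose a := taylor_coeff F; have ea := ecoef_taylor (ler0n _ 2) gF.
have aF z : ps a z = F z by apply: ps_taylor gF; rewrite ler0n.
have ao j : odd j -> a j = 0.
  apply: (ps_even_coef ea) => z; rewrite (aF z) (aF (- z)); exact: Fe.
have fE : (fun t : R => F t%:C) = fun t => ps a t%:C by apply/funext => t; rewrite aF.
have aa : admissible a.
  split; [exact: ea|exact: ao|]; have -> : ps a = F by apply/funext.
  exact: tF.
rewrite fE in fin nf *.
have [v v0 fv] := norm_value hnu hp measurableT fat_setT (rcont_ps ea) nf fin.
rewrite (bessel_valueP ea ao) fv inver gt_eqF // => yv.
by exists a, v; split=> //; rewrite /norm_le fv.
Qed.

Lemma horner_dilation q c z : (q \Po (c%:C *: 'X)).[z] = q.[c%:C * z].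
Proof. by rewrite horner_comp hornerZ hornerX. Qed.

Lemma size_dilation q (c : R[i]) m : (size q <= m.+1)%N -> (size (q \Po (c *: 'X)) <= m.+1)%N.
Proof.
move=> sq; rewrite (leq_trans (size_comp_poly_leq _ _)) // ltnS.
have : (size (c *: 'X : {poly R[i]}) <= 2)%N.
  by rewrite (leq_trans (size_scale_leq _ _)) // size_polyX.
case: (size (c *: 'X)) => [|[|[|//]]] _; rewrite ?muln0 // muln1.
by move: sq; case: (size q).
Qed.

Lemma coef_dilation q (c : R[i]) k : (q \Po (c *: 'X))`_k = c ^+ k * q`_k.
Proof.
have e1 := ecoef_poly (q \Po (c *: 'X)).
have e2 : ecoef (fun j => c ^+ j * q`_j).
  move=> r r0; have cr0 : 0 < (cmod c + 1) * r by rewrite mulr_gt0 // ltr_wpDl ?cmod_ge0.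
  have [M HM] := ecoef_poly q cr0; exists M => j; rewrite (le_trans _ (HM j)) //.
  rewrite cmodM cmodX [cmod c ^+ j * _]mulrC -mulrA ler_wpM2l ?cmod_ge0 // -exprMn.
  rewrite lerXn2r ?nnegrE ?mulr_ge0 ?addr_ge0 ?cmod_ge0 ?(ltW r0) //.
  by rewrite ler_wpM2r ?(ltW r0) // lerDl.
apply/eqP; rewrite -subr_eq0 -mulN1r; apply/eqP.
apply: (@ps_eq0 _ (fun j => (q \Po (c *: 'X))`_j + -1 * (c ^+ j * q`_j))).
  by apply: ecoefD => //; exact: ecoefZ.
move=> t; rewrite psD ?psZ //; last exact: ecoefZ.
rewrite (ps_poly (q \Po (c *: 'X))) ps_dilation (ps_poly q) horner_comp hornerZ hornerX.
by rewrite mulN1r subrr.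
Qed.

Local Notation B q := (bessel_value (fun k => q`_k)).

Lemma poly_value q : (forall z, q.[- z] = q.[z]) -> cmod (BeN (fun t => q.[t%:C]) 0) = B q.
Proof.
move=> qe; have eq := ecoef_poly q.
have -> : (fun t : R => q.[t%:C]) = fun t => ps (fun k => q`_k) t%:C by apply/funext => t; rewrite ps_poly.
apply: bessel_valueP => // j; apply: (ps_even_coef eq) => z; by rewrite 2!ps_poly.
Qed.

Lemma rcont_poly q : rcont (fun t => q.[t%:C]).
Proof. by apply: cdiff_rcont => z; exact: cdiff_horner. Qed.

Definition scaled_constant n : \bar R :=
  ((n%:R `^ (- (2 * N)%:R - s))%:E * poly_constant n)%E.

Lemma scale_factor (n : nat) : (0 < n)%N ->
  n%:R `^ (- (2 * N)%:R - s) = (n%:R ^+ N.*2)^-1 * n%:R `^ (- s) :> R.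
Proof.
move=> n0; have nR : 0 < n%:R :> R by rewrite ltr0n.
rewrite powRD; last by rewrite (gt_eqF nR) implybT.
by rewrite (powRN _ (2 * N)%:R) (powR_mulrn _ (ltW nR)) mul2n.
Qed.

Lemma scaled_constant_gt (n : nat) x : (0 < n)%N -> (x%:E < scaled_constant n)%E -> exists q,
  [/\ (size q <= (n./2).*2.+1)%N, forall z, q.[- z] = q.[z],
    norm_le `[- n%:R, n%:R]%classic (fun t => q.[t%:C]) 1 & x < B q].
Proof.
move=> n0; have nR : 0 < n%:R :> R by rewrite ltr0n.
rewrite /scaled_constant scale_factor //; set k := (n%:R ^+ N.*2)^-1 * n%:R `^ _.
have k0 : 0 < k by rewrite mulr_gt0 ?powR_gt0 // invr_gt0 exprn_gt0.
rewrite -lte_pdivrMl // => /ereal_sup_gt[_ [f [[q [sq qe] <-] nf] <-]].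
have mI : measurable I by exact: measurable_itv.
have fI : fat I by exact: (fat_itv ltr01).
have cq := rcont_poly q.
have [v v0 fv] : exists2 v, 0 < v & nrm I (fun t => q.[t%:C]) = v%:E.
  apply: norm_value => //; suff [c _ qc] : exists2 c, 0 <= c & norm_le I (fun t => q.[t%:C]) c.
    exact: norm_le_finite qc.
  pose M := \sum_(j < size q) cmod q`_j.
  apply: (@norm_le_bounded _ _ _ hnu hp 1 _ M) => //; first by apply: sumr_ge0 => j _; exact: cmod_ge0.
  move=> t t1; rewrite horner_coef (le_trans (cmod_sum _ _ _)) //; apply: ler_sum => j _.
  by rewrite cmodM cmodX cmod_real ler_piMr ?cmod_ge0 // exprn_ile1.
rewrite poly_value // fv inver gt_eqF // -EFinM lte_fin => xq.
(* Stretching the polynomial to [[-n, n]] multiplies its norm by [n ^ s]; the factor [c] brings the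
   norm back to [1]. *)
pose c := (v * n%:R `^ s)^-1; have c0 : 0 < c by rewrite invr_gt0 mulr_gt0 // powR_gt0.
pose Q0 := q \Po ((n%:R^-1)%:C *: 'X).
have Q0E t : Q0.[t%:C] = q.[(n%:R^-1 * t)%:C] by rewrite horner_dilation rmorphM.
have vs0 : 0 <= v * n%:R `^ s by rewrite mulr_ge0 ?powR_ge0 // ltW.
have Q0n : norm_le `[- n%:R, n%:R]%classic (fun t => Q0.[t%:C]) (v * n%:R `^ s).
  apply/(norm_le_interval nu hp nR (rcont_poly Q0)); first by rewrite mulr_ge0 ?powR_ge0 // ltW.
  rewrite mulrCA powRN mulVf ?gt_eqF ?powR_gt0 // mulr1.
  have -> : (fun t => Q0.[(n%:R * t)%:C]) = fun t => q.[t%:C].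
    by apply/funext => t; rewrite Q0E mulrA mulVf ?gt_eqF // mul1r.
  by rewrite /norm_le fv.
exists (c%:C *: Q0); split.
- by rewrite (leq_trans (size_scale_leq _ _)) // size_dilation.
- by move=> z; rewrite !hornerZ !horner_dilation mulrN qe.
- have := norm_leZ hp c%:C (@measurable_itv _ _) (fat_itv nR) (rcont_poly Q0) vs0 Q0n.
  rewrite cmod_real ger0_norm ?(ltW c0) // mulVf ?gt_eqF ?mulr_gt0 ?powR_gt0 //.
  rewrite (_ : (fun t => (c%:C *: Q0).[t%:C]) = fun t => c%:C * Q0.[t%:C]); last first.
    by apply/funext => t; rewrite hornerZ.
  by [].
- move: xq; rewrite mulrC ltr_pdivrMr // => /lt_le_trans; apply.
  rewrite /bessel_value coefZ coef_dilation !cmodM cmodX !cmod_real !ger0_norm ?invr_ge0 ?(ltW nR) ?(ltW c0) //.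
  rewrite /k /c powRN exprVn le_eqVlt; apply/orP; left; apply/eqP.
  by rewrite invfM; ring.
Qed.

Lemma scaled_constant_ge (n : nat) q c : (0 < n)%N -> (size q <= (n./2).*2.+1)%N ->
  (forall z, q.[- z] = q.[z]) -> 0 < c -> norm_le `[- n%:R, n%:R]%classic (fun t => q.[t%:C]) c ->
  q`_(N.*2) != 0 -> ((B q / c)%:E <= scaled_constant n)%E.
Proof.
move=> n0 sq qe c0 qc q0; have nR : 0 < n%:R :> R by rewrite ltr0n.
rewrite /scaled_constant scale_factor //; set k := (n%:R ^+ N.*2)^-1 * n%:R `^ _.
have k0 : 0 < k by rewrite mulr_gt0 ?powR_gt0 // invr_gt0 exprn_gt0.
have mI : measurable I by exact: measurable_itv.
have fI : fat I by exact: (fat_itv ltr01).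
pose q1 := q \Po ((n%:R)%:C *: 'X).
have q1E t : q1.[t%:C] = q.[(n%:R * t)%:C] by rewrite horner_dilation rmorphM.
have q1c : norm_le I (fun t => q1.[t%:C]) (n%:R `^ (- s) * c).
  rewrite (_ : (fun t => q1.[t%:C]) = fun t => q.[(n%:R * t)%:C]); last by apply/funext.
  by apply/(norm_le_interval nu hp nR (rcont_poly q) (ltW c0)).
have q1k : q1`_(N.*2) = (n%:R)%:C ^+ N.*2 * q`_(N.*2) by exact: coef_dilation.
have q10 : q1`_(N.*2) != 0.
  by rewrite q1k mulf_neq0 // expf_neq0 // -cmod_gt0 cmod_real normr_gt0 gt_eqF.
have nq : nonzero_on I (fun t => q1.[t%:C]).
  apply: contrapT => H; case/negP: q10; rewrite -cmod_eq0 eq_le cmod_ge0 andbT.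
  have z t : `|t| <= 1 -> cmod q1.[t%:C] <= 0.
    move=> t1; rewrite le_eqVlt cmod_eq0; apply/orP; left; apply/negPn/negP => h; apply: H.
    by exists t => //=; rewrite in_itv /= -ler_norml.
  have := poly_coef_le_interval N.*2 (leqnSn (size q1)) ltr01 ltr01 z.
  by rewrite expr1n mulr1 mul0r mulr0.
have [v v0 fv] := norm_value hnu hp mI fI (rcont_poly q1) nq (norm_le_finite q1c).
have q1e z : q1.[- z] = q1.[z] by rewrite !horner_dilation mulrN qe.
apply: (@le_trans _ _ (k%:E * (B q1 / v)%:E)%E); last first.
  apply: lee_wpmul2l; first by rewrite lee_fin ltW.
  apply: ereal_sup_ubound; exists (fun t => q1.[t%:C]).
    by split=> //; exists q1 => //; split=> //; exact: size_dilation.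
  by rewrite poly_value // fv inver gt_eqF.
rewrite -EFinM lee_fin.
have vc : v <= n%:R `^ (- s) * c by move: q1c; rewrite /norm_le fv lee_fin.
have B0 : 0 <= B q by rewrite mulr_ge0 ?cmod_ge0 // ltW // bessel_const_gt0.
have -> : B q1 = n%:R ^+ N.*2 * B q.
  rewrite /bessel_value q1k cmodM cmodX cmod_real ger0_norm ?(ltW nR) //; ring.
have nN : n%:R ^+ N.*2 != 0 :> R by rewrite expf_neq0 // gt_eqF.
have -> : k * (n%:R ^+ N.*2 * B q / v) = B q * (n%:R `^ (- s) / v).
  by rewrite /k; field; rewrite nN gt_eqF.
apply: ler_wpM2l => //; rewrite ler_pdivlMr // mulrC ler_pdivrMr //.
Qed.

End Ratios.

(** * The limit of the sharp constants *)

(** The gap between [x] and [A] is split into three factors [q], spent in [scaled_constant_lower] on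
    the dilation, on the norm and on the coefficient of the approximating polynomial. *)
Lemma cube_room (R : realType) (x A : R) : 0 < x -> x < A -> exists q : R, 0 < q < 1 /\ x <= q ^+ 3 * A.
Proof.
move=> x0 xA; have A0 : 0 < A by exact: lt_trans xA.
pose r := x / A; have r1 : r < 1 by rewrite ltr_pdivrMr // mul1r.
have r0 : 0 < r by rewrite divr_gt0.
(* With [d = (1 - r) / 3], one has [(1 - d) ^+ 3 >= 1 - 3 * d = r]. *)
exists (1 - (1 - r) / 3); split; first by apply/andP; split; lra.
rewrite -ler_pdivrMr // -/r; move: r r0 r1 => r r0 r1.
have d0 : 0 < (1 - r) / 3 by rewrite divr_gt0 // subr_gt0.
have d1 : (1 - r) / 3 <= 1 by lra.
have E : r = 1 - 3 * ((1 - r) / 3) by field.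
rewrite [leLHS]E; move: ((1 - r) / 3) d0 d1 => d d0 d1.
rewrite !exprS expr0 mulr1; nra.
Qed.

Section SharpConstants.
Context {R : realType}.
Variables (nu : R) (p : \bar R) (N : nat).
Hypotheses (hnu : - (1 / 2) <= nu) (hp : (0 < p)%E).
Local Notation nrm Om f := (weighted_norm Om (bessel_weight nu) p f).
Local Notation s := (scale_exp nu p).
Local Notation BeN := (iter N (bessel nu)).
Local Notation Bv a := (bessel_value nu N a).
Local Notation C := (entire_constant nu p N).
Local Notation P := (scaled_constant nu p N).
Implicit Types (a b : nat -> R[i]) (c l t u v x y e : R) (q : {poly R[i]}).

Let B0 : 0 < bessel_const nu N := bessel_const_gt0 hnu N.

Lemma leq_even_degree (n : nat) : ((n./2).*2.+1 <= n.+1)%N.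
Proof. by rewrite ltnS -[leqRHS]odd_double_half leq_addl. Qed.

Lemma scaled_constant_bounded : exists2 K : R, 0 <= K & forall n, (0 < n)%N -> (P n <= K%:E)%E.
Proof.
have half : 0 < (1 / 2 : R) < 1 by apply/andP; split; lra.
have [K K0 HK] := norm_le_coef_bound hnu hp half.
exists (bessel_const nu N * (K * 1 * expR (1 / (1 - 1 / 2)))) => [|n n0].
  by rewrite mulr_ge0 ?(ltW B0) // mulr1 mulr_ge0 ?expR_ge0.
rewrite leNgt; apply/negP => /(scaled_constant_gt hnu hp n0)[q [sq _ qn]].
have := HK n q 1 N.*2 1 n0 (leq_trans sq (leq_even_degree n)) ler01 qn ltr01.
by rewrite expr1n mulr1 /bessel_value ltr_pM2l // ltNge => ->.
Qed.

Lemma taylor_coeff_ps b M T k : 0 <= T -> ecoef b -> growth_le (ps b) M T ->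
  taylor_coeff (ps b) k = b k.
Proof.
move=> T0 eb gb; have et := ecoef_taylor T0 gb.
apply/eqP; rewrite -subr_eq0 -mulN1r; apply/eqP.
apply: (@ps_eq0 _ (fun j => taylor_coeff (ps b) j + -1 * b j)).
  by apply: ecoefD => //; exact: ecoefZ.
move=> t; rewrite (psD t%:C et (ecoefZ (-1) eb)) (psZ (-1) _ eb).
by rewrite (ps_taylor _ T0 gb) mulN1r subrr.
Qed.

Let powR_one x : 1 `^ x = 1 :> R. Proof. by rewrite powR1. Qed.

Lemma dilation_room (q : R) : 0 < q < 1 -> exists l, 0 < l < 1 /\ q <= l ^+ N.*2 * l `^ s.
Proof.
move=> /andP[q0 q1]; have s0 : 0 <= s by exact: scale_exp_ge0.
pose w : R := (N.*2)%:R + s; have w0 : 0 <= w by rewrite addr_ge0.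
have w1 : 0 < w + 1 by rewrite ltr_wpDl.
(* The exponent uses [w + 1] rather than [w], which may be [0]; then
   [l ^ w = q ^ (w / (w + 1)) >= q]. *)
exists (q `^ (w + 1)^-1); split.
  rewrite powR_gt0 //= -[ltRHS](powR_one (w + 1)^-1).
  by rewrite gt0_ltr_powR ?invr_gt0 // nnegrE ltW.
set l := q `^ _; have l0 : 0 < l by rewrite powR_gt0.
rewrite -powR_mulrn ?(ltW l0) // -powRD; last by rewrite (gt_eqF l0) implybT.
rewrite -powRrM -[leLHS](powRr1 (ltW q0)) ger_powR ?q0 ?(ltW q1) //.
by rewrite mulrC ler_pdivrMr // mul1r lerDl.
Qed.

Lemma ecoef_dilation a l : 0 <= l -> ecoef a -> ecoef (fun k => l%:C ^+ k * a k).
Proof.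
move=> l0 ea r r0; have lr0 : 0 < (l + 1) * r by rewrite mulr_gt0 // ltr_wpDl.
have [M HM] := ea _ lr0; exists M => k; rewrite (le_trans _ (HM k)) //.
rewrite cmodM cmodX cmod_real ger0_norm // [l ^+ k * _]mulrC -mulrA ler_wpM2l ?cmod_ge0 //.
rewrite -exprMn lerXn2r ?nnegrE ?mulr_ge0 ?addr_ge0 ?(ltW r0) //.
by rewrite ler_wpM2r ?(ltW r0) // lerDl.
Qed.

(* A competitor is first dilated by [l < 1], which brings its type below [1] and makes it approximable. *)
Lemma scaled_constant_lower x : 0 < x -> (x%:E < C)%E ->
  exists J, forall n, (J <= n)%N -> (x%:E <= P n)%E.
Proof.
move=> x0 /(entire_constant_gt hnu hp)[a [v [aa v0 fv xv]]]; have [ea ao ta] := aa.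
rewrite lte_fin in xv.
have [q [q01 xq]] := cube_room x0 xv; have /andP[q0 q1] := q01.
have [l [l01 ql]] := dilation_room q01; have /andP[l0 l1] := l01.
pose b k := l%:C ^+ k * a k.
have bE z : ps b z = ps a (l%:C * z) by exact: ps_dilation.
have eb : ecoef b by apply: ecoef_dilation => //; exact: ltW.
(* A growth rate above [1], hence available for type 1, that becomes [T = (1 + l) / 2 < 1] after
   dilation by [l]. The rate [(l + 3) / 4] used below is midway between [T] and [1]. *)
have T1 : 1 < (1 + l^-1) / 2.
  rewrite ltr_pdivlMr // mul1r mulr2n ltrD2l invf_gt1 //.
have [C1 [_ gC]] := exp_type_growth T1 ta.
pose T := (1 + l) / 2.
have gb : growth_le (ps b) C1 T.
  split=> z; first exact: cdiff_ps.
  rewrite bE (le_trans (gC _)) // cmodM cmod_real ger0_norm ?(ltW l0) //.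
  rewrite le_eqVlt; apply/orP; left; apply/eqP; congr (_ * expR _).
  by rewrite /T; field; rewrite gt_eqF.
have T0 : 0 <= T by rewrite divr_ge0 // addr_ge0 // ltW.
have T2 : T <= 2 by rewrite /T; move: l1; lra.
have Tsg : T < (l + 3) / 4 by rewrite /T; move: l1; lra.
have sg1 : (l + 3) / 4 < 1 by move: l1; lra.
have ca := rcont_ps ea; have cb := rcont_ps eb.
pose c1 := l `^ (- s) * v; have c10 : 0 < c1 by rewrite mulr_gt0 // powR_gt0.
have bv : norm_le nu p setT (fun t => ps b t%:C) c1.
  rewrite (_ : (fun t : R => ps b t%:C) = fun t => ps a (l * t)%:C); last first.
    by apply/funext => t; rewrite bE rmorphM.
  by apply/(norm_le_setT nu hp l0 ca (ltW v0)).
have [M _ bM] := growth_bounded_real hnu hp gb T2 (ltW c10) bv.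
have be z : ps b (- z) = ps b z by rewrite !bE mulrN (admissible_even _ aa).
have [Q [K [th [K0 th01 HQ Qb Qc]]]] := even_approximants gb T2 T0 Tsg sg1 be bM.
pose dl := q^-1 - 1; have dl0 : 0 < dl by rewrite subr_gt0 invf_gt1.
have e0 n : 0 <= K * th ^+ n by case/andP: th01 => /ltW th0 _; rewrite mulr_ge0 ?exprn_ge0.
have [J1 H1] := norm_le_approx hnu hp (fun n => rcont_poly (Q n)) cb c10 dl0 bv Qb e0
  (fun k k0 => geometric_powR_small s K0 th01 k0).
have a0 : 0 < cmod (a N.*2).
  rewrite lt_neqAle cmod_ge0 andbT eq_sym; apply: contraTneq (lt_trans x0 xv) => a0.
  by rewrite /bessel_value a0 mulr0 mul0r ltxx.
have b0 : 0 < cmod (b N.*2).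
  by rewrite cmodM cmodX cmod_real ger0_norm ?(ltW l0) // mulr_gt0 // exprn_gt0.
have e1 : 0 < (1 - q) * cmod (b N.*2) by rewrite mulr_gt0 // subr_gt0.
have [J2 H2] := Qc N.*2 _ e1.
exists (maxn (maxn J1 J2) 1) => n; rewrite !geq_max => /andP[/andP[/H1 h1 /H2 h2] n0].
rewrite (taylor_coeff_ps _ T0 eb gb) in h2.
have qb : q * cmod (b N.*2) <= cmod (Q n)`_(N.*2).
  have := cmod_lerB (b N.*2) (Q n)`_(N.*2); rewrite cmod_distC => /le_trans/(_ h2).
  by rewrite lerBlDr -lerBlDl mulrBl mul1r opprB addrCA subrr addr0.
have Q0 : (Q n)`_(N.*2) != 0 by rewrite -cmod_gt0 (lt_le_trans _ qb) // mulr_gt0.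
have [sQ eQ] := HQ n.
have c0 : 0 < (1 + dl) * c1 by rewrite mulr_gt0 // addr_gt0.
apply: le_trans (scaled_constant_ge hnu hp n0 sQ eQ c0 h1 Q0); rewrite lee_fin.
rewrite (le_trans xq) // ler_pdivlMr //.
have -> : 1 + dl = q^-1 by rewrite /dl addrC subrK.
have -> : q ^+ 3 * (Bv a / v) * (q^-1 * c1) =
    bessel_const nu N * (q * (cmod (a N.*2) * (q * l `^ (- s)))).
  by rewrite /c1 /bessel_value; field; rewrite !gt_eqF.
rewrite /bessel_value ler_pM2l // (le_trans _ qb) // ler_pM2l //.
rewrite cmodM cmodX cmod_real ger0_norm ?(ltW l0) // [leRHS]mulrC ler_pM2l //.
by rewrite powRN ler_pdivrMr ?powR_gt0.
Qed.

(** The hypothesis says that [x] is at most the upper limit of [P]. It is used with the sharp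
    constant itself, to obtain an extremal function, and with larger values, to reach a
    contradiction. *)
Lemma extremal_coefficients x : (forall e, 0 < e -> forall J, exists2 n, (J <= n)%N & ((x - e)%:E < P n)%E) ->
  exists a, [/\ admissible a, expo_coef a, norm_le nu p setT (fun t => ps a t%:C) 1 & x <= Bv a].
Proof.
move=> H; have H1 (j : nat) : exists nq : nat * {poly R[i]}, [/\ (j < nq.1)%N, (size nq.2 <= nq.1.+1)%N,
    forall z, nq.2.[- z] = nq.2.[z], norm_le nu p `[- nq.1%:R, nq.1%:R]%classic (fun t => nq.2.[t%:C]) 1
    & x - 2^-1 ^+ j < Bv (fun k => nq.2`_k)].
  have h0 : 0 < 2^-1 ^+ j :> R by rewrite exprn_gt0 // invr_gt0.
  have [n jn Hn] := H _ h0 j.+1; have n0 : (0 < n)%N by exact: leq_ltn_trans jn.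
  have [q [sq qe qn xq]] := scaled_constant_gt hnu hp n0 Hn.
  by exists (n, q); split=> //=; exact: leq_trans sq (leq_even_degree n).
have [f Hf] := choice H1.
have [a [ea ao an xa]] : exists a, [/\ expo_coef a, forall k, odd k -> a k = 0,
    norm_le nu p setT (fun t => ps a t%:C) 1 & x / bessel_const nu N <= cmod (a N.*2)].
  apply: (@extremal_limit _ nu p hnu hp (fun j => (f j).2) (fun j => (f j).1)).
  - by move=> j; have [] := Hf j.
  - by move=> j; have [] := Hf j.
  - by move=> j; have [] := Hf j.
  - by move=> j; have [] := Hf j.
  move=> e e0; have [J HJ] := @half_power_small R 1 (e * bessel_const nu N) ler01 (mulr_gt0 e0 B0).
  exists J => j /HJ; rewrite mul1r => hj; have [_ _ _ _ xq] := Hf j.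
  rewrite -(ler_pM2l B0) mulrBr mulrCA mulfV ?gt_eqF // mulr1 (le_trans _ (ltW xq)) //.
  by rewrite lerB // mulrC.
exists a; split=> //; last by rewrite /bessel_value -ler_pdivrMl // mulrC.
by split=> //; [exact: expo_coef_ecoef|exact: ps_exp_type].
Qed.

(** [C] is finite because every positive real below it is eventually a lower bound of the bounded
    sequence [P]. If [P] exceeded [c + e] infinitely often, a limit of its near-extremal polynomials
    would be a competitor with ratio above [C]. *)
Lemma sharp_constant_limit : exists c a, [/\ 0 < c, C = c%:E, P n @[n --> \oo] --> C,
  admissible a /\ expo_coef a & norm_le nu p setT (fun t => ps a t%:C) 1 /\ c <= Bv a].
Proof.
have [K K0 HK] := scaled_constant_bounded.
have Cpos : (0 < C)%E.
  have [a [ea ta ae [c c0 ac] a0]] := test_function hnu hp N.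
  have aa : admissible a by split=> // j; exact: ps_even_coef.
  have c1 : 0 < c + 1 by rewrite ltr_wpDl.
  have ac1 : norm_le nu p setT (fun t => ps a t%:C) (c + 1) by apply: norm_leW ac; rewrite lerDl.
  apply: lt_le_trans (entire_constant_ge hnu hp aa c1 ac1 a0).
  by rewrite lte_fin divr_gt0 // mulr_gt0 // cmod_gt0.
have Cfin : (C < +oo)%E.
  rewrite ltey; apply/eqP => CE; have x0 : 0 < K + 1 by rewrite ltr_wpDl.
  have [|J HJ] := scaled_constant_lower x0; first by rewrite CE ltry.
  have := le_trans (HJ (maxn J 1) (leq_maxl _ _)) (HK (maxn J 1) (leq_maxr _ _)).
  by rewrite lee_fin gerDl ler10.
have [c c0 CE] : exists2 c, 0 < c & C = c%:E.
  move: Cpos Cfin; case: C => [c c0 _|//|//].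
  by exists c.
have upper e : 0 < e -> exists J, forall n, (J <= n)%N -> (P n <= (c + e)%:E)%E.
  move=> e0; apply: contrapT => H.
  have [|a [aa _ an xa]] := @extremal_coefficients (c + e).
    move=> d d0 J; apply: contrapT => H'; apply: H; exists J => n Jn.
    rewrite leNgt; apply/negP => h; apply: H'; exists n => //; apply: le_lt_trans h.
    by rewrite lee_fin gerBl ltW.
  have a0 : a N.*2 != 0.
    rewrite -cmod_gt0 -(pmulr_rgt0 _ B0); apply: lt_le_trans xa; exact: addr_gt0.
  have := entire_constant_ge hnu hp aa ltr01 an a0.
  by rewrite CE divr1 lee_fin leNgt (lt_le_trans _ xa) // ltrDl.
have lower e : 0 < e -> exists J, forall n, (J <= n)%N -> ((c - e)%:E <= P n)%E.
  move=> e0; pose x := Num.max (c - e) (c / 2).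
  have x0 : 0 < x by rewrite lt_max divr_gt0 ?orbT.
  have xc : (x%:E < C)%E.
    rewrite CE lte_fin gt_max gtrBl e0 /= ltr_pdivrMr // mulr_natr mulr2n ltrDl //.
  have [J HJ] := scaled_constant_lower x0 xc; exists J => n /HJ; apply: le_trans.
  by rewrite lee_fin le_max lexx.
have Plim : P n @[n --> \oo] --> C.
  rewrite CE; apply/fine_cvgP; split.
    have [J1 H1] := upper 1 ltr01; have [J2 H2] := lower 1 ltr01.
    exists (maxn J1 J2) => // n /=; rewrite geq_max => /andP[/H1 h1 /H2 h2].
    by rewrite fin_numElt (lt_le_trans (ltNyr _) h2) (le_lt_trans h1 (ltry _)).
  apply/cvgrPdist_le => e e0; have [J1 H1] := upper e e0; have [J2 H2] := lower e e0.
  exists (maxn J1 J2) => // n /=; rewrite geq_max => /andP[/H1 h1 /H2 h2].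
  move: h1 h2; case: (P n) => [y|//|//] /=; rewrite !lee_fin => h1 h2.
  by rewrite distrC ler_distl h1 h2.
have [|a [aa ea an xa]] := @extremal_coefficients c.
  move=> e e0 J; have e2 : 0 < e / 2 by rewrite divr_gt0.
  have [J' HJ] := lower _ e2; exists (maxn J J'); first exact: leq_maxl.
  apply: lt_le_trans (HJ _ (leq_maxr _ _)); rewrite lte_fin ltrD2l ltrN2.
  by rewrite ltr_pdivrMr // mulr_natr mulr2n ltrDl.
by exists c, a; split.
Qed.

Lemma iter_bessel_coef_dilation n a w k :
  iter n (bessel_coef nu) (fun k => w ^+ k * a k) k = w ^+ n.*2 * (w ^+ k * iter n (bessel_coef nu) a k).
Proof.
elim: n k => [|n IH] k /=; first by rewrite expr0 mul1r.
by rewrite /bessel_coef IH doubleS !exprS; ring.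
Qed.

Lemma scale_exp_infty : scale_exp nu +oo%E = 0.
Proof. by have [[]|[r []]] := exponent_cases nu (ltry 0 : (0 < +oo)%E). Qed.

Lemma scale_exp_eq0 : s = 0 -> p = +oo%E.
Proof.
have [[//]|[r [pE r0 ->]]] := exponent_cases nu hp.
have h : 0 < 2 * nu + 2 by move: hnu; lra.
by move=> /eqP; rewrite mulf_eq0 invr_eq0 (gt_eqF r0) (gt_eqF h).
Qed.

(* Dilating an extremal function of norm [1] by [l] multiplies the ratio of its norms by [l ^ (2 N + s)];
   [l] is chosen so that the ratio becomes the sharp constant.  When [2 N + s = 0] the ratio is already [1]. *)
Lemma extremal_function : exists f0 : R -> R[i],
  [/\ (even_exp_type (1 : R) `&` weighted_Lp setT (bessel_weight nu) p) f0, nonzero_on setT f0 &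
    (weighted_norm setT (bessel_weight nu) +oo%E (BeN f0) / nrm setT f0)%E = C].
Proof.
have [c [a [c0 CE _ [aa ea] [an ca]]]] := sharp_constant_limit.
have [eca ao ta] := aa; have cf := rcont_ps eca.
have a0 : a N.*2 != 0 by rewrite -cmod_gt0 -(pmulr_rgt0 _ B0) (lt_le_trans c0).
have nf := nonzero_ps eca a0.
have [v v0 fv] := norm_value hnu hp measurableT fat_setT cf nf (norm_le_finite an).
have av : norm_le nu p setT (fun t => ps a t%:C) v by rewrite /norm_le fv.
(* The ratio [Bv a / v] is at most [c], while [c <= Bv a]; hence the norm cannot be below [1]. *)
have v1 : v = 1.
  apply/eqP; rewrite eq_le; apply/andP; split; first by move: an; rewrite /norm_le fv lee_fin.
  have := entire_constant_ge hnu hp aa v0 av a0; rewrite CE lee_fin ler_pdivrMr // => h.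
  by rewrite -(ler_pM2l c0) mulr1 (le_trans ca).
have hy : (0 < +oo :> \bar R)%E by exact: ltry.
pose g t := ps (iter N (bessel_coef nu) a) t%:C.
have eg : ecoef (iter N (bessel_coef nu) a) by exact: ecoef_iter_bessel.
have cg : rcont g by exact: rcont_ps.
have [C1 gC] := exp_type_growth (ltr1n _ 2 : 1 < 2) ta.
have [M _ fM] := growth_bounded_real hnu hp gC (lexx 2) ler01 an.
have [M' M'0 gM] := iter_bessel_bounded hnu N (ler0n _ 2) (lexx 2) eca ao gC fM.
have g0 : cmod (g 0) = Bv a.
  by rewrite -(bessel_valueP N hnu eca ao) (iter_bessel_ps nu N eca ao).
have ng : nonzero_on setT g.
  by exists 0 => //; rewrite -cmod_gt0 g0 (lt_le_trans c0).
have gM' : norm_le nu +oo%E setT g M' by apply/(norm_le_infty nu erefl M'0 fat_setT cg) => t _; exact: gM.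
have [m m0 gm] := norm_value hnu hy measurableT fat_setT cg ng (norm_le_finite gM').
(* The supremum [m] dominates the value at [0], possibly strictly. *)
have cm : c <= m.
  rewrite (le_trans ca) // -g0.
  have gm' : norm_le nu +oo%E setT g m by rewrite /norm_le gm.
  exact: ((norm_le_infty nu erefl (ltW m0) fat_setT cg).1 gm' 0 I).
have s0 : 0 <= s by exact: scale_exp_ge0.
have [w0|w0] := ltP 0 ((N.*2)%:R + s); last first.
  have [N0 s00] : N = 0%N /\ s = 0.
    have n0 : 0 <= (N.*2)%:R :> R by [].
    have Ns : (N.*2)%:R = 0 :> R by move: w0 s0 n0; lra.
    by split; [move/eqP : Ns; rewrite pnatr_eq0 double_eq0 => /eqP|move: w0 s0 n0; lra].
  have py := scale_exp_eq0 s00.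
  exists (fun t => ps a t%:C); split=> //; first exact: admissible_mem an.
  have -> : BeN (fun t => ps a t%:C) = (fun t => ps a t%:C) by rewrite N0.
  rewrite (_ : weighted_norm _ _ +oo _ = nrm setT (fun t => ps a t%:C)); last by rewrite py.
  rewrite fv v1 inver oner_eq0 invr1 mule1 CE; congr EFin.
  apply/eqP; rewrite eq_le; apply/andP; split; last first.
    rewrite (le_trans ca) // /bessel_value N0 /bessel_const big_ord0 mul1r -(ps0 eca).
    by have := (norm_le_infty nu py ler01 fat_setT cf).1 an 0 I.
  (* For [N = 0] and [p = +oo] the constant function [1] is a competitor with ratio [1], so
     [c >= 1]. *)
  have e1 := ecoef_poly (1 : {poly R[i]}).
  have p1 z : ps (fun k => (1 : {poly R[i]})`_k) z = 1 by rewrite (ps_poly 1) hornerC.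
  have a1 : admissible (fun k => (1 : {poly R[i]})`_k).
    split=> //; first by move=> j; rewrite coefC; case: j.
    split; first by apply/entire_cdiff => z; exact: cdiff_ps.
    move=> e e0; exists 1 => z; rewrite p1 cmod1 mul1r (le_trans _ (expR_ge1Dx _)) //.
    by rewrite lerDl !mulr_ge0 ?cmod_ge0 // addr_ge0 // ltW.
  have n1 : norm_le nu p setT (fun t => ps (fun k => (1 : {poly R[i]})`_k) t%:C) 1.
    by apply/(norm_le_infty nu py ler01 fat_setT (rcont_ps e1)) => t _; rewrite p1 cmod1.
  have := @entire_constant_ge _ nu p N hnu hp _ 1 a1 ltr01 n1.
  rewrite CE divr1 lee_fin N0 /bessel_value /bessel_const big_ord0 mul1r coefC /= cmod1; apply.
  exact: oner_neq0.
pose l := (c / m) `^ ((N.*2)%:R + s)^-1.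
have l0 : 0 < l by rewrite powR_gt0 // divr_gt0.
(* This follows from [c <= m]; a dilation by [l <= 1] does not raise the type above [1]. *)
have l1 : l <= 1.
  rewrite /l -[leRHS](powR_one ((N.*2)%:R + s)^-1) ge0_ler_powR ?invr_ge0 ?(ltW w0) // ?nnegrE ?divr_ge0 ?(ltW c0) ?(ltW m0) //.
  by rewrite ler_pdivrMr // mul1r.
have lE : l ^+ N.*2 * l `^ s = c / m.
  rewrite -powR_mulrn ?(ltW l0) // -powRD; last by rewrite (gt_eqF l0) implybT.
  by rewrite -powRrM mulVf ?gt_eqF // powRr1 // divr_ge0 // ltW.
pose b k := l%:C ^+ k * a k.
have bE z : ps b z = ps a (l%:C * z) by exact: ps_dilation.
have eb : ecoef b by apply: ecoef_dilation => //; exact: ltW.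
have bo j : odd j -> b j = 0 by move=> /ao; rewrite /b => ->; rewrite mulr0.
have ab : admissible b.
  split=> //; apply: ps_exp_type => e /ea[M1 HM1]; exists M1 => k r r0.
  rewrite (le_trans _ (HM1 k r r0)) // ler_wpM2r ?exprn_ge0 ?(ltW r0) // cmodM cmodX cmod_real.
  by rewrite ler_piMl ?cmod_ge0 // exprn_ile1 // ger0_norm // ltW.
have fb : nrm setT (fun t => ps b t%:C) = (l `^ (- s))%:E.
  have := norm_scale hnu hp cf nf (oner_neq0 _) l0 v0 fv.
  rewrite cmod1 mul1r v1 mulr1 => <-; congr (weighted_norm _ _ _ _).
  by apply/funext => t; rewrite bE mul1r rmorphM.
have gb : weighted_norm setT (bessel_weight nu) +oo%E (BeN (fun t => ps b t%:C)) = (l ^+ N.*2 * m)%:E.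
  have lk : l%:C ^+ N.*2 != 0 :> R[i] by rewrite expf_neq0 // fmorph_eq0 gt_eqF.
  have := norm_scale hnu hy cg ng lk l0 m0 gm.
  rewrite scale_exp_infty oppr0 powRr0 mul1r cmodX cmod_real ger0_norm ?(ltW l0) // => <-.
  congr (weighted_norm _ _ _ _); rewrite iter_bessel_ps //; apply/funext => t.
  rewrite /g rmorphM -ps_dilation -psZ; last by apply: ecoef_dilation => //; exact: ltW.
  by apply: ps_ext => k; rewrite iter_bessel_coef_dilation.
exists (fun t => ps b t%:C); split.
- by apply: (@admissible_mem _ _ _ _ (l `^ (- s)) ab); rewrite /norm_le fb.
- apply: (@nonzero_ps _ _ N.*2) => //; rewrite mulf_neq0 // expf_neq0 // fmorph_eq0 gt_eqF //.
have ls : (l `^ (- s) == 0) = false by rewrite gt_eqF // powR_gt0.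
rewrite gb fb inver ls -EFinM CE; congr EFin.
by rewrite powRN invrK mulrAC lE divfK // gt_eqF.
Qed.

End SharpConstants.

Theorem theorem4p1 (R : realType) (nu : R) (N : nat) (p : \bar R)
    (hnu : - (1 / 2) <= nu) (hp : (0 < p)%E) :
  let w := bessel_weight nu in
  let I := `[(-1 : R), 1]%classic in
  let E := even_exp_type (1 : R) `&` weighted_Lp setT w p in
  let BeN := iter N (bessel nu) in
  let scaled_poly_constant (n : nat) : \bar R :=
    ((n%:R `^ (- (2 * N)%:R - (2 * nu + 2) * fine (p^-1)%E))%:E
     * sharp_constant I (@even_poly_deg_le R (n./2).*2)
         (weighted_norm I w p) BeN 0)%E in
  let entire_constant : \bar R :=
    sharp_constant setT E (weighted_norm setT w p) BeN 0 in
  [/\ entire_constant \is a fin_num,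
      scaled_poly_constant n @[n --> \oo] --> entire_constant &
      exists f0 : R -> R[i],
        [/\ E f0, nonzero_on setT f0 &
            scaled_poly_constant n @[n --> \oo] -->
              (weighted_norm setT w +oo%E (BeN f0)
               / weighted_norm setT w p f0)%E]].
Proof.
have [c [a [_ CE lim _ _]]] := sharp_constant_limit N hnu hp.
have [f0 [Ef0 nf0 f0C]] := extremal_function N hnu hp.
split; [|exact: lim|].
  by have := fin_numE c%:E; rewrite -CE => ->; rewrite CE.
by exists f0; split=> //; rewrite f0C; exact: lim.
Qed.
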